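(* Let $\rho\in\mathcal{P}(\Omega_{\mathrm{input}})$ be such that, under $\rho$, $(B,W)$ is a standard two-dimensional Wiener process with respect to the filtration $\mathbb{F}^{B,W,\mu}$. Then $\mathcal{R}^+(\rho)$ is convex and compact (in the weak topology of $\mathcal{P}(\Omega)$) and equals the closure of $\mathcal{R}_0(\rho)$. Moreover $\mathcal{R}^+(\rho)=\mathcal{R}(\rho)$.
   Context: Fix $T\in(0,\infty)$, $\mathcal{C}=C([0,T])$ with the sup norm; for Polish $E$, $\mathcal{P}(E)$ is the space of Borel probability measures with the weak topology. $\Omega_{\mathrm{input}}=\mathcal{C}^2\times\mathcal{P}(\mathcal{C}\times[0,T])$ and $\Omega=\Omega_{\mathrm{input}}\times[0,T]$, with canonical projections $(B,W,\mu,\tau)$. $\mathbb{F}^B,\mathbb{F}^W$ are the raw natural filtrations; $\mathcal{F}^\tau_t=\sigma\{\tau\wedge t\}$; on $\mathcal{C}\times[0,T]$, $\mathcal{F}^{W,\tau}_t$ is generated by $(w,s)\mapsto(w_{\cdot\wedge t},s\wedge t)$; $\mathcal{F}^\mu_t=\sigma\{\mu(C):C\in\mathcal{F}^{W,\tau}_t\}$; joint filtrations use combined superscripts, and $\mathcal{F}_{t+}=\bigcap_{s>t}\mathcal{F}_s$. Three sets of measures on $\Omega$, each consisting of $P\in\mathcal{P}(\Omega)$ whose $\Omega_{\mathrm{input}}$-marginal is $\rho$, and additionally: $\mathcal{R}^+(\rho)$: $\mathcal{F}^\tau_{t+}$ is conditionally independent of $(B,W,\mu)$ given $\mathcal{F}^{B,W,\mu}_{t+}$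 for every $t\in[0,T)$; $\mathcal{R}(\rho)$: $\mathcal{F}^\tau_t$ is conditionally independent of $(B,W,\mu)$ given $\mathcal{F}^{B,W,\mu}_t$ for every $t\in[0,T)$; $\mathcal{R}_0(\rho)$: $\tau$ is a stopping time relative to the $P$-completion of $\mathbb{F}^{B,W,\mu}$ and $\tau=\hat\tau(B,W,\mu)$ $P$-a.s. for some continuous $\hat\tau:\Omega_{\mathrm{input}}\to[0,T]$. *)

(* Defs.v *)
From HB Require Import structures.
From mathcomp Require Import all_boot all_order all_algebra.
From mathcomp Require Import all_classical all_reals all_analysis.
From mathcomp Require Import measurable_realfun giry.
Set Implicit Arguments. Unset Strict Implicit. Unset Printing Implicit Defensive.
Import Order.TTheory GRing.Theory Num.Def Num.Theory.
Import numFieldTopology.Exports.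
Local Open Scope classical_set_scope.
Local Open Scope ring_scope.

#[short(type="topMeasType")]
HB.structure Definition TopMeasurable d := {T of Measurable d T & Topological T}.

Definition borel (X : ptopologicalType) : Type := X.
HB.instance Definition _ (X : ptopologicalType) := PointedTopological.on (borel X).

Definition borel_display : measure_display. Proof. by constructor. Qed.

Section borel.
Variable X : ptopologicalType.
Definition borel_sets : set (set (borel X)) := <<s open >>.
Let b0 : borel_sets set0. Proof. exact: sigma_algebra0. Qed.
Let bC (U : set (borel X)) : borel_sets U -> borel_sets (~` U).
Proof. exact: sigma_algebraC. Qed.
Let bU (F : (set (borel X))^nat) : (forall i, borel_sets (F i)) -> borel_sets (\bigcup_i F i).
Proof. exact: sigma_algebra_bigcup. Qed.
HB.instance Definition _ := @isMeasurable.Build borel_display (borel X) borel_sets b0 bC bU.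
End borel.


Section time.
Variables (R : realType) (T : {posnum R}).
Definition Iset : set R := `[0, T%:num]%classic.
Lemma Iset0 : 0 \in Iset.
Proof. by rewrite inE /Iset /= in_itv /= lexx /=. Qed.
Definition Iraw := set_type Iset.
HB.instance Definition _ := Topological.on Iraw.
HB.instance Definition _ := isPointed.Build Iraw (exist _ 0 Iset0).
Definition time := borel Iraw.
Definition time0 : time := exist _ 0 Iset0.
Definition Craw := set_type [set f : {uniform time -> R} | continuous (f : time -> R)].
End time.
Section craw.
Variables (R : realType) (T : {posnum R}).
Lemma cont0 : [set f : {uniform time T -> R} | continuous (f : time T -> R)] (fun _ => 0).
Proof. exact: cst_continuous. Qed.
Lemma cont0' : ((fun _ => 0) : {uniform time T -> R}) \in [set f : {uniform time T -> R} | continuous (f : time T -> R)].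
Proof. exact: mem_set cont0. Qed.
HB.instance Definition _ := Topological.on (Craw T).
HB.instance Definition _ := isPointed.Build (Craw T) (@exist _ (fun x => x \in [set f : {uniform time T -> R} | continuous (f : time T -> R)]) _ cont0').
Definition Cpath := borel (Craw T).
Definition Cev (w : Cpath) (u : time T) : R := sval w u.
End craw.

Section PM.
Context d (X : topMeasType d) (R : realType).
Definition PMraw := probability X R.
HB.instance Definition _ := gen_eqMixin PMraw.
HB.instance Definition _ := gen_choiceMixin PMraw.
HB.instance Definition _ := isPointed.Build PMraw (\d_(point : X) : probability X R)%R.
Definition BC := {f : X -> R | continuous f /\ exists M : R, forall x, `|f x| <= M}.
Definition integ (P : PMraw) : {ptws BC -> R} := fun f => fine (\int[P]_x (sval f x)%:E)%E.
Definition PMtop := initial_topology integ.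
HB.instance Definition _ := Pointed.on PMtop.
Definition PM := borel PMtop.
Definition PMof (P : PM) : probability X R := P.
End PM.

HB.saturate prod.
Section spaces.
Variables (R : realType) (T : {posnum R}).
Definition Ein := (Cpath T * time T)%type.
HB.instance Definition _ := TopMeasurable.on Ein.
Definition Omega_in := (Cpath T * Cpath T * PM Ein R)%type.
HB.instance Definition _ := TopMeasurable.on Omega_in.
Definition Omega := (Omega_in * time T)%type.
HB.instance Definition _ := TopMeasurable.on Omega.
Definition PMOmega := PM Omega R.
HB.instance Definition _ := TopMeasurable.on PMOmega.
End spaces.

Definition preim {Om : Type} {d} {Y : measurableType d} (f : Om -> Y) : set (set Om) :=
  preimage_set_system setT f measurable.

Definition fplus {R : realType} {Om : Type} (F : R -> set (set Om)) (t : R) : set (set Om) :=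
  [set A | forall s, t < s -> F s A].

Definition is_condprob {d} {Om : measurableType d} {R : realType}
  (P : probability Om R) (G : set (set Om)) (A : set Om) (f : Om -> R) : Prop :=
  (forall U : set R, measurable U -> G (f @^-1` U)) /\
  (forall S, G S -> (\int[P]_(x in S) (f x)%:E)%E = P (A `&` S)).

Definition cond_indep {d} {Om : measurableType d} {R : realType}
  (P : probability Om R) (F1 F2 G : set (set Om)) : Prop :=
  forall A1 A2, F1 A1 -> F2 A2 ->
    exists f1 f2 : Om -> R,
      [/\ is_condprob P G A1 f1, is_condprob P G A2 f2 &
          is_condprob P G (A1 `&` A2) (f1 \* f2)].

Section filtrations.
Variables (R : realType) (T : {posnum R}).
Local Notation Ein := (Ein T).
Local Notation Omega_in := (Omega_in T).
Local Notation Omega := (Omega T).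

Definition Bin (x : Omega_in) : Cpath T := x.1.1.
Definition Win (x : Omega_in) : Cpath T := x.1.2.
Definition muin (x : Omega_in) : probability Ein R := PMof x.2.
Definition tau (w : Omega) : R := val w.2.

Definition FWtau (t : R) : set (set Ein) :=
  <<s (\bigcup_(u in [set u : time T | val u <= t]) preim (fun p : Ein => Cev p.1 u))
      `|` preim (fun p : Ein => Order.min (val p.2) t) >>.

Definition FBWmu_in (t : R) : set (set Omega_in) :=
  <<s (\bigcup_(u in [set u : time T | val u <= t])
          (preim (fun x : Omega_in => Cev (Bin x) u) `|` preim (fun x : Omega_in => Cev (Win x) u)))
      `|` (\bigcup_(C in FWtau t) preim (fun x : Omega_in => muin x C)) >>.

Definition FBWmu (t : R) : set (set Omega) :=
  preimage_set_system setT fst (FBWmu_in t).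

Definition Ftau (t : R) : set (set Omega) :=
  preim (fun w : Omega => Order.min (tau w) t).

Definition sigBWmu : set (set Omega) := preim (fst : Omega -> Omega_in).
End filtrations.

Section relaxed.
Variables (R : realType) (T : {posnum R}).
Local Notation Omega_in := (Omega_in T).
Local Notation Omega := (Omega T).
Local Notation PMOmega := (PMOmega T).
Local Open Scope ereal_scope.

Definition lawO (P : PMOmega) : probability Omega R := PMof P.

Definition has_marginal (rho : probability Omega_in R) (P : PMOmega) : Prop :=
  forall A : set Omega_in, measurable A -> lawO P (A `*` setT) = rho A.

Definition Rplus (rho : probability Omega_in R) : set PMOmega :=
  [set P | has_marginal rho P /\
     forall t : R, (0 <= t < T%:num)%R ->
       cond_indep (lawO P) (fplus (@Ftau R T) t) (@sigBWmu R T) (fplus (@FBWmu R T) t)].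

Definition Rrel (rho : probability Omega_in R) : set PMOmega :=
  [set P | has_marginal rho P /\
     forall t : R, (0 <= t < T%:num)%R ->
       cond_indep (lawO P) (@Ftau R T t) (@sigBWmu R T) (@FBWmu R T t)].

Definition in_completion (P : probability Omega R) (F : set (set Omega)) (S : set Omega) : Prop :=
  exists A, F A /\ P.-negligible ((S `\` A) `|` (A `\` S)).

Definition R0 (rho : probability Omega_in R) : set PMOmega :=
  [set P | has_marginal rho P /\
     (forall t : R, (0 <= t <= T%:num)%R ->
        in_completion (lawO P) (@FBWmu R T t) [set w : Omega | (tau w <= t)%R]) /\
     exists tauhat : Omega_in -> time T, continuous tauhat /\
        {ae lawO P, forall w : Omega, w.2 = tauhat w.1}].

Definition convex_PM (S : set PMOmega) : Prop :=
  forall (P Q M : PMOmega) (l : R), S P -> S Q -> (0 <= l <= 1)%R ->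
    (forall A : set Omega, measurable A ->
       lawO M A = (l%:E * lawO P A + (1 - l)%:E * lawO Q A)) ->
    S M.

Definition std_wiener2 (rho : probability Omega_in R) : Prop :=
  rho [set x | Cev (Bin x) (time0 T) = 0%R /\ Cev (Win x) (time0 T) = 0%R] = 1 /\
  forall s t : time T, (val s < val t)%R ->
  forall A : set Omega_in, FBWmu_in (val s) A ->
  forall D1 D2 : set R, measurable D1 -> measurable D2 ->
    rho (A `&` [set x | D1 (Cev (Bin x) t - Cev (Bin x) s)%R /\ D2 (Cev (Win x) t - Cev (Win x) s)%R])
    = rho A * normal_prob 0%R (Num.sqrt (val t - val s)) D1
            * normal_prob 0%R (Num.sqrt (val t - val s)) D2.
End relaxed.

(* Main.v *)
Require Import Defs.
From HB Require Import structures.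
From mathcomp Require Import all_boot all_order all_algebra.
From mathcomp Require Import all_classical all_reals all_analysis.
From mathcomp Require Import measurable_realfun giry ring lra.
Set Implicit Arguments. Unset Strict Implicit. Unset Printing Implicit Defensive.
Import Order.TTheory GRing.Theory Num.Def Num.Theory.
Import numFieldTopology.Exports numFieldNormedType.Exports.
Local Open Scope classical_set_scope.
Local Open Scope ring_scope.

(** A law P belongs to R or to R+ exactly when its marginal is rho and, for all s < t, the
    conditional probability of [tau <= s] given (B, W, mu) is F_t-measurable ("adapted law"); the
    gap between s and t absorbs the difference between F_t and F_(t+).  Hence R = R+, and this set
    is convex.  Equivalently, the indicator of [tau <= s] is orthogonal to every bounded function
    of (B, W, mu) orthogonal to F_t; approximating such functions in L^1 by continuous ones, and
    the indicator from above by continuous cutoffs, shows that the set is weakly closed.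

    Compactness: along an ultrafilter of adapted laws, the densities of [tau <= qT], q rational,
    have limits p_q, and the ultrafilter converges to the law of (x, sup {qT | p_q x < u}) under
    the product of rho and the uniform law of u.

    Density: on a grid of step h, delaying tau by one step leaves room to replace its conditional
    distribution function by continuous F_(t_j)-measurable functions q_j.  Inverting them at a
    uniform variable U gives a randomized time, which is a continuous stopping time as soon as U is
    a continuous function of the path of B on [0, h].  Brownian increments provide an i.i.d.
    sequence of such U, and by Bessel's inequality some member of it is almost independent of any
    given finite family of functions. *)

(** * Expectations of bounded functions *)

(** Three obstacles shape the proof. No tightness argument is used, and a limit along an ultrafilter
    is a priori only finitely additive; since the input marginal is fixed, every limit set function
    is dominated by [rho], which restores countable additivity, and compactness of the time interval
    does the rest. Next, an adapted density must be approximated by functions that are continuous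
    and still adapted. This rests on a property of the filtration: each F_t is generated by the
    cozero sets of its continuous measurable functions, even though mu(C) is not continuous in mu.
    Finally, a stopping time of the input can only be randomized by the input itself, so the
    randomizer U cannot be independent of it. Near-independence of finitely many functions suffices,
    because a weak neighbourhood makes finitely many tests and, on a fine grid, each test reduces to
    finitely many expectations that are linear in the conditional distribution function of tau. The
    one-step delay serves twice: it closes the gap between s and t in the definition of an adapted
    law, and it makes U known by the time it is used. *)

Section expectation.
Context {d} {T : measurableType d} {R : realType}.
Implicit Types (P : probability T R) (f g : T -> R).

(** Such functions are integrable under every probability measure, so one class of integrands serves
    for all the laws that are compared. *)
Definition bmeas f := measurable_fun setT f /\ exists M : R, forall x, `|f x| <= M.

Lemma bmeas_meas f : bmeas f -> measurable_fun setT f. Proof. by case. Qed.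

Lemma bmeas_int P f : bmeas f -> P.-integrable setT (EFin \o f).
Proof.
case=> mf [M fM]; apply: measurable_bounded_integrable => //.
  by rewrite -ge0_fin_numE// fin_num_measure.
exists M; split; first exact: num_real.
by move=> N MN x _ /=; exact: le_trans (fM x) (ltW MN).
Qed.

Lemma bmeas_cst (c : R) : bmeas (fun=> c).
Proof. by split; [exact: measurable_cst|exists `|c|]. Qed.

Lemma bmeasD f g : bmeas f -> bmeas g -> bmeas (fun x => f x + g x).
Proof.
case=> mf [M fM] [mg [N gN]]; split; first exact: measurable_funD.
by exists (M + N) => x; rewrite (le_trans (ler_normD _ _))// lerD.
Qed.

Lemma bmeasN f : bmeas f -> bmeas (fun x => - f x).
Proof.
case=> mf [M fM]; split; first exact: measurableT_comp.
by exists M => x; rewrite normrN.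
Qed.

Lemma bmeasB f g : bmeas f -> bmeas g -> bmeas (fun x => f x - g x).
Proof. by move=> bf /bmeasN; exact: bmeasD. Qed.

Lemma bmeasM f g : bmeas f -> bmeas g -> bmeas (fun x => f x * g x).
Proof.
case=> mf [M fM] [mg [N gN]]; split; first exact: measurable_funM.
by exists (M * N) => x; rewrite normrM ler_pM.
Qed.

Lemma bmeasZ (c : R) f : bmeas f -> bmeas (fun x => c * f x).
Proof. by move=> bf; apply: bmeasM => //; exact: bmeas_cst. Qed.

Lemma bmeas_norm f : bmeas f -> bmeas (fun x => `|f x|).
Proof.
case=> mf [M fM]; split; first exact: measurableT_comp.
by exists M => x; rewrite normr_id.
Qed.

Lemma bmeas_max f g : bmeas f -> bmeas g -> bmeas (fun x => Num.max (f x) (g x)).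
Proof.
case=> mf [M fM] [mg [N gN]]; split; first exact: measurable_maxr.
exists (Num.max M N) => x; rewrite le_max.
by case: (leP (f x) (g x)) => _; rewrite ?fM ?gN ?orbT.
Qed.

Lemma bmeas_indic (A : set T) : measurable A -> bmeas (\1_A : T -> R).
Proof.
move=> mA; split; first exact: measurable_indic.
by exists 1 => x; rewrite indicE; case: (_ \in _); rewrite ?normr1 ?normr0.
Qed.

Lemma bmeas01 f : measurable_fun setT f -> (forall x, 0 <= f x <= 1) -> bmeas f.
Proof.
move=> mf f01; split => //; exists 1 => x.
by case/andP: (f01 x) => f0 f1; rewrite ger0_norm.
Qed.

Lemma bmeas_sum (I : Type) (s : seq I) (Q : pred I) (F : I -> T -> R) :
  (forall i, bmeas (F i)) -> bmeas (fun x => \sum_(i <- s | Q i) F i x).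
Proof.
move=> bF; elim: s => [|i s IH].
  by under eq_fun do rewrite big_nil; exact: bmeas_cst.
under eq_fun do rewrite big_cons.
by case: (Q i) => //; exact: bmeasD.
Qed.

Definition Ex P f : R := \int[P]_x f x.

Lemma Ex_cst P (c : R) : Ex P (fun=> c) = c.
Proof.
rewrite /Ex Rintegral_cst// -[RHS]mulr1; congr (_ * _).
by transitivity (fine (1%E : \bar R)) => //; congr fine; exact: probability_setT.
Qed.

Lemma ExD P f g : bmeas f -> bmeas g -> Ex P (fun x => f x + g x) = Ex P f + Ex P g.
Proof. by move=> bf bg; rewrite /Ex RintegralD//; exact: bmeas_int. Qed.

Lemma ExB P f g : bmeas f -> bmeas g -> Ex P (fun x => f x - g x) = Ex P f - Ex P g.
Proof. by move=> bf bg; rewrite /Ex RintegralB//; exact: bmeas_int. Qed.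

Lemma ExZ P (c : R) f : bmeas f -> Ex P (fun x => c * f x) = c * Ex P f.
Proof. by move=> bf; rewrite /Ex RintegralZl//; exact: bmeas_int. Qed.

Lemma Ex_sum P (I : Type) (s : seq I) (F : I -> T -> R) :
  (forall i, bmeas (F i)) ->
  Ex P (fun x => \sum_(i <- s) F i x) = \sum_(i <- s) Ex P (F i).
Proof.
move=> bF; elim: s => [|i s IH].
  by rewrite big_nil -[RHS](Ex_cst P); congr Ex; apply: funext => x; rewrite big_nil.
rewrite big_cons -IH -ExD//; last exact: bmeas_sum.
by congr Ex; apply: funext => x; rewrite big_cons.
Qed.

Lemma Ex_le P f g : bmeas f -> bmeas g -> (forall x, f x <= g x) -> Ex P f <= Ex P g.
Proof. by move=> bf bg fg; apply: le_Rintegral => //; exact: bmeas_int. Qed.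

Lemma Ex_ge0 P f : (forall x, 0 <= f x) -> 0 <= Ex P f.
Proof. by move=> f0; apply: Rintegral_ge0. Qed.

Lemma Ex_norm P f : bmeas f -> `|Ex P f| <= Ex P (fun x => `|f x|).
Proof. by move=> bf; apply: le_normr_Rintegral => //; exact: bmeas_int. Qed.

Lemma Ex_bound P f (M : R) : bmeas f -> (forall x, f x <= M) -> Ex P f <= M.
Proof.
by move=> bf fM; rewrite -[leRHS](Ex_cst P); apply: Ex_le => //; exact: bmeas_cst.
Qed.

Lemma Ex_indic P (A : set T) : measurable A -> Ex P (\1_A) = fine (P A).
Proof.
by move=> mA; rewrite /Ex /Rintegral integral_indic// setIT.
Qed.

Lemma Ex_EFin P f : bmeas f -> (Ex P f)%:E = (\int[P]_x (f x)%:E)%E.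
Proof.
by move=> bf; rewrite /Ex /Rintegral fineK//; exact: integrable_fin_num (bmeas_int P bf).
Qed.

Lemma Ex_EFin_set P f (A : set T) : bmeas f -> measurable A ->
  (Ex P (fun x => \1_A x * f x))%:E = (\int[P]_(x in A) (f x)%:E)%E.
Proof.
move=> bf mA; rewrite Ex_EFin; last by apply: bmeasM => //; exact: bmeas_indic.
rewrite [RHS]integral_mkcond restrict_EFin; apply: eq_integral => x _.
rewrite /= patchE indicE; case: (x \in A); first by rewrite mul1r.
by rewrite mul0r.
Qed.

Lemma fineP P (A : set T) : measurable A -> (fine (P A))%:E = P A.
Proof. by move=> mA; rewrite fineK// fin_num_measure. Qed.

Lemma Ex_cvg P (fn : (T -> R)^nat) f (M : R) :
  (forall n, measurable_fun setT (fn n)) -> (forall n x, `|fn n x| <= M) ->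
  (forall x, fn ^~ x @ \oo --> f x) ->
  (fun n => Ex P (fn n)) @ \oo --> Ex P f.
Proof.
move=> mfn bfn cfn.
have mf : measurable_fun setT f.
  by apply: (@measurable_fun_cvg _ _ _ setT fn).
have bf : bmeas f.
  split => //; exists M => x.
  have /cvg_norm cn := cfn x.
  rewrite -(cvg_lim (@Rhausdorff R) cn).
  by apply: limr_le; [exact: cvgP cn|near=> n; exact: bfn].
have cE : {ae P, forall x, setT x -> (EFin \o fn n) x @[n --> \oo] --> (EFin \o f) x}.
  by apply: aeW => x _; apply/fine_cvgP; split; [exact: nearW|exact: cfn].
have bE : {ae P, forall x n, setT x -> (`|(EFin \o fn n) x| <= (cst M%:E) x)%E}.
  by apply: aeW => x n _ /=; rewrite lee_fin.
have mE n : measurable_fun setT (EFin \o fn n) by exact/measurable_EFinP.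
have mE' : measurable_fun setT (EFin \o f) by exact/measurable_EFinP.
have iM := bmeas_int P (bmeas_cst M).
have [_ _] := dominated_convergence measurableT mE mE' cE iM bE.
rewrite /= -(Ex_EFin P bf) => h; exact: (fine_cvg h).
Unshelve. all: by end_near. Qed.

End expectation.

(** * Level sets, and functionals determined by indicators *)

Section layers.
Context {R : realType}.

(** The sum counts the integers of $[1,m]$ that are at most $z$, so it equals $\min(m,\lfloor
    z\rfloor)$; the three bounds are what is kept of this identity. *)
Lemma sum_layers (z : R) (m : nat) : 0 <= z ->
  [/\ \sum_(k < m) (k.+1%:R <= z)%R%:R <= m%:R :> R,
      \sum_(k < m) (k.+1%:R <= z)%R%:R <= z &
      Num.min m%:R (z - 1) <= \sum_(k < m) (k.+1%:R <= z)%R%:R].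
Proof.
move=> z0; elim: m => [|m [IH1 IH2 IH3]].
  by rewrite big_ord0 ge_min lexx.
rewrite big_ord_recr /=; set S := \sum_(_ < _) _ in IH1 IH2 IH3 *.
move: IH3; rewrite -natr1 !ge_min; case: (leP (m%:R + 1) z) => mz /=.
  by case/orP => ?; split; rewrite ?ge_min; apply/orP || idtac; lra.
by case/orP => ?; split; rewrite ?ge_min; try (apply/orP; right); lra.
Qed.

Lemma layer_approx (y : R) (m : nat) : 0 <= y <= 1 -> (0 < m)%N ->
  `|y - m%:R^-1 * \sum_(k < m) (k.+1%:R / m%:R <= y)%R%:R| <= m%:R^-1.
Proof.
move=> /andP[y0 y1] m0; have m0' : 0 < m%:R :> R by rewrite ltr0n.
have [] := @sum_layers (y * m%:R) m; first by rewrite mulr_ge0.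
under eq_bigr do rewrite -ler_pdivrMr//.
set S := \sum_(_ < _) _ => H1 H2; rewrite ge_min => H3.
have -> : y - m%:R^-1 * S = m%:R^-1 * (y * m%:R - S).
  by rewrite mulrBr mulrCA mulVf ?mulr1// gt_eqF.
rewrite normrM ger0_norm ?invr_ge0// ger_pMr ?invr_gt0//.
rewrite ger0_norm ?subr_ge0//.
case/orP: H3 => H3; last lra.
have : y * m%:R <= m%:R by rewrite ler_piMl.
lra.
Qed.
End layers.

Section orthogonality.
Context {d} {T : measurableType d} {R : realType}.
Variable P : probability T R.

Lemma Ex_null (f g : T -> R) : bmeas f -> bmeas g -> (forall x, 0 <= f x) ->
  Ex P f = 0 -> Ex P (fun x => g x * f x) = 0.
Proof.
move=> bf bg f0 Ef; apply/eqP; rewrite -normr_le0.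
have [_ [M gM]] := bg.
apply: le_trans (Ex_norm _ _) _; first exact: bmeasM.
rewrite -(mulr0 M) -Ef -ExZ//; apply: Ex_le; last first.
- by move=> x; rewrite normrM (ger0_norm (f0 x)) ler_wpM2r.
- exact: bmeasZ.
- by apply: bmeas_norm; exact: bmeasM.
Qed.

Lemma Ex_close (f g : T -> R) (e : R) : bmeas f -> bmeas g ->
  (forall x, `|f x - g x| <= e) -> `|Ex P f - Ex P g| <= e.
Proof.
move=> bf bg fg; rewrite -ExB//.
have bfg := bmeasB bf bg.
by apply: le_trans (Ex_norm _ bfg) _; apply: Ex_bound => //; exact: bmeas_norm.
Qed.

Lemma small_eq0 (a : R) (M : R) :
  (forall m, (0 < m)%N -> `|a| <= M * m%:R^-1) -> a = 0.
Proof.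
move=> h; apply/eqP; rewrite -normr_le0; apply/ler_addgt0Pr => e e0; rewrite add0r.
have M0 : 0 <= M by have := h 1 isT; rewrite invr1 mulr1; apply: le_trans.
have := h (Num.trunc (M / e)).+1 isT => /le_trans; apply.
rewrite ler_pdivrMr ?ltr0n// mulrC -ler_pdivrMr//.
by apply/ltW; exact: truncnS_gt.
Qed.

End orthogonality.

Section functional_eq0.
Context {d} {T : measurableType d} {R : realType} (G : set (set T)) (D : (T -> R) -> R) (C : R).
Hypothesis mG : forall S, G S -> measurable S.
Hypothesis DD : forall f g, bmeas f -> bmeas g -> D (fun x => f x + g x) = D f + D g.
Hypothesis DZ : forall c f, bmeas f -> D (fun x => c * f x) = c * D f.
Hypothesis DC : forall f (M : R), bmeas f -> (forall x, `|f x| <= M) -> `|D f| <= C * M.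
Hypothesis D0 : forall S, G S -> D (\1_S) = 0.

(* A [0,1]-valued function is a uniform limit of averages of the indicators of its upper level sets. *)
Lemma functional_eq0_01 h : bmeas h -> (forall r, G [set x | r <= h x]) -> (forall x, 0 <= h x <= 1) ->
  D h = 0.
Proof.
move=> bh Gh h01; apply: (@small_eq0 _ _ C) => m m0.
pose S (k : 'I_m) : set T := [set x | k.+1%:R / m%:R <= h x].
pose hm x : R := m%:R^-1 * \sum_(k <- index_enum 'I_m) \1_(S k) x.
have bS k : bmeas (\1_(S k) : T -> R) by apply: bmeas_indic; exact/mG/Gh.
have bhm : bmeas hm by apply: bmeasZ; exact: bmeas_sum.
have e0 : D hm = 0.
  rewrite DZ; last exact: bmeas_sum.
  elim: (index_enum _) => [|k s IH].
    under [X in D X]funext do rewrite big_nil.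
    suff -> : D (fun=> 0) = 0 by rewrite mulr0.
    rewrite -[RHS](mul0r (D (fun=> 0))) -DZ; last exact: bmeas_cst.
    by congr (D _); apply: funext => x; rewrite mul0r.
  under [X in D X]funext do rewrite big_cons.
  by rewrite DD//; [rewrite mulrDr IH D0 ?mulr0 ?addr0//; exact: Gh|exact: bmeas_sum].
have -> : D h = D (fun x => h x + -1 * hm x) by rewrite (DD bh (bmeasZ (-1) bhm)) (DZ (-1) bhm) e0 mulr0 addr0.
apply: DC; first by apply: bmeasD => //; exact: bmeasZ.
move=> x; rewrite mulN1r.
have -> : hm x = m%:R^-1 * \sum_(k < m) (k.+1%:R / m%:R <= h x)%R%:R.
  by congr (_ * _); apply: eq_bigr => k _; rewrite indicE /S mem_setE.
exact: layer_approx.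
Qed.

(** An affine change of [h] reduces to values in $[0,1]$; the whole space lies in [G], being a level
    set of [h]. The functional is abstract because it will be an expectation and also a limit of
    expectations along an ultrafilter. *)
Lemma functional_eq0 h : bmeas h -> (forall r, G [set x | r <= h x]) -> D h = 0.
Proof.
move=> bh Gh; have [mh [M hM]] := bh.
have M0 : 0 <= M by exact: le_trans (hM point).
pose N := M + 1; have N0 : 0 < N by rewrite /N; lra.
have N20 : 0 < 2 * N by rewrite mulr_gt0.
pose h' x := (h x + N) / (2 * N).
have bh' : bmeas h'.
  rewrite (_ : h' = fun x => (2 * N)^-1 * (h x + N)); last by apply: funext => x; rewrite /h' mulrC.
  by apply: bmeasZ; apply: bmeasD => //; exact: bmeas_cst.
have -> : h = fun x => 2 * N * h' x + - N * 1.
  by apply: funext => x; rewrite /h'; field; rewrite gt_eqF.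
rewrite DD; [|exact: bmeasZ|by apply: bmeasZ; exact: bmeas_cst].
rewrite !DZ//; last exact: bmeas_cst.
have GT : G setT.
  rewrite [X in G X](_ : _ = [set x | - N <= h x]) //; apply/seteqP; split => // x _ /=.
  by have := hM x; rewrite ler_norml /N => /andP[? ?]; lra.
rewrite -[X in _ + _ * D X](@indicT T R) D0// functional_eq0_01 ?mulr0 ?addr0//.
  by move=> r; rewrite [X in G X](_ : _ = [set x | r * (2 * N) - N <= h x]) //;
    apply/seteqP; split => x /=; rewrite /h' ler_pdivlMr// lerBlDr.
move=> x; have := hM x; rewrite ler_norml => /andP[? ?].
by rewrite /h' divr_ge0 ?ler_pdivrMr//= /N; lra.
Qed.
End functional_eq0.

(** When [G] is a sigma-algebra, the hypothesis on [a] says that its conditional expectation on [G]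
    vanishes; this orthogonality takes the place of computations with conditional expectations. *)
Lemma Ex_ortho {d} {T : measurableType d} {R : realType} (P : probability T R) (G : set (set T)) (a h : T -> R) :
  (forall S, G S -> measurable S) -> bmeas a ->
  (forall S, G S -> Ex P (fun x => \1_S x * a x) = 0) ->
  (forall r, G [set x | r <= h x]) -> bmeas h ->
  Ex P (fun x => h x * a x) = 0.
Proof.
move=> mG ba a0 Gh bh; have [_ [M aM]] := ba.
apply: (@functional_eq0 _ _ _ G (fun h => Ex P (fun x => h x * a x)) M) => //.
- move=> f g bf bg; rewrite -ExD; [|exact: bmeasM..].
  by congr (Ex P _); apply: funext => x; rewrite mulrDl.
- move=> c f bf; rewrite -ExZ; last exact: bmeasM.
  by congr (Ex P _); apply: funext => x; rewrite mulrA.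
- move=> f N bf fN; apply: le_trans (Ex_norm _ _) _; first exact: bmeasM.
  apply: Ex_bound; first by apply: bmeas_norm; exact: bmeasM.
  by move=> x; rewrite normrM mulrC ler_pM.
Qed.

(** * Densities on a sub-sigma-algebra *)

Section radon_nikodym_sub.
Context {d} {T : measurableType d} {R : realType}.
Variables (rho : probability T R) (G : set (set T)) (n : set T -> R).
Hypothesis sG : sigma_algebra setT G.
Hypothesis mG : forall S, G S -> measurable S.
Hypothesis n_ge0 : forall S, 0 <= n S.
Hypothesis n_le : forall S, G S -> n S <= fine (rho S).
Hypothesis nU : forall A B, G A -> G B -> [disjoint A & B] -> n (A `|` B) = n A + n B.

Local Notation X := (g_sigma_algebraType G).
Let GX (S : set X) : measurable S = G S.
Proof. by rewrite -[in RHS](sigma_algebra_id sG). Qed.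

Let G0 : G set0. Proof. by case: sG. Qed.
Let GC S : G S -> G (~` S). Proof. by case: sG => _ /(_ S); rewrite setTD. Qed.
Let GU (F : (set T)^nat) : (forall i, G (F i)) -> G (\bigcup_i F i).
Proof. by case: sG => _ _; exact. Qed.

Let rn (S : set X) : \bar R := (n S)%:E.

Let rn0 : rn set0 = 0%E.
Proof.
congr EFin; have := nU G0 G0; rewrite setU0 disj_set2E setI0 eqxx => /(_ isT) h.
lra.
Qed.

Let rn_ge0 S : (0 <= rn S)%E. Proof. by rewrite lee_fin. Qed.

Let rn_sum (F : (set T)^nat) k : (forall i, G (F i)) -> trivIset setT F ->
  G (\big[setU/set0]_(i < k) F i) /\
  n (\big[setU/set0]_(i < k) F i) = \sum_(i < k) n (F i).
Proof.
move=> GF tF; elim: k => [|k [IH1 IH2]].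
  by rewrite !big_ord0; split => //; case: rn0.
have Gk : G (\big[setU/set0]_(i < k.+1) F i).
  by rewrite -GX; apply: bigsetU_measurable => i _; rewrite GX.
split => //; rewrite !big_ord_recr /= nU ?IH2//.
rewrite disj_set2E; apply/eqP; rewrite -bigcup_mkord; apply/seteqP; split => // x.
case=> [[i /= ik Fi] Fk]; have /trivIsetP/(_ i k I I) h := tF.
by rewrite -[False]/(set0 x) -h// ltn_eqF.
Qed.

(** Domination turns finite into countable additivity: for the finite unions $V_k$ increasing to
    $U$, $n(U)-n(V_k)=n(U\setminus V_k)\le\rho(U\setminus V_k)\to0$. *)
Let rn_sigma_additive : semi_sigma_additive rn.
Proof.
move=> F mF tF mUF; have GF i : G (F i) by rewrite -GX.
pose U := \bigcup_i F i; have GUF : G U by exact: GU.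
pose V k := \big[setU/set0]_(i < k) F i.
pose r (S : set T) := fine (rho S).
have -> : (fun k => \sum_(0 <= i < k) rn (F i))%E = EFin \o (fun k => n (V k)).
  apply: funext => k /=; have [_ ->] := rn_sum k GF tF.
  by rewrite big_mkord sumEFin.
apply/fine_cvgP; split; first exact: nearW.
have rV : r (V k) @[k --> \oo] --> r U.
  apply/fine_cvg; rewrite fineP; last exact: mG.
  have := @measure_semi_sigma_additive _ _ _ rho F (fun i => mG (GF i)) tF (mG GUF).
  apply: cvg_trans; apply: near_eq_cvg; apply: nearW => k /=.
  by rewrite big_mkord /V measure_bigsetU// => j; exact: mG.
have Vsub k : V k `<=` U by rewrite /V -bigcup_mkord; by move=> x [i _ Fi]; exists i.
have key k : n U - (r U - r (V k)) <= n (V k) <= n U.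
  have [GV _] := rn_sum k GF tF.
  have GD : G (U `\` V k) by rewrite -GX; apply: measurableD; rewrite GX.
  have dVD : [disjoint V k & U `\` V k] by rewrite disj_set2E setDE setICA setICr setI0 eqxx.
  have UE : V k `|` (U `\` V k) = U by rewrite setDUK//; exact: Vsub.
  have -> : n U = n (V k) + n (U `\` V k) by rewrite -nU// UE.
  have -> : r U = r (V k) + r (U `\` V k).
    apply: EFin_inj; rewrite EFinD !fineP; try exact: mG.
    rewrite -[in LHS]UE measureU//; [exact: mG|exact: mG|].
    by apply/eqP; rewrite -disj_set2E.
  have := n_ge0 (U `\` V k); have := n_le GD; rewrite -/(r _); lra.
apply: (@squeeze_cvgr _ _ _ _ (fun k => n U - (r U - r (V k))) (fun=> n U)).
- exact: nearW.
- rewrite -[X in _ --> X]subr0 -(subrr (r U)).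
  by apply: cvgB; [exact: cvg_cst|apply: cvgB => //; exact: cvg_cst].
- exact: cvg_cst.
Qed.

HB.instance Definition _ := isMeasure.Build _ _ _ rn rn0 rn_ge0 rn_sigma_additive.

Let rn_fin : fin_num_fun rn. Proof. by []. Qed.
HB.instance Definition _ := @Measure_isFinite.Build _ _ _ rn rn_fin.

Let id_meas : measurable_fun setT (id : T -> X).
Proof. by move=> _ S; rewrite setTI GX; exact: mG. Qed.

(** The restriction of [rho] to [G], encoded as an image measure under the identity onto the coarser
    measurable space. *)
Let rr : set X -> \bar R := pushforward rho (id : T -> X).
Let rr0 : rr set0 = 0%E. Proof. exact: measure0. Qed.
Let rr_ge0 S : (0 <= rr S)%E. Proof. exact: measure_ge0. Qed.
Let rr_sa : semi_sigma_additive rr.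
Proof.
move=> F mF tF mU; have GF i : G (F i) by rewrite -GX.
exact: (@measure_semi_sigma_additive _ _ _ rho F (fun i => mG (GF i)) tF (mG (GU GF))).
Qed.
HB.instance Definition _ := isMeasure.Build _ _ _ rr rr0 rr_ge0 rr_sa.
Let rr_fin : fin_num_fun rr.
Proof. by move=> S; rewrite GX => GS; rewrite /rr /pushforward fin_num_measure//; exact: mG. Qed.
HB.instance Definition _ := @Measure_isFinite.Build _ _ _ rr rr_fin.

(** Finite additivity of [n] is all that limits along an ultrafilter provide. The density is
    truncated at 1 so that its bounds hold everywhere and not only almost everywhere; the truncation
    changes no integral because [n] is dominated by [rho]. *)
Lemma radon_nikodym_sub : exists p : T -> R,
  [/\ forall U : set R, measurable U -> G (p @^-1` U), forall x, 0 <= p x <= 1 &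
      forall S, G S -> n S = Ex rho (fun x => \1_S x * p x)].
Proof.
have dom : rn `<< rr.
  apply/null_content_dominatesP => A mA rA; rewrite /rn.
  have GA : G A by rewrite -GX.
  apply/eqP; rewrite eqe eq_le n_ge0 andbT (le_trans (n_le GA))//.
  by rewrite -lee_fin fineP; [rewrite -[rho A]/(rr A) rA|exact: mG].
have [f [f0 intf fE]] := radon_nikodym_finite dom.
have mf : measurable_fun setT f by exact: measurable_int intf.
pose g x := mine (f x) 1%E.
have mg : measurable_fun setT g by apply: measurable_mine => //; exact: measurable_cst.
have g0 x : (0 <= g x)%E by rewrite le_min f0 lee01.
have g1 x : (g x <= 1)%E by rewrite ge_min lexx orbT.
have gfin x : g x \is a fin_num.
  by rewrite ge0_fin_numE// (le_lt_trans (g1 x))// ltry.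
pose p x := fine (g x).
have mp' : @measurable_fun _ _ X R setT p by exact: measurableT_comp.
have mp : measurable_fun setT (p : T -> R).
  by move=> _ U mU; rewrite setTI; apply: mG; rewrite -GX -[X in measurable X]setTI; exact: mp'.
have p01 x : 0 <= p x <= 1 by rewrite -!lee_fin fineK// g0 g1.
exists p; split => //.
  by move=> U mU; rewrite -GX -[X in measurable X]setTI; exact: mp'.
move=> S GS; apply: EFin_inj; rewrite Ex_EFin_set; [|exact: bmeas01|exact: mG].
have -> : (\int[rho]_(x in S) (p x)%:E = \int[rr]_(x in S) g x)%E.
  rewrite ge0_integral_pushforward//.
  - by apply: eq_integral => x _ /=; rewrite fineK.
  - by rewrite GX.
  - exact: measurable_funTS.
rewrite -[(n S)%:E]/(rn S) fE ?GX//.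
pose D : set X := f @^-1` `]1%E, +oo[%classic.
have mD : measurable D.
  by rewrite -[D]setTI; apply: mf => //; exact: emeasurable_itv.
have mS : @measurable _ X S by rewrite GX.
have mSD := measurableI _ _ mS mD.
have mSD' : @measurable _ X (S `\` D) by exact: measurableD.
have SE : S = (S `\` D) `|` (S `&` D) by rewrite setUC setUIDK.
have dis : [disjoint S `\` D & S `&` D].
  by rewrite disj_set2E setDE setIACA setICl setI0 eqxx.
have dis' := dis; rewrite SE !ge0_integral_setU//; try exact: measurable_funTS.
congr (_ + _)%E.
  apply: eq_integral => x /set_mem [Sx /= Dx]; rewrite /g; apply/esym/min_idPl.
  by rewrite leNgt; apply/negP => h; apply: Dx; rewrite /D /= in_itv /= h.
(* where f > 1, the density exceeds that of rho, but nu <= rho: both equal rho there *)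
have gE : (\int[rr]_(x in S `&` D) g x = rho (S `&` D))%E.
  rewrite (eq_integral (cst 1%E)); first by rewrite integral_cst ?mul1e.
  move=> x /set_mem [Sx]; rewrite /D /= in_itv /= andbT => fx; rewrite /g; apply/min_idPr.
  exact: ltW.
have GSD : G (S `&` D) by rewrite -GX.
apply/eqP; rewrite eq_le; apply/andP; split.
  rewrite gE -fE// -[leRHS]fineP; [exact: n_le|exact: mG].
apply: ge0_le_integral => //; [exact: measurable_funTS..|].
by move=> x _; rewrite ge_min lexx.
Qed.

End radon_nikodym_sub.

Section sub_sigma.
Context {d} {T : measurableType d} {R : realType}.
Variables (G : set (set T)).
Hypothesis sG : sigma_algebra setT G.

(** Measurability as a predicate on set systems, so that several sigma-algebras on one carrier can
    be compared without changing its type; [GmeasP] translates to measurable functions. *)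
Definition Gmeas (G : set (set T)) (f : T -> R) :=
  forall U : set R, measurable U -> G (f @^-1` U).

Lemma g_sigma_measurableE (S : set (g_sigma_algebraType G)) : measurable S = G S.
Proof. by rewrite -[in RHS](sigma_algebra_id sG). Qed.

Lemma GmeasP (f : T -> R) :
  Gmeas G f <-> measurable_fun setT (f : g_sigma_algebraType G -> R).
Proof.
split => [Gf _ U mU|mf U mU].
  by rewrite setTI g_sigma_measurableE; exact: Gf.
by rewrite -g_sigma_measurableE -[X in measurable X]setTI; exact: mf.
Qed.

Lemma sigma_algebraT : G setT.
Proof. by rewrite -g_sigma_measurableE. Qed.

Lemma Gmeas_indic (A : set T) : G A -> Gmeas G (\1_A).
Proof. by move=> GA; apply/GmeasP; apply: measurable_indic; rewrite g_sigma_measurableE. Qed.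

Lemma GmeasM f g : Gmeas G f -> Gmeas G g -> Gmeas G (fun x => f x * g x).
Proof. by move=> /GmeasP mf /GmeasP mg; apply/GmeasP; exact: measurable_funM. Qed.

Lemma GmeasB f g : Gmeas G f -> Gmeas G g -> Gmeas G (fun x => f x - g x).
Proof. by move=> /GmeasP mf /GmeasP mg; apply/GmeasP; exact: measurable_funB. Qed.

Lemma GmeasD f g : Gmeas G f -> Gmeas G g -> Gmeas G (fun x => f x + g x).
Proof. by move=> /GmeasP mf /GmeasP mg; apply/GmeasP; exact: measurable_funD. Qed.

Lemma Gmeas_cst (c : R) : Gmeas G (fun=> c).
Proof. by apply/GmeasP; exact: measurable_cst. Qed.

Lemma Gmeas_max f g : Gmeas G f -> Gmeas G g -> Gmeas G (fun x => Num.max (f x) (g x)).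
Proof. by move=> /GmeasP mf /GmeasP mg; apply/GmeasP; exact: measurable_maxr. Qed.

Lemma Gmeas_min f g : Gmeas G f -> Gmeas G g -> Gmeas G (fun x => Num.min (f x) (g x)).
Proof. by move=> /GmeasP mf /GmeasP mg; apply/GmeasP; exact: measurable_minr. Qed.

Lemma Gmeas_comp f (g : R -> R) : Gmeas G f -> measurable_fun setT g ->
  Gmeas G (g \o f).
Proof. by move=> /GmeasP mf mg; apply/GmeasP; exact: measurableT_comp. Qed.

Lemma Gmeas_ge f (r : R) : Gmeas G f -> G [set x | r <= f x].
Proof.
move=> Gf; rewrite (_ : [set x | _] = f @^-1` `[r, +oo[%classic); first exact: Gf.
by apply/seteqP; split => x /=; rewrite in_itv /= andbT.
Qed.

Lemma Gmeas_cvg (fn : (T -> R)^nat) f : (forall n, Gmeas G (fn n)) ->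
  (forall x, fn ^~ x @ \oo --> f x) -> Gmeas G f.
Proof.
move=> mfn cfn; apply/GmeasP.
apply: (@measurable_fun_cvg _ _ _ setT (fn : nat -> g_sigma_algebraType G -> R)) => // n.
exact/GmeasP.
Qed.

Lemma Gmeas_sum (I : Type) (s : seq I) (Q : pred I) (F : I -> T -> R) :
  (forall i, Gmeas G (F i)) -> Gmeas G (fun x => \sum_(i <- s | Q i) F i x).
Proof.
move=> bF; elim: s => [|i s IH].
  by under eq_fun do rewrite big_nil; exact: Gmeas_cst.
under eq_fun do rewrite big_cons.
by case: (Q i) => //; exact: GmeasD.
Qed.

Lemma Gmeas_meas f : (forall S, G S -> measurable S) -> Gmeas G f -> measurable_fun setT f.
Proof. by move=> mG Gf _ U mU; rewrite setTI; exact/mG/Gf. Qed.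
End sub_sigma.

Lemma GmeasS {d} {T : measurableType d} {R : realType} (G H : set (set T)) (f : T -> R) :
  G `<=` H -> Gmeas G f -> Gmeas H f.
Proof. by move=> GH Gf U /Gf/GH. Qed.

Section change_of_measure.
Context {d} {T : measurableType d} {R : realType}.

Lemma Ex_eq_measure (P Q : probability T R) f :
  (forall A, measurable A -> P A = Q A) -> Ex P f = Ex Q f.
Proof.
move=> PQ; rewrite /Ex /Rintegral; congr fine; apply: eq_measure_integral => A mA _.
exact: PQ.
Qed.

(** Expanding $(m|h|-1)^2\ge0$ gives $|h|\le m h^2+1/m$; integrate and let $m$ grow. *)
Lemma Ex_sq0_abs (P : probability T R) (h : T -> R) : bmeas h ->
  Ex P (fun x => h x * h x) = 0 -> Ex P (fun x => `|h x|) = 0.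
Proof.
move=> bh hh; apply: (@small_eq0 R _ 1) => m m0; have m0' : 0 < m%:R :> R by rewrite ltr0n.
rewrite mul1r ger0_norm ?Ex_ge0//.
have bhh := bmeasM bh bh.
have -> : m%:R^-1 = Ex P (fun x => m%:R * (h x * h x) + m%:R^-1).
  by rewrite ExD ?ExZ ?hh ?mulr0 ?add0r ?Ex_cst//; [exact: bmeasZ|exact: bmeas_cst].
apply: Ex_le; [exact: bmeas_norm|by apply: bmeasD; [exact: bmeasZ|exact: bmeas_cst]|].
move=> x; have -> : h x * h x = `|h x| ^+ 2 by rewrite -normrX ger0_norm ?sqr_ge0// expr2.
have : 0 <= (m%:R * `|h x| - 1) ^+ 2 by exact: sqr_ge0.
have i0 : 0 < m%:R^-1 :> R by rewrite invr_gt0.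
rewrite sqrrB1 => /(mulr_ge0 (ltW i0)).
have -> : m%:R^-1 * ((m%:R * `|h x|) ^+ 2 - m%:R * `|h x| *+ 2 + 1) =
   m%:R * `|h x| ^+ 2 - `|h x| *+ 2 + m%:R^-1 by field; rewrite gt_eqF.
have := normr_ge0 (h x); lra.
Qed.

Lemma Ex_sq0 (P : probability T R) (g h : T -> R) : bmeas h -> bmeas g ->
  Ex P (fun x => h x * h x) = 0 -> Ex P (fun x => g x * h x) = 0.
Proof.
move=> bh bg hh; have [_ [M gM]] := bg.
apply/eqP; rewrite -normr_le0.
apply: le_trans (Ex_norm _ (bmeasM bg bh)) _.
rewrite -(mulr0 M) -(Ex_sq0_abs bh hh) -ExZ; last exact: bmeas_norm.
apply: Ex_le; [by apply: bmeas_norm; exact: bmeasM|by apply: bmeasZ; exact: bmeas_norm|].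
by move=> x; rewrite normrM ler_wpM2r.
Qed.

Context {d'} {Y : measurableType d'}.

Lemma push_ex (P : probability T R) (g : T -> Y) : measurable_fun setT g ->
  exists Q : probability Y R,
    (forall A, measurable A -> Q A = P (g @^-1` A)) /\
    (forall f, bmeas f -> Ex Q f = Ex P (f \o g)).
Proof.
move=> mg; exists (distribution P (mfun_Sub (mem_set mg))); split => //.
move=> f [mf [M fM]]; rewrite /Ex /Rintegral integral_distribution//.
  exact/measurable_EFinP.
apply: (@bmeas_int _ _ _ P (f \o g)); split; first exact: measurableT_comp.
by exists M => x; exact: fM.
Qed.

Lemma bmeas_comp (g : T -> Y) (f : Y -> R) : measurable_fun setT g -> bmeas f ->
  bmeas (fun x => f (g x)).
Proof.
move=> mg [mf [M fM]]; split; first exact: measurableT_comp.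
by exists M => x; exact: fM.
Qed.
End change_of_measure.

(** * Adapted events and conditional independence *)

Section adapted_events.
Context {d d'} {X : measurableType d} {Y : measurableType d'} {R : realType}.
Variables (rho : probability X R) (P : probability (X * Y)%type R).
Hypothesis marg : forall A, measurable A -> P (A `*` setT) = rho A.
Implicit Types (G : set (set X)) (A : set (X * Y)).

Lemma Ex_marginal (h : X -> R) : bmeas h -> Ex P (fun w => h w.1) = Ex rho h.
Proof.
move=> bh; have [Q [QE QEx]] := push_ex P (@measurable_fst _ _ X Y).
rewrite -[LHS](QEx _ bh); apply: Ex_eq_measure => A mA; rewrite QE// -marg//.
by congr (P _); apply/seteqP; split => x /=; [|case].
Qed.

(** [S] ranges over all measurable sets, so [g] is a version of the conditional probability of [A]
    given the whole first coordinate; the requirement is that it can be chosen [G]-measurable. *)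
Definition adapted_event G A := exists g : X -> R,
  [/\ Gmeas G g, forall x, 0 <= g x <= 1 &
      forall S, measurable S ->
        Ex P (fun w => \1_A w * \1_S w.1) = Ex rho (fun x => \1_S x * g x)].

(** The dual form of [adapted_event]. No density occurs in it: each test function gives one linear
    equation in [P], a form suited to passing to limits. *)
Definition orth_event G A := forall h : X -> R, bmeas h ->
  (forall S, G S -> Ex rho (fun x => \1_S x * h x) = 0) ->
  Ex P (fun w => \1_A w * h w.1) = 0.

Let bfst (h : X -> R) : bmeas h -> bmeas (fun w : X * Y => h w.1).
Proof. by apply: bmeas_comp; exact: measurable_fst. Qed.

(** The difference $1_A-g$ is orthogonal to every indicator of the first coordinate, hence to every
    bounded function of it. *)
Lemma density_Ex A (g h : X -> R) : measurable A -> bmeas g -> bmeas h ->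
  (forall S, measurable S ->
     Ex P (fun w => \1_A w * \1_S w.1) = Ex rho (fun x => \1_S x * g x)) ->
  Ex P (fun w => \1_A w * h w.1) = Ex rho (fun x => h x * g x).
Proof.
move=> mA bg bh gE; have bA := @bmeas_indic _ _ R _ mA.
rewrite -(Ex_marginal (bmeasM bh bg)).
pose a w := \1_A w - g w.1.
have ba : bmeas a by apply: bmeasB => //; exact: bfst.
have := @Ex_ortho _ _ _ P (preimage_set_system setT fst measurable) a (fun w => h w.1).
have -> : Ex P (fun w => h w.1 * a w) = Ex P (fun w => \1_A w * h w.1) - Ex P (fun w => h w.1 * g w.1).
  rewrite -ExB; last 2 first.
  - by apply: bmeasM => //; exact: bfst.
  - by apply: bmeasM => //; exact: bfst.
  by congr Ex; apply: funext => w; rewrite /a mulrBr mulrC.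
move=> H; apply/eqP; rewrite -subr_eq0; apply/eqP; apply: H => //; last exact: bfst.
- by move=> _ [S mS <-]; rewrite setTI; rewrite -[X in measurable X]setTI; exact: measurable_fst.
- move=> _ [S mS <-]; rewrite setTI /a.
  have bS := @bmeas_indic _ _ R _ mS.
  rewrite [X in Ex P X](_ : _ = fun w => \1_A w * \1_S w.1 - \1_S w.1 * g w.1); last first.
    by apply: funext => w; rewrite mulrBr mulrC.
  rewrite ExB; last 2 first.
  - by apply: bmeasM => //; exact: (bfst bS).
  - by apply: bmeasM; [exact: (bfst bS)|exact: bfst].
  by rewrite gE// (Ex_marginal (bmeasM bS bg)) subrr.
- move=> r; exists [set x | r <= h x]; last by rewrite setTI.
  apply: Gmeas_ge => U mU.
  by rewrite -[X in measurable X]setTI; case: bh => mh _; exact: mh.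
Qed.

Lemma adapted_orth G A : (forall S, G S -> measurable S) -> sigma_algebra setT G ->
  measurable A -> adapted_event G A -> orth_event G A.
Proof.
move=> mG sG mA [g [Gg g01 gE]] h bh h0.
have mg := Gmeas_meas mG Gg.
rewrite (density_Ex mA _ bh gE); last exact: bmeas01.
rewrite [X in Ex rho X](_ : _ = fun x => g x * h x); last by apply: funext => x; rewrite mulrC.
apply: (@Ex_ortho _ _ _ rho G) => //; last exact: bmeas01.
by move=> r; exact: Gmeas_ge.
Qed.

(** The set function $S\mapsto P(A\cap(S\times Y))$ is additive and dominated by the marginal
    [rho]. *)
Lemma density_exists G A : (forall S, G S -> measurable S) -> sigma_algebra setT G ->
  measurable A -> exists q : X -> R,
  [/\ Gmeas G q, forall x, 0 <= q x <= 1 &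
      forall S, G S ->
        Ex P (fun w => \1_A w * \1_S w.1) = Ex rho (fun x => \1_S x * q x)].
Proof.
move=> mG sG mA.
have bA := @bmeas_indic _ _ R _ mA.
have bS S : G S -> bmeas (\1_S : X -> R) by move=> /mG; exact: bmeas_indic.
apply: (@radon_nikodym_sub _ _ _ rho G
  (fun S => Ex P (fun w => \1_A w * \1_S w.1)) sG mG).
- by move=> S; apply: Ex_ge0 => w; rewrite mulr_ge0// indicE.
- move=> S GS; rewrite -Ex_indic; last exact: mG.
  rewrite -(Ex_marginal (bS _ GS)); apply: Ex_le.
  + by apply: bmeasM => //; exact: (bfst (bS _ GS)).
  + exact: (bfst (bS _ GS)).
  + by move=> w; rewrite ler_piMl// indicE//; case: (_ \in _).
- move=> B C GB GC BC; rewrite -ExD; last 2 first.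
  + by apply: bmeasM => //; exact: (bfst (bS _ GB)).
  + by apply: bmeasM => //; exact: (bfst (bS _ GC)).
  congr Ex; apply: funext => w; rewrite -mulrDr; congr (_ * _).
  rewrite !indicE in_setU; case: (boolP (w.1 \in B)) => wB /=; last by rewrite add0r.
  case: (boolP (w.1 \in C)) => wC; last by rewrite addr0.
  move: BC; rewrite disj_set2E => /eqP BC0.
  by have [] : set0 w.1 by rewrite -BC0; split; exact: set_mem.
Qed.

(* With p, q the densities of the event over the full and the sub-sigma-algebra, p - q is orthogonal to G, hence to the event, hence to p; being also orthogonal to q it vanishes. *)
Lemma orth_adapted G A : (forall S, G S -> measurable S) -> sigma_algebra setT G ->
  measurable A -> orth_event G A -> adapted_event G A.
Proof.
move=> mG sG mA oA.
have [p [mp p01 pE]] := @density_exists measurable A (fun S mS => mS)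
  (sigma_algebra_measurable _) mA.
have [q [Gq q01 qE]] := density_exists mG sG mA.
have mq := Gmeas_meas mG Gq.
have bp : bmeas p by apply: bmeas01 => //; exact: (@Gmeas_meas _ _ _ measurable).
have bq : bmeas q by exact: bmeas01.
pose h x := p x - q x; have bh : bmeas h by exact: bmeasB.
have h0 S : G S -> Ex rho (fun x => \1_S x * h x) = 0.
  move=> GS; have bS := @bmeas_indic _ _ R _ (mG _ GS).
  rewrite [X in Ex rho X](_ : _ = fun x => \1_S x * p x - \1_S x * q x); last first.
    by apply: funext => x; rewrite mulrBr.
  by rewrite ExB -?pE ?qE ?subrr//; [exact: mG|exact: bmeasM..].
have hp : Ex rho (fun x => h x * p x) = 0.
  by rewrite -(density_Ex mA bp bh pE); exact: oA.
have hq : Ex rho (fun x => q x * h x) = 0.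
  by apply: (@Ex_ortho _ _ _ rho G) => // r; exact: Gmeas_ge.
have hh : Ex rho (fun x => h x * h x) = 0.
  rewrite [X in Ex rho X](_ : _ = fun x => h x * p x - q x * h x).
    by rewrite ExB ?hp ?hq ?subrr//; exact: bmeasM.
  by apply: funext => x; rewrite /h; ring.
exists q; split => // S mS; rewrite pE//.
have bS := @bmeas_indic _ _ R _ mS.
have := Ex_sq0 bh bS hh.
rewrite [X in Ex rho X](_ : _ = fun x => \1_S x * p x - \1_S x * q x); last first.
  by apply: funext => x; rewrite mulrBr.
by rewrite ExB; [move/eqP; rewrite subr_eq0 => /eqP|exact: bmeasM..].
Qed.
End adapted_events.

Section condprob_clamp.
Context {d} {T : measurableType d} {R : realType}.
Variables (P : probability T R) (H : set (set T)) (A : set T).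
Hypothesis sH : sigma_algebra setT H.
Hypothesis mH : forall S, H S -> measurable S.
Hypothesis mA : measurable A.

(** The sets $\{f<0\}$ and $\{f>1\}$ lie in [H], so the defining identity may be tested on them; the
    signs of $f$ and $f-1$ there force both to be null. Clamping therefore gives a bounded version,
    to which the calculus of [Ex] applies. *)
Lemma condprob_clamp f : is_condprob P H A f -> exists f' : T -> R, exists N : set T,
  [/\ Gmeas H f', forall x, 0 <= f' x <= 1,
      forall S, H S -> Ex P (fun x => \1_S x * f' x) = Ex P (fun x => \1_A x * \1_S x),
      measurable N & P N = 0%E /\ forall x, ~ N x -> f x = f' x].
Proof.
move=> [Hf fE]; have mf : measurable_fun setT f by exact: (Gmeas_meas mH Hf).
pose D1 := f @^-1` `]-oo, 0[%classic; pose D2 := f @^-1` `]1, +oo[%classic.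
have HD1 : H D1 by exact: Hf.
have HD2 : H D2 by exact: Hf.
have mD1 := mH HD1; have mD2 := mH HD2.
have PD1 : P D1 = 0%E.
  have : (\int[P]_(x in D1) `|(f x)%:E| = 0)%E.
    rewrite (eq_integral (fun x => - (f x)%:E)%E); last first.
      by move=> x /set_mem; rewrite /D1 /= in_itv /= => fx; rewrite ltr0_norm.
    apply/eqP; rewrite eq_le; apply/andP; split.
      rewrite -[leLHS]oppeK -integral_ge0N.
        rewrite oppe_le0 (eq_integral (fun x => (f x)%:E)) ?fE//.
        by move=> x _; rewrite oppeK.
      by move=> x; rewrite /D1 /= in_itv /= => fx; rewrite lee_fin oppr_ge0 ltW.
    by apply: integral_ge0 => x; rewrite /D1 /= in_itv /= => fx; rewrite lee_fin oppr_ge0 ltW.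
  have mf1 : measurable_fun D1 (EFin \o f).
    by apply/measurable_EFinP; exact: measurable_funTS.
  move/(ae_eq_integral_abs _ mD1 mf1) => [N [mN N0 sN]].
  apply: (subset_measure0 mD1 mN _ N0) => x Dx; apply: sN => /= /(_ Dx) [fx].
  by move: Dx; rewrite /D1 /= in_itv /= fx ltxx.
have PD2 : P D2 = 0%E.
  have mf2 : measurable_fun D2 (fun x => (f x - 1)%:E).
    by apply/measurable_EFinP; apply: measurable_funB => //; exact: measurable_funTS.
  have f10 x : D2 x -> (0 <= (f x - 1)%:E)%E.
    by rewrite /D2 /= in_itv /= andbT => fx; rewrite lee_fin subr_ge0 ltW.
  have : (\int[P]_(x in D2) `|(f x - 1)%:E| = 0)%E.
    rewrite (eq_integral (fun x => (f x - 1)%:E)%E); last first.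
      by move=> x /set_mem Dx; rewrite gee0_abs// f10.
    have : (\int[P]_(x in D2) ((f x - 1)%:E + 1) = P (A `&` D2))%E.
      by rewrite -fE//; apply: eq_integral => x _; rewrite -EFinD subrK.
    rewrite ge0_integralD//.
    rewrite integral_cst// mul1e => e.
    apply/eqP; rewrite eq_le integral_ge0// andbT.
    have : (\int[P]_(x in D2) (f x - 1)%:E + P D2 <= P D2)%E.
      by rewrite e; apply: le_measure; rewrite ?inE//; exact: measurableI.
    by rewrite -[leRHS]add0e leeD2rE// fin_num_measure.
  move/(ae_eq_integral_abs _ mD2 mf2) => [N [mN N0 sN]].
  apply: (subset_measure0 mD2 mN _ N0) => x Dx; apply: sN => /= /(_ Dx) [/eqP].
  by move: Dx; rewrite /D2 /= in_itv /= andbT subr_eq0 => /gt_eqF ->.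
pose f' x := Num.min (Num.max (f x) 0) 1.
pose N := D1 `|` D2.
have mN : measurable N by exact: measurableU.
have PN : P N = 0%E by rewrite null_set_setU.
have Hf' : Gmeas H f'.
  apply: (Gmeas_min sH); last exact: (Gmeas_cst sH).
  by apply: (Gmeas_max sH) => //; exact: (Gmeas_cst sH).
have f'01 x : 0 <= f' x <= 1.
  by rewrite /f' ge_min lexx orbT andbT le_min le_max lexx orbT ler01.
have bf' : bmeas f' by apply: bmeas01 => //; exact: (Gmeas_meas mH).
have ff' x : ~ N x -> f x = f' x.
  rewrite /N /D1 /D2 /f' => h.
  have f0 : 0 <= f x by rewrite leNgt; apply/negP => h'; apply: h; left; rewrite /= in_itv.
  have f1 : f x <= 1.
    by rewrite leNgt; apply/negP => h'; apply: h; right; rewrite /= in_itv /= h'.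
  by rewrite (max_idPl f0) (min_idPl f1).
exists f', N; split => // S HS.
have mS := mH HS; have bA := @bmeas_indic _ _ R _ mA.
apply: EFin_inj; rewrite Ex_EFin_set//.
rewrite [X in Ex P X](_ : _ = \1_(A `&` S)); last first.
  by apply: funext => x; rewrite indicI.
rewrite Ex_indic; last exact: measurableI.
rewrite fineP; last exact: measurableI.
rewrite -fE//; apply: ae_eq_integral => //.
- by apply/measurable_EFinP; apply: measurable_funTS; exact: bmeas_meas.
- by apply/measurable_EFinP; exact: measurable_funTS.
exists N; split => // x /= /not_implyP [Sx ne]; apply: contrapT => /ff' e.
by apply: ne; rewrite e.
Qed.
End condprob_clamp.

Section conditional_independence.
Context {d d'} {X : measurableType d} {Y : measurableType d'} {R : realType}.
Variables (rho : probability X R) (P : probability (X * Y)%type R).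
Hypothesis marg : forall A, measurable A -> P (A `*` setT) = rho A.
Variables (G : set (set X)) (F1 : set (set (X * Y))).
Hypothesis sG : sigma_algebra setT G.
Hypothesis mG : forall S, G S -> measurable S.
Hypothesis mF1 : forall A, F1 A -> measurable A.
Local Notation H := (preimage_set_system setT (fst : X * Y -> X) G).

Let sH : sigma_algebra setT H. Proof. exact: sigma_algebra_preimage. Qed.
Let mfst (S : set X) : measurable S -> measurable ((fst : X * Y -> X) @^-1` S).
Proof. by move=> mS; rewrite -[X in measurable X]setTI; exact: measurable_fst. Qed.
Let mH S : H S -> measurable S.
Proof. by move=> [S' /mG mS <-]; rewrite setTI; exact: mfst. Qed.
Let Hfst (g : X -> R) : Gmeas G g -> Gmeas H (fun w => g w.1).
Proof. by move=> Gg U mU; exists (g @^-1` U); [exact: Gg|rewrite setTI]. Qed.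
Let bfst (h : X -> R) : bmeas h -> bmeas (fun w : X * Y => h w.1).
Proof. by apply: bmeas_comp; exact: measurable_fst. Qed.

(** If the conditional probabilities multiply, then $P(A\cap A_2)=E[f_1f_2]=E[f_1 1_{A_2}]$ for
    every event $A_2$ of the first coordinate, so $f_1$ is already the density over the full
    sigma-algebra. Conversely, an adapted density [g] of [A] and the conditional probability [q] of
    $A_2$ give $E[1_{S'}1_S g]=E[1_{S'}q\,g]$, that is, the product rule. *)
Lemma cond_indep_adapted :
  cond_indep P F1 (Defs.preim (fst : X * Y -> X)) H <->
  forall A, F1 A -> adapted_event rho P G A.
Proof.
split.
- move=> ci A FA; have mA := mF1 FA; have bA := @bmeas_indic _ _ R _ mA.
  have [q [Gq q01 qE]] := density_exists marg mG sG mA.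
  have bq : bmeas q by apply: bmeas01 => //; exact: Gmeas_meas Gq.
  have bq' := bfst bq.
  exists q; split => // S mS; have bS := @bmeas_indic _ _ R _ mS.
  pose A2 : set (X * Y) := fst @^-1` S.
  have mA2 : measurable A2 by exact: mfst.
  have [f1 [f2 [c1 c2 c12]]] := ci A A2 FA (ex_intro2 _ _ S mS (setTI _)).
  have [g1 [N1 [Hg1 g1b g1E mN1 [PN1 fg1]]]] := condprob_clamp sH mH mA c1.
  have [g2 [N2 [Hg2 g2b g2E mN2 [PN2 fg2]]]] := condprob_clamp sH mH mA2 c2.
  have [g3 [N3 [Hg3 g3b g3E mN3 [PN3 fg3]]]] := condprob_clamp sH mH (measurableI _ _ mA mA2) c12.
  have bg1 : bmeas g1 by apply: bmeas01 => //; exact: Gmeas_meas Hg1.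
  have bg2 : bmeas g2 by apply: bmeas01 => //; exact: Gmeas_meas Hg2.
  have bg3 : bmeas g3 by apply: bmeas01 => //; exact: Gmeas_meas Hg3.
  have bA2 := @bmeas_indic _ _ R _ mA2.
  have HT := sigma_algebraT sH.
  have E3 : Ex P g3 = Ex P (fun w => \1_A w * \1_A2 w).
    transitivity (Ex P (fun w => \1_[set: X * Y] w * g3 w)).
      by congr Ex; apply: funext => w; rewrite indicT mul1r.
    by rewrite (g3E _ HT); congr Ex; apply: funext => w; rewrite indicI indicT mulr1.
  have E12 : Ex P g3 = Ex P (fun w => g1 w * g2 w).
    rewrite /Ex /Rintegral; congr fine; apply: ae_eq_integral => //.
    - by apply/measurable_EFinP; exact: bmeas_meas.
    - by apply/measurable_EFinP; apply: bmeas_meas; exact: bmeasM.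
    exists (N1 `|` N2 `|` N3); split.
    - by do 2?apply: measurableU.
    - by rewrite null_set_setU ?null_set_setU//; exact: measurableU.
    move=> w /= ne; apply: contrapT => h; apply: ne => _; congr EFin.
    by rewrite -fg1 -?fg2 -?fg3// => hN; apply: h; [right|left;right|left;left].
  have o2 : Ex P (fun w => g1 w * (g2 w - \1_A2 w)) = 0.
    apply: (@Ex_ortho _ _ _ P H) => //; first exact: bmeasB.
      move=> S' HS'; have bS' := @bmeas_indic _ _ R _ (mH HS').
      rewrite [X in Ex P X](_ : _ = fun w => \1_S' w * g2 w - \1_A2 w * \1_S' w); last first.
        by apply: funext => w; ring.
      by rewrite ExB ?g2E ?subrr//; exact: bmeasM.
    by move=> r; exact: Gmeas_ge.
  have o1 S' : H S' -> Ex P (fun w => \1_S' w * (g1 w - q w.1)) = 0.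
    move=> HS'; have bS' := @bmeas_indic _ _ R _ (mH HS').
    rewrite [X in Ex P X](_ : _ = fun w => \1_S' w * g1 w - \1_S' w * q w.1); last first.
      by apply: funext => w; ring.
    rewrite ExB//; [|exact: bmeasM..].
    rewrite g1E//; have [S0 GS0 S0E] := HS'.
    rewrite -S0E setTI; have bS0 := @bmeas_indic _ _ R _ (mG GS0).
    have := qE _ GS0; rewrite -(Ex_marginal marg (bmeasM bS0 bq)) => e.
    by apply/eqP; rewrite subr_eq0; apply/eqP; exact: e.
  have b1 : bmeas (fun w => g1 w - q w.1) by exact: bmeasB.
  (* [g1] lives on the product, whereas the witness [q] is a function of x. Both are versions of the
     same conditional probability, so their [H]-measurable difference is orthogonal to itself. *)
  have o11 : Ex P (fun w => (g1 w - q w.1) * (g1 w - q w.1)) = 0.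
    apply: (@Ex_ortho _ _ _ P H) => // r; apply: Gmeas_ge.
    by apply: (GmeasB sH) => //; exact: Hfst.
  have o3 := Ex_sq0 b1 bA2 o11.
  rewrite -[LHS]E3 E12 -(Ex_marginal marg (bmeasM bS bq)).
  apply/eqP; rewrite -subr_eq0 -ExB; [|exact: bmeasM|exact: (bfst (bmeasM bS bq))].
  rewrite [X in Ex P X](_ : _ = fun w => g1 w * (g2 w - \1_A2 w) + \1_A2 w * (g1 w - q w.1)).
    by rewrite ExD ?o2 ?o3 ?addr0//; [apply: bmeasM => //; exact: bmeasB|exact: bmeasM].
  by apply: funext => w; rewrite (_ : \1_A2 w = \1_S w.1)//; ring.
- move=> ad A _ FA [S mS <-]; rewrite setTI.
  have mA := mF1 FA; have bA := @bmeas_indic _ _ R _ mA.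
  have bS := @bmeas_indic _ _ R _ mS.
  have [g [Gg g01 gE]] := ad _ FA.
  have bg : bmeas g by apply: bmeas01 => //; exact: Gmeas_meas Gg.
  pose A2 : set (X * Y) := fst @^-1` S.
  have mA2 : measurable A2 by exact: mfst.
  have [q [Gq q01 qE]] := density_exists marg mG sG mA2.
  have bq : bmeas q by apply: bmeas01 => //; exact: Gmeas_meas Gq.
  have cp (B : set (X * Y)) (f : X -> R) : measurable B -> Gmeas G f -> bmeas f ->
      (forall S', G S' -> Ex P (fun w => \1_B w * \1_S' w.1) = Ex rho (fun x => \1_S' x * f x)) ->
      is_condprob P H B (fun w => f w.1).
    move=> mB Gf bf fE; split; first exact: Hfst.
    move=> _ [S' GS' <-]; rewrite setTI.
    have mS' := mG GS'; have bS' := @bmeas_indic _ _ R _ mS'.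
    rewrite -Ex_EFin_set; [|exact: bfst|exact: mfst].
    rewrite -fineP; last by apply: measurableI => //; exact: mfst.
    rewrite -Ex_indic; last by apply: measurableI => //; exact: mfst.
    congr EFin; rewrite [RHS](_ : _ = Ex P (fun w => \1_B w * \1_S' w.1)).
      by rewrite fE//; exact: (Ex_marginal marg (bmeasM bS' bf)).
    by congr Ex; apply: funext => w; rewrite indicI.
  exists (fun w => g w.1), (fun w => q w.1); split.
  + by apply: cp => // S' GS'; apply: gE; exact: mG.
  + exact: cp.
  + apply: (cp _ (fun x => g x * q x)).
    * exact: measurableI.
    * exact: (GmeasM sG).
    * exact: bmeasM.
    move=> S' GS'; have mS' := mG GS'; have bS' := @bmeas_indic _ _ R _ mS'.
    have mSS := measurableI _ _ mS mS'.
    rewrite [LHS](_ : _ = Ex P (fun w => \1_A w * \1_(S `&` S') w.1)); last first.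
      by congr Ex; apply: funext => w; rewrite !indicI -mulrA.
    rewrite gE//; apply/eqP; rewrite -subr_eq0 -ExB; last 2 first.
    * by apply: bmeasM => //; exact: bmeas_indic.
    * by apply: bmeasM => //; exact: bmeasM.
    rewrite [X in Ex rho X](_ : _ = fun x => (\1_S' x * g x) * (\1_S x - q x)); last first.
      by apply: funext => x; rewrite indicI /=; ring.
    apply/eqP; apply: (@Ex_ortho _ _ _ rho G) => //.
    * exact: bmeasB.
    * move=> S0 GS0; have mS0 := mG GS0; have bS0 := @bmeas_indic _ _ R _ mS0.
      rewrite [X in Ex rho X](_ : _ = fun x => \1_S0 x * \1_S x - \1_S0 x * q x); last first.
        by apply: funext => x; ring.
      rewrite ExB; [|exact: bmeasM..].
      rewrite -qE// -(Ex_marginal marg (bmeasM bS0 bS)).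
      rewrite [X in _ - X](_ : _ = Ex P (fun w => \1_S0 w.1 * \1_S w.1)) ?subrr//.
      by congr Ex; apply: funext => w; rewrite mulrC.
    * move=> r; apply: Gmeas_ge; apply: (GmeasM sG) => //; exact: Gmeas_indic.
    * exact: bmeasM.
Qed.
End conditional_independence.

(** * Bases of cozero sets *)

Section good_spaces.
Context {R : realType}.

(* Replaces second countability: this property passes to products and to [PM X]. *)
Definition cozero_base {d} (X : topMeasType d) := exists h : nat -> X -> R,
  [/\ forall i, continuous (h i) /\ measurable_fun setT (h i),
      forall i x, 0 <= h i x <= 1,
      forall x (U : set X), nbhs x U -> exists i, 0 < h i x /\ (forall y, 0 < h i y -> U y) &
      @measurable _ X `<=` <<s [set S | exists i, S = [set x | 0 < h i x]] >>].

Lemma cozero_base_open {d} (X : topMeasType d) (U : set X) : cozero_base X ->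
  open U -> measurable U.
Proof.
move=> [h [ch h01 hb _]] oU.
have -> : U = \bigcup_(i in [set i | forall y, 0 < h i y -> U y]) [set x | 0 < h i x].
  apply/seteqP; split => [x Ux|x [i /= iU] /iU//].
  by have [i [hix hiU]] := hb x U (open_nbhs_nbhs (conj oU Ux)); exists i.
apply: bigcup_measurable => i _.
rewrite (_ : [set x | _] = setT `&` h i @^-1` `]0, +oo[%classic).
  by case: (ch i) => _; apply => //; exact: measurable_itv.
by apply/seteqP; split => x /=; rewrite in_itv /= andbT // => -[].
Qed.

Lemma continuous_meas {d} (X : topMeasType d) (f : X -> R) : cozero_base X ->
  continuous f -> measurable_fun setT f.
Proof.
move=> gX cf; apply: (measurability _ (RGenOInfty.measurableE R)) => //.
move=> _ [_ [r ->] <-]; rewrite setTI; apply: (cozero_base_open gX).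
by move/continuousP : cf; apply; exact: itv_open_ends_open.
Qed.
End good_spaces.
Arguments cozero_base R {d} X.

(** * Convergence in the weak topology *)

Section weak_topology.
Context {R : realType} {d} {X : topMeasType d}.

Lemma BC_bmeas (f : BC X R) : cozero_base R X -> bmeas (sval f).
Proof. by move=> gX; case: f => f /= [cf [M fM]]; split; [exact: continuous_meas|exists M]. Qed.

Lemma initial_nbhs (S : choiceType) (Z : topologicalType) (g : S -> Z)
  (s : initial_topology g) (U : set (initial_topology g)) :
  nbhs s U -> exists2 V : set Z, nbhs (g s) V & g @^-1` V `<=` U.
Proof.
rewrite nbhsE => -[_ [[V oV <-] Vs] sU]; exists V => //.
by exists V.
Qed.

Lemma PM_cvgP (F : set_system (PM X R)) (P : PM X R) : Filter F ->
  (forall f : BC X R, (fun Q : PM X R => Ex (PMof Q) (sval f)) @ F --> Ex (PMof P) (sval f)) ->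
  F --> P.
Proof.
move=> FF h U nU.
have [V nV VU] := @initial_nbhs (PMraw X R) {ptws (BC X R) -> R} (@integ _ X R) P U nU.
have : (@integ _ X R) @ F --> (integ P : {ptws (BC X R) -> R}).
  apply/cvg_sup => f W nW.
  have [W' nW' W'W] := @initial_nbhs {ptws (BC X R) -> R} R (fun g => g f) (integ P) W nW.
  have FW' : F [set Q | W' (Ex (PMof Q) (sval f))] by exact: h f W' nW'.
  by change (F [set Q | W (@integ _ X R Q)]); 
     apply: (@filterS _ F FF _ [set Q | W (@integ _ X R Q)] _ FW') => Q hQ; exact: (W'W (integ Q) hQ).
move=> /(_ V nV) FV; have FV' : F [set Q | V (@integ _ X R Q)] by exact: FV.
by apply: filterS FV'.
Qed.

Lemma PM_cont (f : BC X R) : continuous (fun Q : PM X R => Ex (PMof Q) (sval f)).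
Proof.
move=> P V nV.
have c1 : continuous (@integ _ X R : PM X R -> {ptws (BC X R) -> R}).
  exact: initial_continuous.
have c2 : continuous (fun g : {ptws (BC X R) -> R} => g f).
  move=> g W nW; have hg : nbhs g --> (g : {ptws (BC X R) -> R}) by [].
  have /cvg_sup/(_ f) := hg; apply.
  exact: (@initial_continuous {ptws (BC X R) -> R} R (fun g => g f) g W nW).
exact: (@continuous_comp _ _ _ _ (fun g : {ptws (BC X R) -> R} => g f) P (c1 P) (c2 _) V nV).
Qed.
End weak_topology.

Section cozero_base_prod.
Context {R : realType} {d1 d2} {X : topMeasType d1} {Y : topMeasType d2}.

Lemma sigma_preimage_sub (T U : Type) (f : T -> U) (B : set (set U)) (K : set (set T)) :
  sigma_algebra setT K -> (forall A, B A -> K (f @^-1` A)) ->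
  forall A, <<s B >> A -> K (f @^-1` A).
Proof.
move=> [K0 KC KU] BK A.
apply: (@smallest_sub _ _ _ [set A | K (f @^-1` A)]) => //.
split => /=.
- by rewrite preimage_set0.
- by move=> S; rewrite setTD => /KC; rewrite setTD preimage_setC.
- by move=> F KF; rewrite preimage_bigcup; exact: KU.
Qed.

Lemma sigma_algebra_smallest (T : Type) (B : set (set T)) : sigma_algebra setT <<s B >>.
Proof. exact: smallest_sigma_algebra. Qed.

(** The products $h_i(x)k_j(y)$ have the rectangles as cozero sets. The cylinder over $\{h_i>0\}$ is
    a countable union of rectangles because the sets $\{k_j>0\}$ cover the second factor. Codes of
    no pair get the zero function, whose cozero set is empty. *)
Lemma cozero_base_prod : cozero_base R X -> cozero_base R Y -> cozero_base R (X * Y)%type.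
Proof.
move=> [h [ch h01 hb hs]] [k [ck k01 kb ks]].
pose f n (z : X * Y) : R :=
  if unpickle n is Some ij then h ij.1 z.1 * k ij.2 z.2 else 0.
exists f; split.
- move=> n; rewrite /f; case: unpickle => [[i j]|]; last first.
    by split; [exact: cst_continuous|exact: measurable_cst].
  split => /=.
    move=> z; apply: cvgM; [apply: (@cvg_comp _ _ _ fst (h i))|apply: (@cvg_comp _ _ _ snd (k j))].
    + exact: cvg_fst.
    + exact: (ch i).1.
    + exact: cvg_snd.
    + exact: (ck j).1.
  apply: measurable_funM; apply: measurableT_comp => //.
  + exact: (ch i).2.
  + exact: (ck j).2.
- move=> n z; rewrite /f; case: unpickle => [[i j]|]; last by rewrite lexx ler01.
  have /andP[a b] := h01 i z.1; have /andP[a' b'] := k01 j z.2.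
  by rewrite mulr_ge0//= mulr_ile1.
- move=> [x y] U [[/= V W] [nV nW] VWU].
  have [i [hi hiV]] := hb _ _ nV; have [j [kj kjW]] := kb _ _ nW.
  exists (pickle (i, j)); rewrite /f pickleK /=; split; first exact: mulr_gt0.
  move=> [x' y'] /= p; apply: VWU => /=; split => /=.
    apply: hiV; rewrite lt_neqAle eq_sym; case/andP: (h01 i x') => -> _; rewrite andbT.
    by apply: contraTneq p => ->; rewrite mul0r ltxx.
  apply: kjW; rewrite lt_neqAle eq_sym; case/andP: (k01 j y') => -> _; rewrite andbT.
  by apply: contraTneq p => ->; rewrite mulr0 ltxx.
- set B := [set S | _].
  have sK := sigma_algebra_smallest B.
  have sub1 A : measurable A -> <<s B >> ((fst : X * Y -> X) @^-1` A).
    move=> /hs; apply: sigma_preimage_sub => // _ [i ->].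
    suff -> : (fst : X * Y -> X) @^-1` [set x | 0 < h i x] =
        \bigcup_j [set z : X * Y | 0 < f (pickle (i, j : nat)) z].
      by apply: sigma_algebra_bigcup => j; apply: sub_sigma_algebra; exists (pickle (i, j)).
    apply/seteqP; split => [[x y] /= hx|[x y] [j _] /=].
      have [j [kj _]] := kb y setT filterT.
      by exists j => //=; rewrite /f pickleK mulr_gt0.
    rewrite /f pickleK /= => p.
    rewrite lt_neqAle eq_sym; case/andP: (h01 i x) => -> _; rewrite andbT.
    by apply: contraTneq p => ->; rewrite mul0r ltxx.
  have sub2 A : measurable A -> <<s B >> ((snd : X * Y -> Y) @^-1` A).
    move=> /ks; apply: sigma_preimage_sub => // _ [j ->].
    suff -> : (snd : X * Y -> Y) @^-1` [set x | 0 < k j x] =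
        \bigcup_i [set z : X * Y | 0 < f (pickle (i : nat, j)) z].
      by apply: sigma_algebra_bigcup => i; apply: sub_sigma_algebra; exists (pickle (i, j)).
    apply/seteqP; split => [[x y] /= hx|[x y] [i _] /=].
      have [i [hi _]] := hb x setT filterT.
      by exists i => //=; rewrite /f pickleK mulr_gt0.
    rewrite /f pickleK /= => p.
    rewrite lt_neqAle eq_sym; case/andP: (k01 j y) => -> _; rewrite andbT.
    by apply: contraTneq p => ->; rewrite mulr0 ltxx.
  apply: smallest_sub => // _ [[A mA <-]|[A mA <-]]; rewrite setTI; [exact: sub1|exact: sub2].
Qed.
End cozero_base_prod.

Section continuous_lattice.
Context {R : realType} {X : topologicalType}.
Implicit Types f g : X -> R.

Lemma continuous_maxr f g : continuous f -> continuous g ->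
  continuous (fun x => Num.max (f x) (g x)).
Proof. by move=> cf cg x; apply: (@continuous_max R X f g x); [exact: cf|exact: cg]. Qed.

Lemma continuous_minr f g : continuous f -> continuous g ->
  continuous (fun x => Num.min (f x) (g x)).
Proof. by move=> cf cg x; apply: (@continuous_min R X f g x); [exact: cf|exact: cg]. Qed.

Lemma continuousDr f g : continuous f -> continuous g -> continuous (fun x => f x + g x).
Proof. by move=> cf cg x; apply: cvgD; [exact: cf|exact: cg]. Qed.

Lemma continuousBr f g : continuous f -> continuous g -> continuous (fun x => f x - g x).
Proof. by move=> cf cg x; apply: cvgB; [exact: cf|exact: cg]. Qed.

Lemma continuousMr f g : continuous f -> continuous g -> continuous (fun x => f x * g x).
Proof. by move=> cf cg x; apply: cvgM; [exact: cf|exact: cg]. Qed.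

Lemma continuous_cstr (c : R) : continuous (fun _ : X => c).
Proof. exact: cst_continuous. Qed.

Lemma continuous_sumr (I : Type) (s : seq I) (F : I -> X -> R) :
  (forall i, continuous (F i)) -> continuous (fun x => \sum_(i <- s) F i x).
Proof.
move=> cF; elim: s => [|i s IH].
  by under eq_fun do rewrite big_nil; exact: continuous_cstr.
by under eq_fun do rewrite big_cons; exact: continuousDr.
Qed.
End continuous_lattice.

(** * The time interval and the path space *)

Section time_interval.
Variables (R : realType) (T : {posnum R}).
Local Notation time := (time T).

Lemma val_time01 (t : time) : 0 <= val t <= T%:num.
Proof. by case: t => r /= rI; move: rI; rewrite inE /Iset /= in_itv. Qed.

Lemma clamp_subproof (r : R) : Num.min (Num.max r 0) T%:num \in Iset T.
Proof.
by rewrite inE /Iset /= in_itv /= ge_min lexx orbT andbT le_min le_max lexx orbT /=.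
Qed.

Definition clamp_time (r : R) : time := exist (fun x => x \in Iset T) _ (clamp_subproof r).

Lemma val_clamp_time (r : R) : val (clamp_time r) = Num.min (Num.max r 0) T%:num.
Proof. by []. Qed.

Lemma clamp_timeK (t : time) : clamp_time (val t) = t.
Proof.
apply: val_inj; rewrite val_clamp_time; have /andP[t0 t1] := val_time01 t.
by rewrite (max_idPl t0) (min_idPl t1).
Qed.

Lemma val_clamp_id (r : R) : 0 <= r <= T%:num -> val (clamp_time r) = r.
Proof. by move=> /andP[t0 t1]; rewrite val_clamp_time (max_idPl t0) (min_idPl t1). Qed.

Lemma val_time_continuous : continuous (fun t : time => val t : R).
Proof. exact: initial_continuous. Qed.

Lemma clamp_time_continuous : continuous clamp_time.
Proof.
apply: continuous_comp_initial => /=.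
apply: (continuous_minr _ (@continuous_cstr _ _ _)); apply: (continuous_maxr _ (@continuous_cstr _ _ _)).
by move=> x; exact: cvg_id.
Qed.

Lemma nbhs_time (t : time) (U : set time) : nbhs t U ->
  exists2 e : R, 0 < e & forall s : time, `|val s - val t| < e -> U s.
Proof.
move=> /(@initial_nbhs _ R (set_val : Iraw T -> R)) [V nV VU].
have [e /= e0 eV] := nV; exists e => // s st; apply: VU; apply: eV.
by rewrite /ball_ /= distrC.
Qed.

(** Heine's theorem. Extending [w] to the real line by clamping makes compactness of a real segment
    applicable, and its near-covering form yields one [d] for all centres. *)
Lemma time_unif_continuous (w : time -> R) : continuous w -> forall e : R, 0 < e ->
  exists2 d : R, 0 < d & forall s t : time, `|val s - val t| < d -> `|w s - w t| < e.
Proof.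
move=> cw e e0; pose g r := w (clamp_time r).
have cg : continuous g.
  by move=> r; apply: continuous_comp; [exact: clamp_time_continuous|exact: cw].
have /compact_near_coveringP K := @segment_compact R 0 T%:num.
have H : forall x : R, `[0, T%:num]%classic x ->
   \forall x' \near x & i \near 0^'+, forall y : R, `|x' - y| < i -> `|g x' - g y| < e.
  move=> x _.
  have e20 : 0 < e / 2 by rewrite divr_gt0.
  have /cvgrPdist_lt/(_ _ e20) := cg x.
  move=> -[r /= r0 rg].
  have r20 : 0 < r / 2 by rewrite divr_gt0.
  exists ([set x' | `|x - x'| < r / 2], [set d | d < r / 2]).
    split => /=; first by exists (r / 2).
    exact: nbhs_right_lt.
  move=> [x' d] /= [xx' dr] y yx'.
  have g1 : `|g x - g x'| < e / 2 by apply: rg => /=; apply: lt_trans xx' _; lra.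
  have g2 : `|g x - g y| < e / 2.
    apply: rg => /=; rewrite -(subrKA x' x) (le_lt_trans (ler_normD _ _))//.
    by have := lt_trans yx' dr; lra.
  rewrite -(subrKA (g x)) (le_lt_trans (ler_normD _ _))// distrC.
  lra.
have near0 : \forall d \near (0 : R)^'+, `[0, T%:num]%classic `<=`
    (fun x => forall y : R, `|x - y| < d -> `|g x - g y| < e).
  exact: (K _ _ (fun d x => forall y, `|x - y| < d -> `|g x - g y| < e) _ H).
near (0:R)^'+ => d.
exists d; first by near: d; exact: nbhs_right_gt.
have Kd : `[0, T%:num]%classic `<=` (fun x => forall y : R, `|x - y| < d -> `|g x - g y| < e).
  by near: d; exact: near0.
move=> s t st; rewrite -(clamp_timeK s) -(clamp_timeK t); apply: (Kd (val s)) => //.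
by rewrite /= in_itv /=; exact: val_time01.
Unshelve. all: by end_near. Qed.

End time_interval.

Section borel_base.
Context {R : realType} {B : ptopologicalType}.
Local Notation X := (borel B).

(** For a Borel sigma-algebra the measurability clauses are automatic: an open set is the union of
    the countably many $\{h_i>0\}$ that it contains. *)
Lemma borel_cozero_base (h : nat -> X -> R) : (forall i, continuous (h i)) ->
  (forall i x, 0 <= h i x <= 1) ->
  (forall x (U : set X), nbhs x U -> exists i, 0 < h i x /\ (forall y, 0 < h i y -> U y)) ->
  cozero_base R X.
Proof.
move=> ch h01 hb.
have oh i : open [set x | 0 < h i x].
  rewrite (_ : [set x | _] = h i @^-1` `]0, +oo[%classic); last first.
    by apply/seteqP; split => x /=; rewrite in_itv /= andbT.
  by have /continuousP := ch i; apply; exact: itv_open_ends_open.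
exists h; split => //.
- move=> i; split => //.
  apply: (measurability _ (RGenOInfty.measurableE R)) => //.
  move=> _ [_ [r ->] <-]; rewrite setTI; apply: sub_sigma_algebra.
  by have /continuousP := ch i; apply; exact: itv_open_ends_open.
- apply: smallest_sub; first exact: smallest_sigma_algebra.
  move=> U oU.
  have -> : U = \bigcup_(i in [set i | forall y, 0 < h i y -> U y]) [set x | 0 < h i x].
    apply/seteqP; split => [x Ux|x [i /= iU] /iU//].
    by have [i [hix hiU]] := hb x U (open_nbhs_nbhs (conj oU Ux)); exists i.
  rewrite bigcup_mkcond; apply: sigma_algebra_bigcup => i.
  case: ifPn => _; last exact: sigma_algebra0.
  by apply: sub_sigma_algebra; exists i.
Qed.
End borel_base.

Section metric_base.
Context {R : realType} {B : ptopologicalType}.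
Local Notation X := (borel B).
Variable D : X -> X -> R.
Hypothesis D_ge0 : forall x y, 0 <= D x y.
Hypothesis D_sym : forall x y, D x y = D y x.
Hypothesis D_tri : forall x y z, D x z <= D x y + D y z.
Hypothesis D_near : forall x (e : R), 0 < e -> nbhs x [set y : X | D y x < e].
Hypothesis D_nbhs : forall x (U : set X), nbhs x U ->
  exists2 e : R, 0 < e & forall y, D y x < e -> U y.
Hypothesis D_cover : forall e : R, 0 < e -> exists c : nat -> X, forall x, exists n, D x (c n) < e.

Lemma metric_dist_continuous x : continuous (fun y => D y x).
Proof.
move=> y; apply/cvgrPdist_lt => e e0.
apply: filterS (D_near y e0) => z /= zy.
rewrite ltr_distl; have := D_tri z y x; have := D_tri y z x; rewrite (D_sym y z); lra.
Qed.

(** Tent functions of radius $1/(k+1)$ around the points of a countable $1/(k+1)$-net. If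
    $1/(k+1)<e/2$, a tent that is positive at x is positive only within distance e of x. *)
Lemma metric_cozero_base : cozero_base R X.
Proof.
have inv0 (m : nat) : 0 < m.+1%:R^-1 :> R by rewrite invr_gt0 ltr0n.
pose c (k : nat) := sval (cid (D_cover (inv0 k))).
have cP k x : exists n, D x (c k n) < k.+1%:R^-1 by rewrite /c; case: cid.
pose h i (x : X) : R := if unpickle i is Some (n, k) then
   Num.max 0 (k.+1%:R^-1 - D x (c k n)) else 0.
have ch i : continuous (h i).
  rewrite /h; case: unpickle => [[n k]|]; last exact: continuous_cstr.
  apply: continuous_maxr; first exact: continuous_cstr.
  by apply: continuousBr; [exact: continuous_cstr|exact: metric_dist_continuous].
have hb x (U : set X) : nbhs x U -> exists i, 0 < h i x /\ (forall y, 0 < h i y -> U y).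
  move=> /D_nbhs [e e0 eU].
  pose k := Num.trunc (2 / e).
  have ke : k.+1%:R^-1 < e / 2.
    rewrite -[e / 2]invrK invf_div ltf_pV2 ?posrE ?divr_gt0 ?ltr0n//.
    exact: truncnS_gt.
  have [n xn] := cP k x.
  exists (pickle (n, k)); rewrite /h pickleK lt_max ltxx /= subr_gt0; split => // y.
  rewrite lt_max ltxx /= subr_gt0 => yn; apply: eU.
  apply: (le_lt_trans (D_tri y (c k n) x)); rewrite (D_sym (c k n) x) (splitr e).
  by apply: ltrD; exact: lt_trans ke.
apply: (@borel_cozero_base R B h) => //.
move=> i x; rewrite /h; case: unpickle => [[n k]|]; last by rewrite lexx ler01.
rewrite le_max lexx /= ge_max ler01 /=.
have : k.+1%:R^-1 <= 1 :> R by rewrite invf_le1 ?ler1n ?ltr0n.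
by apply: le_trans; rewrite lerBlDr lerDl.
Qed.
End metric_base.

Section path_space.
Variables (R : realType) (T : {posnum R}).
Local Notation time := (time T).
Local Notation Cpath := (Cpath T).

Lemma time_cozero_base : cozero_base R time.
Proof.
apply: (@metric_cozero_base R (Iraw T) (fun s t : time => `|val s - val t|)).
- by [].
- by move=> x y; rewrite distrC.
- by move=> x y z; rewrite -(subrKA (val y)) ler_normD.
- move=> x e e0; have /cvgrPdist_lt/(_ _ e0) := @val_time_continuous R T x.
  by apply: filterS => y /=; rewrite distrC.
- by move=> x U /nbhs_time.
- move=> e e0; exists (fun n => clamp_time T (n%:R * (e / 2))) => x.
  have /andP[x0 xT] := val_time01 x.
  have e20 : 0 < e / 2 by rewrite divr_gt0.
  exists (Num.trunc (val x / (e / 2))).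
  have := truncn_itv (divr_ge0 x0 (ltW e20)); set n := Num.trunc _ => /andP[n1 n2].
  rewrite ler_pdivlMr// in n1; rewrite ltr_pdivrMr// -natr1 mulrDl mul1r in n2.
  rewrite val_clamp_id; last first.
    by rewrite (mulr_ge0 (ler0n _ _) (ltW e20)); exact: le_trans n1 xT.
  by rewrite ger0_norm ?subr_ge0// ltrBlDl; apply: lt_trans n2 _; rewrite ltrD2l; lra.
Qed.

Lemma Cev_continuous (w : Cpath) : continuous (Cev w).
Proof. exact: set_mem (svalP w). Qed.

(* Truncated at 1 so that the supremum exists without appealing to compactness. *)
Definition Cdist (w w' : Cpath) : R :=
  sup [set Num.min 1 `|Cev w t - Cev w' t| | t in [set: time]].

Let Cset w w' := [set Num.min 1 `|Cev w t - Cev w' t| | t in [set: time]].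

Let Cset_sup w w' : has_sup (Cset w w').
Proof.
split; first by exists (Num.min 1 `|Cev w (time0 T) - Cev w' (time0 T)|), (time0 T).
by exists 1 => _ [t _ <-]; rewrite ge_min lexx.
Qed.

Lemma Cdist_ub w w' t : Num.min 1 `|Cev w t - Cev w' t| <= Cdist w w'.
Proof. by apply: ub_le_sup; [case: (Cset_sup w w')|exists t]. Qed.

Lemma Cdist_le w w' (e : R) : (forall t, Num.min 1 `|Cev w t - Cev w' t| <= e) ->
  Cdist w w' <= e.
Proof. by move=> h; apply: ge_sup; [case: (Cset_sup w w')|move=> _ [t _ <-]]. Qed.

(** A path that oscillates by less than [a] at scale $T/(n+1)$ is determined up to [3 * a] by the
    integer parts of its grid values divided by [a]. There are countably many such codes, and one
    path is chosen for each code that occurs. *)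
Lemma Cpath_cover (e : R) : 0 < e -> exists c : nat -> Cpath, forall x, exists n,
  Cdist x (c n) < e.
Proof.
(* Three errors of size [a] are added: from t to the node, between the two paths at the node, and
   back; [3 * a] must stay strictly below [e]. *)
move=> e0; pose a := e / 4; have a0 : 0 < a by rewrite divr_gt0.
pose h (n : nat) : R := T%:num / n.+1%:R.
have h0 n : 0 < h n by rewrite divr_gt0.
pose osc n (w : Cpath) := forall s t : time, `|val s - val t| < h n -> `|Cev w s - Cev w t| < a.
(* The nodes have indices 0 to n+1: with mesh $T/(n+1)$ the last one is T itself. *)
pose code n (w : Cpath) := [seq Num.floor (Cev w (clamp_time T (i%:R * h n)) / a) | i <- iota 0 n.+2].
pose c j : Cpath := if unpickle j is Some (n, s) then
   xget point [set w | osc n w /\ code n w = s] else point.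
exists c => w.
have [d d0 wd] := time_unif_continuous (@Cev_continuous w) a0.
pose n := Num.trunc (T%:num / d).
have hd : h n < d.
  by rewrite /h ltr_pdivrMr ?ltr0n// mulrC -ltr_pdivrMr//; exact: truncnS_gt.
have ow : osc n w by move=> s t st; apply: wd; exact: lt_trans hd.
exists (pickle (n, code n w)); rewrite /c pickleK.
have [] : [set w' | osc n w' /\ code n w' = code n w] (xget point [set w' | osc n w' /\ code n w' = code n w]).
  by apply: (@xgetPex _ point); exists w.
move: (xget _ _) => w' ow' cw'.
apply: (@le_lt_trans _ _ (3 * a)); last by rewrite /a; lra.
apply: Cdist_le => t; rewrite ge_min; apply/orP; right.
have /andP[t0 tT] := val_time01 t.
have := truncn_itv (divr_ge0 t0 (ltW (h0 n))); set i := Num.trunc _ => /andP[n1 n2].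
rewrite ler_pdivlMr// in n1; rewrite ltr_pdivrMr// -natr1 mulrDl mul1r in n2.
have i_n : (i < n.+2)%N.
  rewrite ltnS -(ler_nat R) -(ler_pM2r (h0 n)).
  apply: le_trans n1 _; apply: le_trans tT _.
  by rewrite /h mulrCA divff ?mulr1// gt_eqF// ltr0n.
pose ti := clamp_time T (i%:R * h n).
have vti : val ti = i%:R * h n.
  by apply: val_clamp_id; rewrite (mulr_ge0 (ler0n _ _) (ltW (h0 n))); exact: le_trans n1 tT.
have tti : `|val t - val ti| < h n by rewrite vti ger0_norm ?subr_ge0// ltrBlDl.
have H1 := ow _ _ tti; have H2 := ow' _ _ tti.
have E : Num.floor (Cev w' ti / a) = Num.floor (Cev w ti / a).
  have := congr1 (fun s => nth 0 s i) cw'.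
  by rewrite !(nth_map 0%N) ?size_iota// !nth_iota.
have H3 : `|Cev w ti - Cev w' ti| < a.
  have := floor_itv (Cev w ti / a); have := floor_itv (Cev w' ti / a); rewrite E.
  rewrite !ler_pdivlMr// !ltr_pdivrMr// intrD mulrDl mul1r => /andP[? ?] /andP[? ?].
  by rewrite ltr_norml; lra.
move: H1 H2 H3; rewrite !ltr_norml ler_norml => /andP[? ?] /andP[? ?] /andP[? ?].
apply/andP; split; lra.
Qed.

Lemma Cpath_nbhs (w : Cpath) (U : set Cpath) : nbhs w U ->
  exists2 e : R, 0 < e & forall w', Cdist w' w < e -> U w'.
Proof.
move=> nU.
have [V nV VU] := @initial_nbhs _ {uniform time -> R} (set_val : Craw T -> _) w U nU.
have [E [entE EV]] := (uniform_nbhs _ _).1 nV.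
move: entE; rewrite -entourage_ballE => -[e /= e0 eE].
(* Below 1 the truncation in [Cdist] is inactive. *)
exists (Num.min e 1); first by rewrite lt_min e0 ltr01.
move=> w' ww'; apply: VU; apply: EV => t _; apply: eE.
rewrite /ball /= distrC.
have := le_lt_trans (Cdist_ub w' w t) ww'.
rewrite lt_min !gt_min ltxx /= => /andP[/orP[|//] h1 h2].
by apply: lt_le_trans h2 _; exact: ltW.
Qed.

Lemma Cpath_near (w : Cpath) (e : R) : 0 < e -> nbhs w [set w' : Cpath | Cdist w' w < e].
Proof.
move=> e0; have cv := @initial_continuous _ {uniform time -> R} (set_val : Craw T -> _) w.
(* A supremum of values below [e / 2] is only known to be at most [e / 2], which is still strictly
   below [e]. *)
have e20 : 0 < e / 2 by rewrite divr_gt0.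
have : nbhs (set_val (w : Craw T) : {uniform time -> R})
    [set h | forall t, setT t -> `|set_val (w : Craw T) t - h t| < e / 2].
  apply/uniform_nbhs; exists [set xy | `|xy.1 - xy.2| < e / 2]; split => //.
  by rewrite -entourage_ballE; exists (e / 2).
move=> /cv nU; have {}nU : nbhs w [set w' : Cpath | forall t, setT t -> `|set_val (w : Craw T) t - set_val (w' : Craw T) t| < e / 2] by exact: nU.
apply: filterS nU => w' /= ww'.
apply: (@le_lt_trans _ _ (e / 2)); last lra.
apply: Cdist_le => t; rewrite ge_min; apply/orP; right.
by rewrite distrC; apply: ltW; exact: ww'.
Qed.

Lemma Cpath_cozero_base : cozero_base R Cpath.
Proof.
apply: (@metric_cozero_base R (Craw T) Cdist).
- move=> x y; apply: le_trans (Cdist_ub x y (time0 T)).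
  by rewrite le_min ler01 normr_ge0.
- move=> x y; congr sup; apply/seteqP; split => _ [t _ <-]; exists t => //;
    by rewrite distrC.
- move=> x y z; apply: Cdist_le => t.
  apply: (@le_trans _ _ (Num.min 1 `|Cev x t - Cev y t| + Num.min 1 `|Cev y t - Cev z t|)).
    have : `|Cev x t - Cev z t| <= `|Cev x t - Cev y t| + `|Cev y t - Cev z t|.
      by rewrite -(subrKA (Cev y t)) ler_normD.
    have := normr_ge0 (Cev x t - Cev y t); have := normr_ge0 (Cev y t - Cev z t).
    move: `|_| `|_| `|_| => p q r ? ? ?.
    by case: (leP 1 p); case: (leP 1 q); case: (leP 1 r); lra.
  by apply: lerD; exact: Cdist_ub.
- exact: Cpath_near.
- exact: Cpath_nbhs.
- exact: Cpath_cover.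
Qed.

Lemma Cev_eval_continuous (t : time) : continuous (fun w : Cpath => Cev w t).
Proof.
move=> w V [e /= e0 eV].
have m0 : 0 < Num.min e 1 by rewrite lt_min e0 ltr01.
have nw := Cpath_near w m0.
suff : nbhs w [set w' : Cpath | V (Cev w' t)] by [].
apply: filterS nw => w' /= ww'; apply: eV => /=.
have := le_lt_trans (Cdist_ub w' w t) ww'.
rewrite lt_min !gt_min ltxx /= distrC => /andP[/orP[|//] h1 h2].
exact: lt_trans h2 h1.
Qed.
End path_space.

(** * A cozero base for the weak topology *)

Section weak_topology_base.
Context {R : realType} {d} {X : topMeasType d}.
Variable h : nat -> X -> R.
Hypothesis ch : forall i, continuous (h i).
Hypothesis h01 : forall i x, 0 <= h i x <= 1.
Hypothesis hb : forall x (U : set X), nbhs x U ->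
  exists i, 0 < h i x /\ (forall y, 0 < h i y -> U y).
Hypothesis gX : cozero_base R X.

(** A rational height times a continuous approximation, of slope m, of the indicator of $\{h_i>0\}$.
    The family is countable, and its finite maxima approximate every nonnegative continuous function
    from below. *)
Definition bump (a : nat * nat * nat * nat) (x : X) : R :=
  let: (i, m, q, r) := a in q%:R / r.+1%:R * Num.min 1 (m%:R * h i x).

Fixpoint bumps (l : seq (nat * nat * nat * nat)) (x : X) : R :=
  if l is a :: l' then Num.max (bump a x) (bumps l' x) else 0.

Lemma bumps_ge0 l x : 0 <= bumps l x.
Proof. by elim: l => //= a l IH; rewrite le_max IH orbT. Qed.

Lemma bumps_BC l : continuous (bumps l) /\ exists M : R, forall x, `|bumps l x| <= M.
Proof.
split.
  elim: l => [|a l IH]; first exact: continuous_cstr.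
  apply: continuous_maxr => //; case: a => [[[i m] q] r] /=.
  apply: continuousMr; first exact: continuous_cstr.
  apply: continuous_minr; first exact: continuous_cstr.
  by apply: continuousMr; [exact: continuous_cstr|exact: ch].
suff [M hM] : exists M : R, forall x, bumps l x <= M.
  by exists M => x; rewrite ger0_norm ?bumps_ge0.
elim: l => [|a l [M IH]]; first by exists 0.
case: a => [[[i m] q] r]; exists (Num.max (q%:R / r.+1%:R) M) => x /=.
rewrite ge_max !le_max IH orbT andbT ler_piMr ?divr_ge0//.
by rewrite ge_min lexx.
Qed.

Definition bumpsBC l : BC X R := exist _ (bumps l) (bumps_BC l).

(** Take a rational c strictly between $f(x)-e$ and $f(x)$, a base set $\{h_i>0\}$ around x inside
    $\{f>c\}$, and a slope larger than $1/h_i(x)$, so that the bump attains its height c at x. *)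
Lemma bump_below (f : X -> R) (x : X) (e : R) : continuous f -> (forall y, 0 <= f y) ->
  0 < e -> exists a, (forall y, bump a y <= f y) /\ f x - e < bump a x.
Proof.
move=> cf f0 e0.
case: (ltP (f x - e) 0) => [fx|fx].
  exists (0%N, 0%N, 0%N, 0%N); split => [y|] /=; rewrite !mul0r//.
have [c] := rat_in_itvoo (ltr_pwDr e0 (lexx (f x - e))).
rewrite in_itv /= subrK => /andP[c1 c2].
have c0 : 0 <= c by rewrite -(ler0q R); exact: le_trans (ltW c1).
have [n dE] : exists n : nat, denq c = n.+1%:Z.
  by have := denq_gt0 c; case: (denq c) => [[|n]|n]// _; exists n.
have [q nE] : exists q : nat, numq c = q%:Z.
  have nc : 0 <= numq c by rewrite numq_ge0.
  by move: nc; case: (numq c) => // q _; exists q.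
have cE : ratr c = q%:R / n.+1%:R :> R by rewrite /ratr dE nE.
have nU : nbhs x [set y | ratr c < f y].
  exact: (cvgr_gt (f x) (cf x)).
have [i [hi hiU]] := hb nU.
exists (i, (Num.trunc (h i x)^-1).+1, q, n); split => [y|] /=; rewrite -cE.
  case: (ltP 0 (h i y)) => [/hiU /= cy|hy].
    apply: le_trans (ltW cy); rewrite ler_piMr ?ler0q// ge_min lexx//.
  have -> : h i y = 0 by apply/eqP; rewrite eq_le hy; case/andP: (h01 i y).
  by rewrite mulr0 (min_idPr ler01) mulr0.
rewrite (min_idPl _) ?mulr1//.
by rewrite -ler_pdivrMr// div1r; apply: ltW; exact: truncnS_gt.
Qed.

(** All minorants of [f] among the first n codes; their maxima increase to [f] pointwise. *)
Definition bumps_upto (f : X -> R) n :=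
  pmap (fun j => if unpickle j is Some a then
     if `[< forall y, bump a y <= f y >] then Some a else None else None) (iota 0 n).

Lemma le_bumps a l x : a \in l -> bump a x <= bumps l x.
Proof.
elim: l => //= b l IH; rewrite inE => /predU1P[->|/IH]; rewrite le_max ?lexx// => ->.
by rewrite orbT.
Qed.

Lemma bumps_le (f : X -> R) l x : 0 <= f x -> (forall a, a \in l -> bump a x <= f x) ->
  bumps l x <= f x.
Proof.
move=> f0; elim: l => //= a l IH H; rewrite ge_max H ?mem_head// IH// => b bl.
by rewrite H// inE bl orbT.
Qed.

Lemma bumps_upto_le (f : X -> R) n x : (forall y, 0 <= f y) -> bumps (bumps_upto f n) x <= f x.
Proof.
move=> f0; apply: bumps_le => // a; rewrite mem_pmap => /mapP[j _].
by case: unpickle => // b; case: ifPn => // /asboolP H [->].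
Qed.

Lemma bumps_upto_cvg (f : X -> R) x : continuous f -> (forall y, 0 <= f y) ->
  (fun n => bumps (bumps_upto f n) x) @ \oo --> f x.
Proof.
move=> cf f0; apply/cvgrPdist_lt => e e0.
have [a [af ax]] := bump_below x cf f0 e0.
exists (pickle a).+1 => // n /= an.
rewrite ger0_norm ?subr_ge0 ?bumps_upto_le//.
have : bump a x <= bumps (bumps_upto f n) x.
  apply: le_bumps; rewrite mem_pmap; apply/mapP; exists (pickle a).
    by rewrite mem_iota.
  by rewrite pickleK; case: asboolP.
lra.
Qed.

(** By dominated convergence along [bumps_upto]. Hence the set of laws with $E f>r$ is a union of
    sets of the same kind taken from a countable family, which gives the weak topology a countable
    base. *)
Lemma Ex_lower (P : probability X R) (f : BC X R) (r : R) : (forall y, 0 <= sval f y) ->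
  r < Ex P (sval f) ->
  exists l, (forall y, bumps l y <= sval f y) /\ r < Ex P (bumps l).
Proof.
move=> f0 rf; have [cf [M fM]] := svalP f.
have c : Ex P (bumps (bumps_upto (sval f) n)) @[n --> \oo] --> Ex P (sval f).
  apply: (@Ex_cvg _ _ _ P _ _ M).
  - by move=> n; apply: bmeas_meas; exact: (BC_bmeas (bumpsBC _) gX).
  - move=> n x; rewrite ger0_norm ?bumps_ge0//; apply: le_trans (bumps_upto_le _ _ f0) _.
    by apply: le_trans (fM x); exact: ler_norm.
  - by move=> x; exact: bumps_upto_cvg.
have e0 : 0 < Ex P (sval f) - r by rewrite subr_gt0.
have /cvgrPdist_lt/(_ _ e0) [N _ /(_ N (leqnn N)) /=] := c.
rewrite ltr_norml => /andP[_ h1].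
exists (bumps_upto (sval f) N); split; first by move=> y; exact: bumps_upto_le.
lra.
Qed.

Fixpoint lower_meets (s : seq (seq (nat * nat * nat * nat) * rat)) (Q : PM X R) : R :=
  if s is (l, a) :: s' then
    Num.min (Num.max 0 (Ex (PMof Q) (bumps l) - ratr a)) (lower_meets s' Q)
  else 1.

Lemma lower_meets_continuous s : continuous (lower_meets s).
Proof.
elim: s => [|[l a] s IH] /=; first exact: continuous_cstr.
apply: (@continuous_minr R (PM X R)) => //.
apply: (@continuous_maxr R (PM X R)); first exact: continuous_cstr.
apply: (@continuousBr R (PM X R)); last exact: continuous_cstr.
exact: (@PM_cont _ _ _ (bumpsBC l)).
Qed.

Lemma lower_meets01 s Q : 0 <= lower_meets s Q <= 1.
Proof.
elim: s => [|[l a] s /andP[IH1 IH2]] /=; first by rewrite ler01 lexx.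
by rewrite le_min le_max lexx IH1 ge_min IH2 orbT.
Qed.

Lemma lower_meets_gt0 s Q :
  0 < lower_meets s Q <-> forall p, p \in s -> ratr p.2 < Ex (PMof Q) (bumps p.1).
Proof.
elim: s => [|[l a] s IH] /=; first by split => // _; rewrite ltr01.
rewrite lt_min lt_max ltxx subr_gt0 /=; split.
  by move=> /andP[h1 /IH h2] p; rewrite inE => /predU1P[->//|]; exact: h2.
move=> H; apply/andP; split; first exact: (H (l, a) (mem_head _ _)).
by apply/IH => p ps; apply: H; rewrite inE ps orbT.
Qed.

(** Lower bounds on expectations of nonnegative functions suffice: applied to $f+M$ and $M-f$ they
    bound $E f$ from both sides. Finitely many strict lower bounds are encoded by positivity of the
    continuous function [lower_meets]. *)
Lemma PM_cozero_base0 : cozero_base R (PM X R).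
Proof.
pose H j (Q : PM X R) := if unpickle j is Some s then lower_meets s Q else 0.
apply: (@borel_cozero_base R (PMtop X R) H).
- move=> j; rewrite /H; case: unpickle => [s|]; last exact: continuous_cstr.
  exact: lower_meets_continuous.
- move=> j Q; rewrite /H; case: unpickle => [s|]; last by rewrite lexx ler01.
  exact: lower_meets01.
move=> P U nU.
pose F : set_system (PM X R) := [set V | exists s, 0 < lower_meets s P /\
   forall Q, 0 < lower_meets s Q -> V Q].
have FF : Filter F.
  split.
  - by exists [::]; split => //=; rewrite ltr01.
  - move=> A B [s [Ps sA]] [s' [Ps' sB]]; exists (s ++ s'); split.
      apply/lower_meets_gt0 => p; rewrite mem_cat => /orP[] ps.
        by move/lower_meets_gt0: Ps; exact.
      by move/lower_meets_gt0: Ps'; exact.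
    move=> Q /lower_meets_gt0 HQ; split.
      by apply: sA; apply/lower_meets_gt0 => p ps; apply: HQ; rewrite mem_cat ps.
    by apply: sB; apply/lower_meets_gt0 => p ps; apply: HQ; rewrite mem_cat ps orbT.
  - by move=> A B AB [s [Ps sA]]; exists s; split => // Q /sA/AB.
suff : F --> P.
  by move=> /(_ U nU) [s [Ps sU]]; exists (pickle s); rewrite /H pickleK.
apply: PM_cvgP => f; apply/cvgrPdist_lt => e e0.
have [cf [M fM]] := svalP f; have bf := BC_bmeas f gX.
have lower (f1 : BC X R) : (forall y, 0 <= sval f1 y) ->
    F [set Q : PM X R | Ex (PMof P) (sval f1) - e < Ex (PMof Q) (sval f1)].
  move=> f10.
  have h1 : Ex (PMof P) (sval f1) - e < Ex (PMof P) (sval f1) by lra.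
  have [l [lf]] := Ex_lower f10 h1.
  move=> /rat_in_itvoo [a]; rewrite in_itv /= => /andP[a1 a2].
  exists [:: (l, a)]; split.
    by apply/lower_meets_gt0 => p; rewrite inE => /eqP ->.
  move=> Q /lower_meets_gt0 /(_ (l, a) (mem_head _ _)) /= aQ.
  apply: lt_trans a1 _; apply: lt_le_trans aQ _; apply: Ex_le => //.
    exact: (BC_bmeas (bumpsBC l) gX).
  exact: BC_bmeas.
have f1P : continuous (fun x => sval f x + M) /\ exists N : R, forall x, `|sval f x + M| <= N.
  split; first by apply: continuousDr => //; exact: continuous_cstr.
  exists (M + `|M|) => x; apply: le_trans (ler_normD _ _) _; exact: lerD.
have f2P : continuous (fun x => M - sval f x) /\ exists N : R, forall x, `|M - sval f x| <= N.
  split; first by apply: continuousBr => //; exact: continuous_cstr.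
  by exists (`|M| + M) => x; apply: le_trans (ler_normB _ _) _; exact: lerD.
have H1 := lower (exist _ _ f1P).
have H2 := lower (exist _ _ f2P).
have {}H1 := H1 _; have {}H2 := H2 _.
have H12 : F ([set Q : PM X R | Ex (PMof P) (fun x => sval f x + M) - e < Ex (PMof Q) (fun x => sval f x + M)] `&` 
   [set Q : PM X R | Ex (PMof P) (fun x => M - sval f x) - e < Ex (PMof Q) (fun x => M - sval f x)]).
  apply: filterI; [apply: H1 => y /=|apply: H2 => y /=]; have := fM y; rewrite ler_norml => /andP[? ?]; lra.
apply: filterS H12 => Q [] /=.
have E1 (Q' : probability X R) : Ex Q' (fun x => sval f x + M) = Ex Q' (sval f) + M.
  by rewrite ExD ?Ex_cst//; exact: bmeas_cst.
have E2 (Q' : probability X R) : Ex Q' (fun x => M - sval f x) = M - Ex Q' (sval f).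
  by rewrite ExB ?Ex_cst//; exact: bmeas_cst.
rewrite !E1 !E2.
by rewrite ltr_distl; move=> ? ?; apply/andP; split; lra.
Qed.
End weak_topology_base.

Lemma PM_cozero_base (R : realType) d (X : topMeasType d) : cozero_base R X ->
  cozero_base R (PM X R).
Proof.
move=> gX; have [h [ch h01 hb _]] := gX.
exact: (PM_cozero_base0 (fun i => (ch i).1) h01 hb gX).
Qed.

Lemma average_le (R : realType) (m : nat) (F : 'I_m -> R) (c : R) : (0 < m)%N ->
  (forall k, F k <= c) -> m%:R^-1 * \sum_(k < m) F k <= c.
Proof.
move=> m0 Fc; rewrite ler_pdivrMl ?ltr0n// mulr_natl.
have -> : c *+ m = \sum_(k < m) c by rewrite sumr_const card_ord.
exact: ler_sum.
Qed.

(** * Approximation by continuous functions measurable for a sub-sigma-algebra *)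

Section continuous_approximation.
Context {R : realType} {d} {X : topMeasType d}.
Variables (nu : probability X R) (G : set (set X)).
Hypothesis sG : sigma_algebra setT G.
Hypothesis mG : forall S, G S -> measurable S.

Definition cadapted (f : X -> R) := [/\ continuous f, Gmeas G f & forall x, 0 <= f x <= 1].

Definition cozeros : set (set X) := [set S | exists F : X -> R,
  [/\ continuous F, Gmeas G F & S = [set x | 0 < F x]]].

Definition capprox (S : set X) := forall e : R, 0 < e ->
  exists2 f, cadapted f & Ex nu (fun x => `|f x - \1_S x|) < e.

Lemma cadapted_bmeas f : cadapted f -> bmeas f.
Proof. by move=> [cf Gf f01]; apply: bmeas01 => //; exact: Gmeas_meas Gf. Qed.

Lemma cadapted_cst (c : R) : 0 <= c <= 1 -> cadapted (fun=> c).
Proof. by move=> c01; split => //; [exact: continuous_cstr|exact: Gmeas_cst]. Qed.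

Lemma cadapted_max f g : cadapted f -> cadapted g -> cadapted (fun x => Num.max (f x) (g x)).
Proof.
move=> [cf Gf f01] [cg Gg g01]; split; [exact: continuous_maxr|exact: Gmeas_max|].
move=> x; move: (f01 x) (g01 x) => /andP[a b] /andP[a' b'].
by rewrite le_max a ge_max b b'.
Qed.

Lemma cadapted_compl f : cadapted f -> cadapted (fun x => 1 - f x).
Proof.
move=> [cf Gf f01]; split.
- by apply: continuousBr => //; exact: continuous_cstr.
- by apply: GmeasB => //; exact: Gmeas_cst.
- by move=> x; have /andP[? ?] := f01 x; apply/andP; split; lra.
Qed.

Let bdist (f : X -> R) S : bmeas f -> G S -> bmeas (fun x => `|f x - \1_S x|).
Proof. by move=> bf /mG mS; apply: bmeas_norm; apply: bmeasB => //; exact: bmeas_indic. Qed.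

Lemma capproxU A B : G A -> G B -> capprox A -> capprox B -> capprox (A `|` B).
Proof.
move=> GA GB aA aB e e0; have e20 : 0 < e / 2 by rewrite divr_gt0.
have [f cf fA] := aA _ e20; have [g cg gB] := aB _ e20.
exists (fun x => Num.max (f x) (g x)); first exact: cadapted_max.
have GAB : G (A `|` B).
  by rewrite -(g_sigma_measurableE sG); apply: measurableU; rewrite g_sigma_measurableE.
have bf := cadapted_bmeas cf; have bg := cadapted_bmeas cg.
apply: (@le_lt_trans _ _ (Ex nu (fun x => `|f x - \1_A x| + `|g x - \1_B x|))); last first.
  by rewrite ExD; [lra|exact: bdist|exact: bdist].
apply: Ex_le => [||x]; [by apply: bdist => //; exact: bmeas_max|by apply: bmeasD; exact: bdist|].
have [_ _ /(_ x) /andP[f0 f1]] := cf; have [_ _ /(_ x) /andP[g0 g1]] := cg.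
rewrite !indicE in_setU; move: (f x) (g x) f0 f1 g0 g1 => a b a0 a1 b0 b1.
case: (x \in A); case: (x \in B) => /=; rewrite ?subr0; case: (leP a b) => ab;
  rewrite ?(ger0_norm a0) ?(ger0_norm b0) ?ler0_norm ?subr_le0//; lra.
Qed.

(** The approximable sets of [G] form a sigma-algebra: complements through $1-f$, finite unions
    through maxima, and countable unions because their finite parts converge in mean. *)
Lemma capprox_sigma : cozeros `<=` capprox -> <<s cozeros >> `<=` (G `&` capprox).
Proof.
move=> Cap; apply: smallest_sub; last first.
  move=> S CS; split; last exact: Cap.
  case: CS => F [_ GF ->].
  rewrite (_ : [set x | _] = F @^-1` `]0, +oo[%classic); first exact: GF.
  by apply/seteqP; split => x /=; rewrite in_itv /= andbT.
have [G0 GC GU] := sG.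
split.
- split => // e e0; exists (fun=> 0); first by apply: cadapted_cst; rewrite lexx ler01.
  rewrite [X in Ex nu X](_ : _ = fun=> 0) ?Ex_cst//.
  by apply: funext => x; rewrite indic0 subrr normr0.
- move=> A [GA aA]; split; first exact: GC.
  move=> e /aA [f cf fA]; exists (fun x => 1 - f x); first exact: cadapted_compl.
  rewrite [X in Ex nu X](_ : _ = fun x => `|f x - \1_A x|)//.
  apply: funext => x; rewrite setTD indicE in_setC indicE.
  by case: (x \in A) => /=; rewrite ?subr0 // -normrN; congr `|_|; ring.
- move=> F GaF; have GF i : G (F i) by case: (GaF i).
  have GV n : G (\bigcup_(i < n) F i).
    rewrite -(g_sigma_measurableE sG); apply: bigcup_measurable => i _.
    by rewrite g_sigma_measurableE.
  have GW : G (\bigcup_i F i) by exact: GU.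
  split => // e e0; have e20 : 0 < e / 2 by rewrite divr_gt0.
  have aV n : capprox (\bigcup_(i < n) F i).
    elim: n => [|n IH].
      move=> e' e'0; exists (fun=> 0); first by apply: cadapted_cst; rewrite lexx ler01.
      rewrite [X in Ex nu X](_ : _ = fun=> 0) ?Ex_cst//.
      apply: funext => x; rewrite (_ : \bigcup_(i < 0) F i = set0) ?indic0 ?subrr ?normr0//.
      by rewrite -subset0 => y [].
    rewrite (_ : \bigcup_(i < n.+1) F i = (\bigcup_(i < n) F i) `|` F n).
      by apply: capproxU => //; case: (GaF n).
    by rewrite bigcup_mkord big_ord_recr /= bigcup_mkord.
  have cW : Ex nu (fun x => `|\1_(\bigcup_(i < n) F i) x - \1_(\bigcup_i F i) x|) @[n --> \oo] --> Ex nu (fun=> 0).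
    apply: (@Ex_cvg _ _ _ nu _ _ 2).
    - by move=> n; apply: bmeas_meas; apply: bdist => //; apply: bmeas_indic; exact: mG.
    - move=> n x; rewrite normr_id !indicE.
      by case: (_ \in _); case: (_ \in _); rewrite ?subrr ?sub0r ?subr0 ?normrN ?normr1 ?normr0; lra.
    - move=> x; apply/cvgrPdist_lt => e' e'0.
      case: (pselect ((\bigcup_i F i) x)) => [[i _ Fi]|nF].
        exists i.+1 => // n /= ni; rewrite !indicE !mem_set ?subrr ?normr0 ?subr0 ?normr0//.
        + by exists i.
        + by exists i.
      exists 0%N => // n _; rewrite !indicE !memNset ?subrr ?normr0 ?subr0 ?normr0//.
      by move=> [i _ Fi]; apply: nF; exists i.
  move/cvgrPdist_lt : cW => /(_ _ e20) [N _ /(_ N (leqnn N)) /=].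
  rewrite Ex_cst sub0r normrN ger0_norm; last by apply: Ex_ge0.
  move=> hN; have [f cf fV] := aV N _ e20; exists f => //.
  have bf := cadapted_bmeas cf.
  have b1 : bmeas (\1_(\bigcup_(i < N) F i) : X -> R) by apply: bmeas_indic; exact: mG.
  apply: (@le_lt_trans _ _ (Ex nu (fun x => `|f x - \1_(\bigcup_(i < N) F i) x|
      + `|\1_(\bigcup_(i < N) F i) x - \1_(\bigcup_i F i) x|))).
    apply: Ex_le; [exact: bdist|by apply: bmeasD; exact: bdist|].
    by move=> x; rewrite -(subrKA (\1_(\bigcup_(i < N) F i) x)) ler_normD.
  by rewrite ExD; [lra|exact: bdist|exact: bdist].
Qed.

Lemma cozeros_limit (S : set X) : cozeros S ->
  exists2 f : nat -> X -> R, forall n, cadapted (f n) & forall x, f n x @[n --> \oo] --> (\1_S x : R).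
Proof.
move=> [F [cF GF ->]]; pose f n x := Num.min 1 (n%:R * Num.max 0 (F x)).
exists f.
  move=> n; split.
  - apply: continuous_minr; first exact: continuous_cstr.
    apply: continuousMr; first exact: continuous_cstr.
    by apply: continuous_maxr => //; exact: continuous_cstr.
  - apply: Gmeas_min => //; first exact: Gmeas_cst.
    apply: GmeasM => //; first exact: Gmeas_cst.
    by apply: Gmeas_max => //; exact: Gmeas_cst.
  - by move=> x; rewrite /f le_min ler01 mulr_ge0 ?le_max ?lexx//= ge_min lexx.
move=> x; apply/cvgrPdist_lt => e e0.
case: (ltP 0 (F x)) => Fx.
  exists (Num.trunc (F x)^-1).+1 => // n /= nx.
  rewrite indicE mem_set// /f (max_idPr (ltW Fx)) (min_idPl _) ?subrr ?normr0//.
  rewrite -ler_pdivrMr// div1r; apply: ltW; apply: lt_le_trans (truncnS_gt _) _.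
  by rewrite ler_nat.
exists 0%N => // n _; rewrite indicE memNset; last by rewrite /= ltNge Fx.
by rewrite /f (max_idPl Fx) mulr0 (min_idPr ler01) subr0 normr0.
Qed.

Lemma cozeros_capprox : cozeros `<=` capprox.
Proof.
move=> S cS e e0; have [f cf fS] := cozeros_limit cS.
have GS : G S.
  case: cS => F [_ GF ->]; rewrite (_ : [set x | _] = F @^-1` `]0, +oo[%classic); first exact: GF.
  by apply/seteqP; split => x /=; rewrite in_itv /= andbT.
have : Ex nu (fun x => `|f n x - \1_S x|) @[n --> \oo] --> Ex nu (fun=> 0).
  apply: (@Ex_cvg _ _ _ nu _ _ 1).
  - by move=> n; apply: bmeas_meas; apply: bdist => //; exact: cadapted_bmeas.
  - move=> n x; rewrite normr_id indicE; have [_ _ /(_ x) /andP[a b]] := cf n.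
    by rewrite ler_norml; case: (_ \in _) => /=; apply/andP; split; lra.
  - move=> x; apply/cvgrPdist_lt => e' e'0.
    move/cvgrPdist_lt : (fS x) => /(_ _ e'0) [N _ HN]; exists N => // n /HN.
    by rewrite sub0r normrN normr_id distrC.
move/cvgrPdist_lt => /(_ _ e0) [N _ /(_ N (leqnn N)) /=].
rewrite Ex_cst sub0r normrN ger0_norm; last by apply: Ex_ge0.
by exists (f N).
Qed.

(** An average of indicators of level sets is uniformly within $1/m<e/2$ of [p]. Each level set is
    then replaced by a continuous function within $e/2$ in mean, and averaging keeps the values in
    $[0,1]$. *)
Lemma capprox_fun (p : X -> R) (e : R) : G `<=` <<s cozeros >> -> Gmeas G p ->
  (forall x, 0 <= p x <= 1) -> 0 < e ->
  exists2 q, cadapted q & Ex nu (fun x => `|q x - p x|) < e.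
Proof.
move=> Gc Gp p01 e0; have e20 : 0 < e / 2 by rewrite divr_gt0.
pose m := (Num.trunc (2 / e)).+1.
have m0 : 0 < m%:R :> R by rewrite ltr0n.
have me : m%:R^-1 < e / 2.
  rewrite -[e / 2]invrK invf_div ltf_pV2 ?posrE ?divr_gt0 ?ltr0n//.
  exact: truncnS_gt.
pose S (k : 'I_m) := [set x | k.+1%:R / m%:R <= p x].
have GS k : G (S k) by exact: Gmeas_ge.
have ap k : exists f, cadapted f /\ Ex nu (fun x => `|f x - \1_(S k) x|) < e / 2.
  have [_ h] := capprox_sigma cozeros_capprox (Gc _ (GS k)).
  by have [f cf hf] := h _ e20; exists f.
pose f k := sval (cid (ap k)).
have fP k : cadapted (f k) /\ Ex nu (fun x => `|f k x - \1_(S k) x|) < e / 2.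
  by rewrite /f; case: cid.
pose q x := m%:R^-1 * \sum_(k < m) f k x.
have i0 : 0 < m%:R^-1 :> R by rewrite invr_gt0.
have cq : cadapted q.
  split.
  - apply: continuousMr; first exact: continuous_cstr.
    by apply: continuous_sumr => k; case: (fP k) => -[].
  - apply: GmeasM => //; first exact: Gmeas_cst.
    by apply: Gmeas_sum => // k; case: (fP k) => -[].
  - move=> x; rewrite /q mulr_ge0 ?(ltW i0)//=; last first.
      by apply: sumr_ge0 => k _; have [[_ _ /(_ x) /andP[]]] := fP k.
    by apply: average_le => // k; have [[_ _ /(_ x) /andP[]]] := fP k.
exists q => //.
have bp : bmeas p by apply: bmeas01 => //; exact: Gmeas_meas Gp.
have bk k : bmeas (fun x => `|f k x - \1_(S k) x|).
  by apply: bdist => //; apply: cadapted_bmeas; case: (fP k).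
apply: (@le_lt_trans _ _ (Ex nu (fun x => m%:R^-1 * \sum_(k < m) `|f k x - \1_(S k) x| + m%:R^-1))).
  apply: Ex_le.
  - by apply: bmeas_norm; apply: bmeasB => //; exact: cadapted_bmeas.
  - by apply: bmeasD; [apply: bmeasZ; exact: bmeas_sum|exact: bmeas_cst].
  move=> x; rewrite -(subrKA (m%:R^-1 * \sum_(k < m) \1_(S k) x)).
  apply: le_trans (ler_normD _ _) _; apply: lerD.
    rewrite /q -mulrBr normrM (ger0_norm (ltW i0)) ler_wpM2l ?(ltW i0)//.
    by rewrite -sumrB; exact: ler_norm_sum.
  rewrite distrC; have -> : \sum_(k < m) \1_(S k) x = \sum_(k < m) (k.+1%:R / m%:R <= p x)%R%:R :> R.
    by apply: eq_bigr => k _; rewrite indicE /S mem_setE.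
  exact: layer_approx.
rewrite ExD ?ExZ ?Ex_cst ?Ex_sum//; [|exact: bmeas_sum|by apply: bmeasZ; exact: bmeas_sum|exact: bmeas_cst].
apply: (@le_lt_trans _ _ (e / 2 + m%:R^-1)); last lra.
rewrite lerD2r; apply: average_le => // k; apply: ltW; exact: (fP k).2.
Qed.
End continuous_approximation.

Lemma measurable_cozeros {R : realType} {d} {X : topMeasType d} : cozero_base R X ->
  @measurable _ X `<=` <<s @cozeros R _ X measurable >>.
Proof.
move=> [h [ch h01 _ hs]]; apply: subset_trans hs _.
apply: sub_sigma_algebra2 => S [i ->]; exists (h i); split => //; first exact: (ch i).1.
by move=> U mU; rewrite -[X in measurable X]setTI; exact: (ch i).2.
Qed.

(** * The canonical filtration *)

Lemma pi_lambda (T : Type) (C H : set (set T)) : setI_closed C -> dynkin H -> C `<=` H ->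
  <<s C >> `<=` H.
Proof.
move=> CI dH CH; apply: lambda_system_subset => //.
by apply/dynkin_lambda_system.
Qed.

Section generated_filtration.
Context {R : realType} {d} {X : topMeasType d}.
Variable G : set (set X).
Hypothesis sG : sigma_algebra setT G.

Lemma cozerosI : setI_closed (@cozeros R _ X G).
Proof.
move=> _ _ [f [cf Gf ->]] [g [cg Gg ->]]; exists (fun x => Num.min (f x) (g x)); split.
- exact: continuous_minr.
- exact: Gmeas_min.
- by apply/seteqP; split => x /=; [move=> [a b]; rewrite lt_min a b|rewrite lt_min => /andP].
Qed.

Lemma cozeros_sub : <<s @cozeros R _ X G >> `<=` G.
Proof.
apply: smallest_sub => // _ [f [_ Gf ->]].
rewrite (_ : [set x | _] = f @^-1` `]0, +oo[%classic); first exact: Gf.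
by apply/seteqP; split => x /=; rewrite in_itv /= andbT.
Qed.

Lemma Gmeas_cozeros (f : X -> R) : continuous f -> Gmeas G f ->
  Gmeas <<s @cozeros R _ X G >> f.
Proof.
move=> cf Gf U mU; have : <<s @RGenOInfty.G R >> U.
  suff : (@RGenOInfty.G R).-sigma.-measurable U by [].
  by rewrite -RGenOInfty.measurableE.
apply: (sigma_preimage_sub (sigma_algebra_smallest _)) => _ [r ->].
apply: sub_sigma_algebra; exists (fun x => f x - r); split.
- by apply: continuousBr => //; exact: continuous_cstr.
- by apply: GmeasB => //; exact: Gmeas_cst.
- by apply/seteqP; split => x /=; rewrite in_itv /= andbT subr_gt0.
Qed.
End generated_filtration.

Section measure_evaluation.
Context {R : realType} {d d'} {X : topMeasType d} {Z : topMeasType d'}.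
Variables (m : Z -> probability X R) (H : set (set X)) (K : set (set Z)).
Hypothesis sH : sigma_algebra setT H.
Hypothesis mH : forall S, H S -> measurable S.
Hypothesis sK : sigma_algebra setT K.
Hypothesis Hc : H `<=` <<s @cozeros R _ X H >>.
Hypothesis mK : forall f : X -> R, cadapted H f -> Gmeas K (fun z => Ex (m z) f).

(** The indicator of a cozero set is a limit of continuous [H]-measurable functions, whose integrals
    are [K]-measurable by hypothesis; the cozero sets form a pi-system that generates [H]. Any [K]
    is allowed, so that [K] can itself be generated by continuous functions. *)
Lemma Gmeas_eval (C : set X) : H C -> Gmeas K (fun z => fine (m z C)).
Proof.
have fE (S : set X) : H S -> (fun z => fine (m z S)) = (fun z => Ex (m z) (\1_S)).
  by move=> HS; apply: funext => z; rewrite Ex_indic//; exact: mH.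
move=> /Hc; have : <<s @cozeros R _ X H >> `<=` [set C | H C /\ Gmeas K (fun z => fine (m z C))].
  apply: pi_lambda; first exact: cozerosI.
  - split.
    + split; first exact: sigma_algebraT.
      rewrite fE; last exact: sigma_algebraT.
      rewrite (_ : (fun z => _) = fun=> 1); first exact: Gmeas_cst.
      by apply: funext => z; rewrite -[RHS](Ex_cst (m z)); congr Ex; apply: funext => x; rewrite indicT.
    + move=> S [HS KS]; have HC : H (~` S) by case: sH => _ /(_ S HS); rewrite setTD.
      split => //.
      rewrite (_ : (fun z => _) = fun z => 1 - fine (m z S)).
        by apply: GmeasB => //; exact: Gmeas_cst.
      apply: funext => z; rewrite probability_setC; last exact: mH.
      by rewrite fineB// fin_num_measure//; exact: mH.
    + move=> F tF HF; have HFi i : H (F i) by case: (HF i).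
      have HU : H (\bigcup_i F i) by case: sH => _ _; apply.
      split => //.
      apply: (@Gmeas_cvg _ _ _ K sK (fun n z => \sum_(0 <= i < n) fine (m z (F i)))).
        by move=> n; apply: Gmeas_sum => // i; case: (HF i).
      move=> z.
      have c : (EFin \o (fun n => \sum_(0 <= i < n) fine (m z (F i)))) n @[n --> \oo] -->
          (fine (m z (\bigcup_i F i)))%:E.
        rewrite fineP; last exact: mH.
        have := @measure_semi_sigma_additive _ _ _ (m z) F (fun i => mH (HFi i)) tF (mH HU).
        apply: cvg_trans; apply: near_eq_cvg; apply: nearW => n /=.
        by rewrite -sumEFin; apply: eq_bigr => i _; rewrite fineP//; exact: mH.
      by have /fine_cvgP[_] := c.
  - move=> S CS; have HS : H S by apply: (@cozeros_sub R _ _ H sH); apply: sub_sigma_algebra.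
    split => //; rewrite fE//.
    have [f cf fS] := cozeros_limit sH CS.
    apply: (@Gmeas_cvg _ _ _ K sK (fun n z => Ex (m z) (f n))); first by move=> n; exact: mK.
    move=> z; apply: (@Ex_cvg _ _ _ (m z) _ _ 1) => //.
    + by move=> n; apply: bmeas_meas; exact: (cadapted_bmeas mH).
    + by move=> n x; have [_ _ /(_ x) /andP[a b]] := cf n; rewrite ger0_norm.
by move=> sub /sub [].
Qed.
End measure_evaluation.

Lemma fst_tm_continuous d1 d2 (X : topMeasType d1) (Y : topMeasType d2) :
  continuous (fst : TopMeasurable.sort ((X * Y)%type : topMeasType _) -> X).
Proof. by move=> x; exact: cvg_fst. Qed.

Lemma snd_tm_continuous d1 d2 (X : topMeasType d1) (Y : topMeasType d2) :
  continuous (snd : TopMeasurable.sort ((X * Y)%type : topMeasType _) -> Y).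
Proof. by move=> x; exact: cvg_snd. Qed.

Lemma continuous_compT (X Y Z : topologicalType) (f : X -> Y) (g : Y -> Z) :
  continuous f -> continuous g -> continuous (fun x => g (f x)).
Proof. by move=> cf cg x; apply: continuous_comp; [exact: cf|exact: cg]. Qed.

Section filtrations.
Variables (R : realType) (T : {posnum R}).
Local Notation time := (time T).
Local Notation Cpath := (Cpath T).
Local Notation Ein := (Ein T).
Local Notation Omega_in := (Omega_in T).
Local Notation Omega := (Omega T).

Lemma Ein_cozero_base : cozero_base R Ein.
Proof. exact: (cozero_base_prod (Cpath_cozero_base T) (time_cozero_base T)). Qed.

Lemma Omega_in_cozero_base : cozero_base R Omega_in.
Proof.
apply: cozero_base_prod; last exact: PM_cozero_base Ein_cozero_base.
by apply: cozero_base_prod; exact: Cpath_cozero_base.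
Qed.

Lemma Bin_continuous u : continuous (fun x : Omega_in => Cev (Bin x) u).
Proof.
apply: (@continuous_compT Omega_in Cpath R (fun x => x.1.1) (fun w => Cev w u)); last first.
  exact: Cev_eval_continuous.
apply: (@continuous_compT Omega_in (Cpath * Cpath)%type Cpath fst fst).
  exact: (@fst_tm_continuous _ _ (Cpath * Cpath)%type (PM Ein R)).
exact: (@fst_tm_continuous _ _ Cpath Cpath).
Qed.

Lemma Win_continuous u : continuous (fun x : Omega_in => Cev (Win x) u).
Proof.
apply: (@continuous_compT Omega_in Cpath R (fun x => x.1.2) (fun w => Cev w u)); last first.
  exact: Cev_eval_continuous.
apply: (@continuous_compT Omega_in (Cpath * Cpath)%type Cpath fst snd).
  exact: (@fst_tm_continuous _ _ (Cpath * Cpath)%type (PM Ein R)).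
exact: (@snd_tm_continuous _ _ Cpath Cpath).
Qed.

Lemma muin_continuous (f : BC Ein R) : continuous (fun x : Omega_in => Ex (muin x) (sval f)).
Proof.
apply: (@continuous_compT Omega_in (PM Ein R) R snd (fun Q => Ex (PMof Q) (sval f))).
  exact: (@snd_tm_continuous _ _ (Cpath * Cpath)%type (PM Ein R)).
exact: PM_cont.
Qed.

Lemma FWtau_sigma t : sigma_algebra setT (@FWtau R T t).
Proof. exact: sigma_algebra_smallest. Qed.

Lemma FBWmu_in_sigma t : sigma_algebra setT (@FBWmu_in R T t).
Proof. exact: sigma_algebra_smallest. Qed.

Lemma Gmeas_Cev (t : R) (u : time) : val u <= t -> Gmeas (@FWtau R T t) (fun p : Ein => Cev p.1 u).
Proof.
move=> ut U mU; apply: sub_sigma_algebra; left; exists u => //.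
by exists U => //; rewrite setTI.
Qed.

Lemma Gmeas_timemin (t : R) : Gmeas (@FWtau R T t) (fun p : Ein => Num.min (val p.2) t).
Proof. by move=> U mU; apply: sub_sigma_algebra; right; exists U => //; rewrite setTI. Qed.

Lemma Gmeas_Bin (t : R) (u : time) : val u <= t ->
  Gmeas (@FBWmu_in R T t) (fun x => Cev (Bin x) u).
Proof.
move=> ut U mU; apply: sub_sigma_algebra; left; exists u => //; left.
by exists U => //; rewrite setTI.
Qed.

Lemma Cev_fst_continuous u : continuous (fun p : Ein => Cev p.1 u).
Proof.
apply: (@continuous_compT Ein Cpath R fst (fun w => Cev w u)).
  exact: (@fst_tm_continuous _ _ Cpath time).
exact: Cev_eval_continuous.
Qed.

Lemma timemin_continuous t : continuous (fun p : Ein => Num.min (val p.2) t).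
Proof.
apply: (@continuous_minr R Ein); last exact: continuous_cstr.
apply: (@continuous_compT Ein time R snd (fun u => val u)).
  exact: (@snd_tm_continuous _ _ Cpath time).
exact: val_time_continuous.
Qed.

Lemma FWtau_cozeros t : @FWtau R T t `<=` <<s @cozeros R _ Ein (FWtau t) >>.
Proof.
apply: smallest_sub; first exact: sigma_algebra_smallest.
move=> S [[u /= ut [U mU <-]]|[U mU <-]]; rewrite setTI.
- by apply: Gmeas_cozeros => //; [exact: FWtau_sigma|exact: Cev_fst_continuous|exact: Gmeas_Cev].
- by apply: Gmeas_cozeros => //; [exact: FWtau_sigma|exact: timemin_continuous|exact: Gmeas_timemin].
Qed.

Lemma FWtau_measurable t S : @FWtau R T t S -> measurable S.
Proof.
move: S; apply: smallest_sub; first exact: sigma_algebra_measurable.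
move=> S [[u /= ut [U mU <-]]|[U mU <-]].
- apply: (continuous_meas Ein_cozero_base (@Cev_fst_continuous u)) => //.
- by apply: (continuous_meas Ein_cozero_base (@timemin_continuous t)).
Qed.

Lemma muin_measurable (C : set Ein) : measurable C ->
  measurable_fun setT (fun x : Omega_in => fine (muin x C)).
Proof.
move=> mC; apply: (@Gmeas_meas _ _ _ measurable) => //.
apply: (@Gmeas_eval R _ _ Ein Omega_in (@muin R T) measurable measurable) => //.
- exact: sigma_algebra_measurable.
- exact: sigma_algebra_measurable.
- exact: measurable_cozeros Ein_cozero_base.
move=> f [cf Gf f01] U mU; rewrite -[X in measurable X]setTI.
have fBC : continuous f /\ exists M : R, forall x, `|f x| <= M.
  by split => //; exists 1 => x; have /andP[a b] := f01 x; rewrite ger0_norm.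
exact: (continuous_meas Omega_in_cozero_base (@muin_continuous (exist _ f fBC))).
Qed.

Lemma muin_preim (C : set Ein) (U : set (\bar R)) : measurable C ->
  (fun x : Omega_in => muin x C) @^-1` U =
  (fun x : Omega_in => fine (muin x C)) @^-1` (EFin @^-1` U).
Proof. by move=> mC; apply/seteqP; split => x /=; rewrite fineP. Qed.

Lemma EFin_preim (U : set (\bar R)) : measurable U -> measurable (EFin @^-1` U : set R).
Proof.
move=> mU; have /measurable_EFinP h := @measurable_id _ R setT.
by rewrite -[X in measurable X]setTI; exact: h.
Qed.

Lemma FBWmu_in_measurable t S : @FBWmu_in R T t S -> measurable S.
Proof.
move: S; apply: smallest_sub; first exact: sigma_algebra_measurable.
move=> S [[u /= ut [[U mU <-]|[U mU <-]]]|[C FC [U mU <-]]].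
- exact: (continuous_meas Omega_in_cozero_base (@Bin_continuous u)).
- exact: (continuous_meas Omega_in_cozero_base (@Win_continuous u)).
- have mC := FWtau_measurable FC.
  by rewrite muin_preim//; apply: muin_measurable => //; exact: EFin_preim.
Qed.

Lemma muin_Gmeas t (C : set Ein) : FWtau t C ->
  Gmeas (@FBWmu_in R T t) (fun x => fine (muin x C)).
Proof.
move=> FC U mU; apply: sub_sigma_algebra; right; exists C => //.
exists (EFin @` U); first exact: measurable_image_EFin.
rewrite setTI muin_preim; last exact: FWtau_measurable FC.
by congr (_ @^-1` _); apply/seteqP; split => r /= => [[s Us [<-]]//|Ur]; exists r.
Qed.

(** Only the generators mu(C) need an argument, since evaluation at a set is not continuous. The
    integral under mu of a continuous $\mathcal F^{W,\tau}_t$-measurable function is continuous in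
    mu, and it is F_t-measurable as a limit of averages of mu-masses of level sets; [Gmeas_eval]
    leads back from these integrals to mu(C). *)
Lemma FBWmu_in_cozeros t : @FBWmu_in R T t `<=` <<s @cozeros R _ Omega_in (FBWmu_in t) >>.
Proof.
have sF := FBWmu_in_sigma t.
apply: smallest_sub; first exact: sigma_algebra_smallest.
move=> S [[u /= ut [[U mU <-]|[U mU <-]]]|[C FC [U mU <-]]]; rewrite setTI.
- by apply: Gmeas_cozeros => //; [exact: Bin_continuous|exact: Gmeas_Bin].
- apply: Gmeas_cozeros => //; first exact: Win_continuous.
  move=> V mV; apply: sub_sigma_algebra; left; exists u => //; right.
  by exists V => //; rewrite setTI.
have mC := FWtau_measurable FC.
rewrite muin_preim//.
apply: (@Gmeas_eval R _ _ Ein Omega_in (@muin R T) (FWtau t)) => //.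
- exact: FWtau_sigma.
- exact: FWtau_measurable.
- exact: FWtau_cozeros.
- move=> f [cf Gf f01].
  have fBC : continuous f /\ exists M : R, forall x, `|f x| <= M.
    by split => //; exists 1 => x; have /andP[a b] := f01 x; rewrite ger0_norm.
  apply: Gmeas_cozeros => //; first exact: (@muin_continuous (exist _ f fBC)).
  pose L n (k : 'I_n) := [set x | k.+1%:R / n%:R <= f x].
  have FL n k : FWtau t (L n k) by exact: Gmeas_ge.
  have bf : bmeas f by apply: bmeas01 => //; apply: Gmeas_meas Gf; exact: FWtau_measurable.
  apply: (@Gmeas_cvg _ _ _ _ sF (fun n x => n.+1%:R^-1 * \sum_(k < n.+1) fine (muin x (L n.+1 k)))).
    move=> n; apply: GmeasM => //; first exact: Gmeas_cst.
    by apply: Gmeas_sum => // k; exact: muin_Gmeas.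
  move=> x; apply/cvgrPdist_lt => e e0.
  exists (Num.trunc e^-1) => // n /= en.
  have bS k : bmeas (\1_(L n.+1 k) : Ein -> R).
    by apply: bmeas_indic; apply: FWtau_measurable; exact: FL.
  have -> : n.+1%:R^-1 * \sum_(k < n.+1) fine (muin x (L n.+1 k)) =
      Ex (muin x) (fun p => n.+1%:R^-1 * \sum_(k < n.+1) \1_(L n.+1 k) p).
    rewrite ExZ ?Ex_sum//; last exact: bmeas_sum.
    by congr (_ * _); apply: eq_bigr => k _; rewrite Ex_indic//; apply: FWtau_measurable; exact: FL.
  apply: (@le_lt_trans _ _ n.+1%:R^-1); last first.
    rewrite -[e]invrK ltf_pV2 ?posrE ?invr_gt0 ?ltr0n//.
    by apply: lt_le_trans (truncnS_gt _) _; rewrite ler_nat.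
  apply: Ex_close => //; first by apply: bmeasZ; exact: bmeas_sum.
  move=> p; have -> : \sum_(k < n.+1) \1_(L n.+1 k) p = \sum_(k < n.+1) (k.+1%:R / n.+1%:R <= f p)%R%:R :> R.
    by apply: eq_bigr => k _; rewrite indicE /L mem_setE.
  exact: layer_approx.
- exact: EFin_preim.
Qed.

Lemma FWtau_mono s t : s <= t -> @FWtau R T s `<=` @FWtau R T t.
Proof.
move=> st; apply: smallest_sub; first exact: FWtau_sigma.
move=> S [[u /= us H]|[U mU <-]].
  by apply: sub_sigma_algebra; left; exists u => //=; exact: le_trans st.
rewrite setTI (_ : _ @^-1` U = (fun p : Ein => Num.min (val p.2) t) @^-1` ((fun r => Num.min r s) @^-1` U)).
  apply: Gmeas_timemin; rewrite -[X in measurable X]setTI.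
  by apply: (@measurable_minr _ _ R setT id (cst s)).
by apply/seteqP; split => p /=; rewrite -minA (min_idPr st).
Qed.

Lemma FBWmu_in_mono s t : s <= t -> @FBWmu_in R T s `<=` @FBWmu_in R T t.
Proof.
move=> st; apply: smallest_sub; first exact: FBWmu_in_sigma.
move=> S [[u /= us H]|[C FC H]]; apply: sub_sigma_algebra.
  by left; exists u => //=; exact: le_trans st.
by right; exists C => //; exact: FWtau_mono FC.
Qed.
End filtrations.

(** * Adapted laws *)

Section relaxed_sets.
Context {R : realType} {d} {X : topMeasType d} (T : {posnum R}).
Variables (F : R -> set (set X)) (rho : probability X R).
Local Notation time := (time T).
Local Notation Om := (X * time)%type.

Definition tauX (w : Om) : R := val w.2.
Definition FtauX (t : R) : set (set Om) := Defs.preim (fun w : Om => Order.min (tauX w) t).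
Definition FX (t : R) : set (set Om) := preimage_set_system setT fst (F t).
Definition tau_le (s : R) : set Om := [set w | tauX w <= s].
Definition law (P : PM Om R) : probability Om R := PMof P.
Definition marginal (P : PM Om R) : Prop :=
  forall A : set X, measurable A -> law P (A `*` setT) = rho A.

Lemma tauX_measurable : measurable_fun setT tauX.
Proof.
apply: (@measurableT_comp _ _ _ Om time R (fun u => val u)); last exact: measurable_snd.
exact: (continuous_meas (time_cozero_base T) (@val_time_continuous R T)).
Qed.

Lemma tau_le_measurable s : measurable (tau_le s).
Proof.
rewrite /tau_le (_ : [set w | _] = setT `&` tauX @^-1` `]-oo, s]%classic).
  by apply: tauX_measurable => //; exact: measurable_itv.
by apply/seteqP; split => w /=; rewrite in_itv //= => -[].
Qed.

Lemma FtauX_measurable t S : FtauX t S -> measurable S.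
Proof.
move=> [U mU <-]; rewrite setTI -[X in measurable X]setTI.
by apply: (measurable_minr tauX_measurable (measurable_cst t)).
Qed.

(** Strictness matters: $\{\tau\wedge t\le s\}$ equals $\{\tau\le s\}$ when $s<t$, but is the whole
    space when $s=t$. *)
Lemma FtauX_tau_le s t : s < t -> FtauX t (tau_le s).
Proof.
move=> st; exists (`]-oo, s]%classic); first exact: measurable_itv.
by apply/seteqP; split => w /=; rewrite in_itv /= ge_min (leNgt t) st orbF //; case.
Qed.

Definition adapted_law (P : PM Om R) := marginal P /\
  forall s t : R, 0 <= s -> s < t -> t < T%:num ->
    adapted_event rho (law P) (F t) (tau_le s).

Lemma cond_indep_law (P : PM Om R) (F1 : set (set Om)) (G : set (set X)) :
  marginal P -> sigma_algebra setT G -> (forall S, G S -> measurable S) ->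
  (forall A, F1 A -> measurable A) ->
  cond_indep (law P) F1 (Defs.preim (fst : Om -> X)) (preimage_set_system setT fst G) <->
  forall A, F1 A -> adapted_event rho (law P) G A.
Proof. by move=> mP sG mG mF; exact: (cond_indep_adapted mP). Qed.

Definition RplusX : set (PM Om R) := [set P | marginal P /\ forall t : R, (0 <= t < T%:num)%R ->
  cond_indep (law P) (fplus FtauX t) (Defs.preim (fst : Om -> X)) (fplus FX t)].

Definition RrelX : set (PM Om R) := [set P | marginal P /\ forall t : R, (0 <= t < T%:num)%R ->
  cond_indep (law P) (FtauX t) (Defs.preim (fst : Om -> X)) (FX t)].

Definition R0X : set (PM Om R) := [set P | marginal P /\
  (forall t : R, (0 <= t <= T%:num)%R ->
     exists A, FX t A /\ (law P).-negligible ((tau_le t `\` A) `|` (A `\` tau_le t))) /\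
  exists tauhat : X -> time, continuous tauhat /\
     {ae law P, forall w : Om, w.2 = tauhat w.1}].

Definition convexX (S : set (PM Om R)) : Prop :=
  forall (P Q M : PM Om R) (l : R), S P -> S Q -> (0 <= l <= 1)%R ->
    (forall A : set Om, measurable A ->
       law M A = (l%:E * law P A + (1 - l)%:E * law Q A)%E) ->
    S M.
End relaxed_sets.

Lemma adapted_eventS {d d'} {X : measurableType d} {Y : measurableType d'} {R : realType}
  (rho : probability X R) (P : probability (X * Y)%type R) (G H : set (set X)) A :
  G `<=` H -> adapted_event rho P G A -> adapted_event rho P H A.
Proof. by move=> GH [g [Gg g01 gE]]; exists g; split => // U /Gg/GH. Qed.

Lemma fplus_sigma {R : realType} {X : Type} (F : R -> set (set X)) t :
  (forall s, sigma_algebra setT (F s)) -> sigma_algebra setT (fplus F t).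
Proof.
move=> sF; split.
- by move=> s _; case: (sF s).
- by move=> A FA s ts; case: (sF s) => _ + _; apply; exact: FA.
- by move=> A FA s ts; case: (sF s) => _ _; apply => i; exact: FA.
Qed.

Lemma RGenOInftyI (R : realType) : setI_closed (@RGenOInfty.G R).
Proof.
move=> _ _ [a ->] [b ->]; exists (Num.max a b).
by apply/seteqP; split => x /=; rewrite !in_itv /= !andbT gt_max; [move=> [-> ->]|move/andP].
Qed.

(** The sets [U] satisfying the identity form a Dynkin class even though [a] may change sign,
    countable disjoint unions being handled by dominated convergence; the rays $]r,\infty[$ are a
    generating pi-system. *)
Lemma orth_dynkin {d d'} {X : measurableType d} {Y : measurableType d'} {R : realType}
  (P : probability (X * Y)%type R) (f : X * Y -> R) (a : X * Y -> R) :
  measurable_fun setT f -> bmeas a -> Ex P a = 0 ->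
  (forall r, Ex P (fun w => \1_[set w | r < f w] w * a w) = 0) ->
  forall U : set R, measurable U -> Ex P (fun w => \1_(f @^-1` U) w * a w) = 0.
Proof.
move=> mf ba a0 H U mU.
have mfU (V : set R) : measurable V -> measurable (f @^-1` V).
  by move=> mV; rewrite -[X in measurable X]setTI; exact: mf.
have bfU (V : set R) : measurable V -> bmeas (fun w => \1_(f @^-1` V) w * a w).
  by move=> mV; apply: bmeasM => //; apply: bmeas_indic; exact: mfU.
have : <<s @RGenOInfty.G R >> `<=`
    [set V | measurable V /\ Ex P (fun w => \1_(f @^-1` V) w * a w) = 0].
  apply: pi_lambda; first exact: RGenOInftyI.
  - split.
    + split => //.
      rewrite [X in Ex P X](_ : _ = a)//.
      by apply: funext => w; rewrite preimage_setT indicT mul1r.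
    + move=> V [mV V0]; split; first exact: measurableC.
      rewrite [X in Ex P X](_ : _ = fun w => a w - \1_(f @^-1` V) w * a w).
        by rewrite ExB ?a0 ?V0 ?subrr//; exact: bfU.
      apply: funext => w; rewrite preimage_setC indicE in_setC indicE.
      by case: (_ \in _); rewrite ?mul1r ?mul0r ?subr0 ?subrr.
    + move=> V tV HV; have mV i : measurable (V i) by case: (HV i).
      split; first exact: bigcup_measurable.
      have [_ [M aM]] := ba.
      have c : Ex P (fun w => \sum_(0 <= i < n) \1_(f @^-1` V i) w * a w) @[n --> \oo] -->
          Ex P (fun w => \1_(f @^-1` (\bigcup_i V i)) w * a w).
        have key n w : \sum_(0 <= i < n) \1_(f @^-1` V i) w * a w =
            \1_(f @^-1` (\bigcup_(i < n) V i)) w * a w.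
          rewrite -mulr_suml; congr (_ * _).
          elim: n => [|n IH].
            by rewrite big_geq// (_ : \bigcup_(i < 0) V i = set0) ?preimage_set0 ?indic0// -subset0 => y [].
          have -> : \bigcup_(i < n.+1) V i = (\bigcup_(i < n) V i) `|` V n.
            by rewrite bigcup_mkord big_ord_recr /= -bigcup_mkord.
          rewrite big_nat_recr //= IH preimage_setU.
          rewrite !indicE in_setU; case: (boolP (w \in f @^-1` V n)) => wn; last by rewrite orbF addr0.
          rewrite (_ : (w \in _) = false) ?add0r//; apply/negbTE/negP => /set_mem [i /= ni Vi].
          move/trivIsetP : tV => /(_ i n I I); rewrite ltn_eqF// => /(_ isT) e.
          have : (V i `&` V n) (f w) by split => //; exact: set_mem wn.
          by rewrite e.
        apply: (@Ex_cvg _ _ _ P _ _ M).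
        - by move=> n; apply: bmeas_meas; apply: bmeas_sum => i; exact: bfU.
        - move=> n w; rewrite key indicE normrM; case: (_ \in _).
            by rewrite normr1 mul1r.
          by rewrite normr0 mul0r; apply: le_trans (aM w).
        - move=> w; apply/cvgrPdist_lt => e e0.
          case: (pselect ((\bigcup_i V i) (f w))) => [[i _ Vi]|nV].
            exists i.+1 => // n /= ni; rewrite key !indicE !mem_set ?subrr ?normr0//.
              by exists i.
            by exists i.
          exists 0%N => // n _; rewrite key !indicE !memNset ?subrr ?normr0//.
          by move=> [i _ Vi]; apply: nV; exists i.
      have e0 : (fun n => Ex P (fun w => \sum_(0 <= i < n) \1_(f @^-1` V i) w * a w)) = fun=> 0.
        apply: funext => n; rewrite Ex_sum; last by move=> i; exact: bfU.
        by rewrite big1// => i _; case: (HV i).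
      by move: c; rewrite e0 => /(cvg_unique (@Rhausdorff R)); apply; exact: cvg_cst.
  - move=> _ [r ->]; split; first exact: measurable_itv.
    rewrite -[RHS](H r).
    suff -> : f @^-1` `]r, +oo[%classic = [set w0 | r < f w0] by [].
    by apply/seteqP; split => w /=; rewrite in_itv /= andbT.
have : <<s @RGenOInfty.G R >> U.
  suff : (@RGenOInfty.G R).-sigma.-measurable U by [].
  by rewrite -RGenOInfty.measurableE.
by move=> sU sub; case: (sub _ sU).
Qed.

(** * Upper limits of versions of a density *)

Section limsup.
Context {R : realType} {d} {X : measurableType d}.
Variables (g : nat -> X -> R).
Hypothesis g01 : forall n x, 0 <= g n x <= 1.

Fixpoint run_max (k n : nat) (x : X) : R :=
  if k is k'.+1 then Num.max (g n x) (run_max k' n.+1 x) else g n x.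

Lemma run_max01 k n x : 0 <= run_max k n x <= 1.
Proof.
elim: k n => [|k IH] n //=; have /andP[a b] := g01 n x; have /andP[a' b'] := IH n.+1.
by rewrite le_max a ge_max b b'.
Qed.

Lemma run_max_nd n x : nondecreasing_seq (fun k => run_max k n x).
Proof.
apply/nondecreasing_seqP => k; elim: k n => [|k IH] n.
  by rewrite /= le_max lexx.
have h := IH n.+1.
rewrite -[leLHS]/(Num.max (g n x) (run_max k n.+1 x)).
rewrite -[leRHS]/(Num.max (g n x) (run_max k.+1 n.+1 x)).
rewrite ge_max; apply/andP; split; first by rewrite le_max lexx.
by apply: le_trans h _; rewrite le_max lexx orbT.
Qed.

Definition tail_sup n x : R := limn (fun k => run_max k n x).

Lemma tail_sup_cvg n x : run_max k n x @[k --> \oo] --> tail_sup n x.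
Proof.
apply: nondecreasing_is_cvgn; first exact: run_max_nd.
by exists 1 => _ [k _ <-]; case/andP: (run_max01 k n x).
Qed.

Lemma tail_sup01 n x : 0 <= tail_sup n x <= 1.
Proof.
have c := cvgP _ (@tail_sup_cvg n x).
apply/andP; split; [apply: limr_ge => //|apply: limr_le => //];
  by apply: nearW => k; case/andP: (run_max01 k n x).
Qed.

Lemma tail_sup_ni x : nonincreasing_seq (fun n => tail_sup n x).
Proof.
apply/nonincreasing_seqP => n.
apply: limr_le; first exact: cvgP (@tail_sup_cvg n.+1 x).
apply: nearW => k; apply: le_trans (_ : run_max k.+1 n x <= _).
  by rewrite /= le_max lexx orbT.
exact: (nondecreasing_cvgn_le (@run_max_nd n x) (cvgP _ (@tail_sup_cvg n x)) k.+1).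
Qed.

(** The pointwise upper limit of [g]. It ignores every initial segment of the sequence, so it is
    measurable for each sigma-algebra that eventually measures the [g n]. *)
Definition lim_tail_sup x : R := limn (fun n => tail_sup n x).

Lemma lim_tail_sup_cvg x : tail_sup n x @[n --> \oo] --> lim_tail_sup x.
Proof.
apply: nonincreasing_is_cvgn; first exact: tail_sup_ni.
by exists 0 => _ [n _ <-]; case/andP: (tail_sup01 n x).
Qed.

Lemma lim_tail_sup01 x : 0 <= lim_tail_sup x <= 1.
Proof.
have c := cvgP _ (@lim_tail_sup_cvg x).
apply/andP; split; [apply: limr_ge => //|apply: limr_le => //];
  by apply: nearW => n; case/andP: (tail_sup01 n x).
Qed.

Lemma Gmeas_tail_sup (G : set (set X)) N : sigma_algebra setT G ->
  (forall n, (N <= n)%N -> Gmeas G (g n)) -> Gmeas G (tail_sup N).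
Proof.
move=> sG Gg; apply: (Gmeas_cvg sG _ (@tail_sup_cvg N)).
move=> k; elim: k N Gg => [|k IH] N Gg /=; first exact: Gg.
apply: Gmeas_max => //; first exact: Gg.
by apply: IH => n Nn; apply: Gg; exact: ltnW.
Qed.

Lemma Gmeas_lim_tail_sup (G : set (set X)) N : sigma_algebra setT G ->
  (forall n, (N <= n)%N -> Gmeas G (g n)) -> Gmeas G lim_tail_sup.
Proof.
move=> sG Gg; apply: (@Gmeas_cvg _ _ _ _ sG (fun n => tail_sup (n + N))).
  move=> n; apply: Gmeas_tail_sup => // k nk; apply: Gg.
  by apply: leq_trans nk; exact: leq_addl.
move=> x; have := @lim_tail_sup_cvg x.
by rewrite -(cvg_shiftn N).
Qed.

(** Each $g_n-q$ is orthogonal to itself, so all [g n] are versions of [q]. Finite maxima then have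
    zero mean distance to [q], and the two limits follow by dominated convergence. *)
Lemma Ex_lim_tail_sup (rho : probability X R) (f : X -> R) (q : X -> R) :
  (forall n, measurable_fun setT (g n)) -> bmeas f -> bmeas q ->
  (forall n (h : X -> R), bmeas h -> Ex rho (fun x => h x * g n x) = Ex rho (fun x => h x * q x)) ->
  Ex rho (fun x => f x * lim_tail_sup x) = Ex rho (fun x => f x * q x).
Proof.
move=> mg bf bq gE.
have bg n : bmeas (g n) by exact: bmeas01.
have bm k n : bmeas (run_max k n).
  by elim: k n => [|k IH] n //=; exact: bmeas_max.
have [_ [M fM]] := bf.
have norm01 (a : X -> R) : (forall x, 0 <= a x <= 1) -> forall x, `|f x * a x| <= M.
  move=> a01 x; have /andP[a0 a1] := a01 x.
  by rewrite normrM (ger0_norm a0) (le_trans _ (fM x))// ler_piMr.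
have sq0 n : Ex rho (fun x => (g n x - q x) * (g n x - q x)) = 0.
  rewrite [X in Ex rho X](_ : _ = fun x => (g n x - q x) * g n x - (g n x - q x) * q x).
    have bb := bmeasB (bg n) bq.
    by rewrite ExB ?gE ?subrr//; exact: bmeasM.
  by apply: funext => x; ring.
have abs0 n : Ex rho (fun x => `|g n x - q x|) = 0.
  by apply: Ex_sq0_abs => //; exact: bmeasB.
have m0 k n : Ex rho (fun x => `|run_max k n x - q x|) = 0.
  elim: k n => [|k IH] n; first exact: abs0.
  apply/eqP; rewrite eq_le Ex_ge0 ?andbT//.
  apply: (@le_trans _ _ (Ex rho (fun x => `|g n x - q x| + `|run_max k n.+1 x - q x|))).
    apply: Ex_le.
    - by apply: bmeas_norm; apply: bmeasB.
    - by apply: bmeasD; apply: bmeas_norm; exact: bmeasB.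
    - move=> x /=; case: (leP (g n x)) => _; by rewrite ?lerDl ?lerDr.
  rewrite ExD ?abs0 ?IH ?addr0//; apply: bmeas_norm; exact: bmeasB.
have mE k n : Ex rho (fun x => f x * run_max k n x) = Ex rho (fun x => f x * q x).
  apply/eqP; rewrite -subr_eq0 -ExB; [|exact: bmeasM..].
  rewrite -normr_le0; apply: le_trans (Ex_norm _ _) _; first by apply: bmeasB; exact: bmeasM.
  rewrite -(mulr0 M) -(m0 k n) -ExZ; last by apply: bmeas_norm; exact: bmeasB.
  apply: Ex_le.
  - by apply: bmeas_norm; apply: bmeasB; exact: bmeasM.
  - by apply: bmeasZ; apply: bmeas_norm; exact: bmeasB.
  - by move=> x; rewrite -mulrBr normrM ler_wpM2r.
have mt n : measurable_fun setT (tail_sup n).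
  by apply: (measurable_fun_cvg (fun k => bmeas_meas (bm k n))) => x _; exact: tail_sup_cvg.
have tE n : Ex rho (fun x => f x * tail_sup n x) = Ex rho (fun x => f x * q x).
  have c : Ex rho (fun x => f x * run_max k n x) @[k --> \oo] --> Ex rho (fun x => f x * tail_sup n x).
    apply: (@Ex_cvg _ _ _ rho _ _ M).
    - by move=> k; apply: bmeas_meas; exact: bmeasM.
    - by move=> k; apply: norm01 => x; exact: run_max01.
    - by move=> x; apply: cvgM; [exact: cvg_cst|exact: tail_sup_cvg].
  move: c; under eq_fun do rewrite mE.
  by move=> /(cvg_unique (@Rhausdorff R)); move=> /(_ _ (cvg_cst _)).
have c : Ex rho (fun x => f x * tail_sup n x) @[n --> \oo] --> Ex rho (fun x => f x * lim_tail_sup x).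
  apply: (@Ex_cvg _ _ _ rho _ _ M).
  - by move=> k; apply: measurable_funM => //; case: bf.
  - by move=> k; apply: norm01 => x; exact: tail_sup01.
  - by move=> x; apply: cvgM; [exact: cvg_cst|exact: lim_tail_sup_cvg].
move: c; under eq_fun do rewrite tE.
by move=> /(cvg_unique (@Rhausdorff R)); move=> /(_ _ (cvg_cst _)).
Qed.
End limsup.

Section relaxed_sets_characterization.
Context {R : realType} {d} {X : topMeasType d} (T : {posnum R}).
Variables (F : R -> set (set X)) (rho : probability X R).
Hypothesis sF : forall t, sigma_algebra setT (F t).
Hypothesis mF : forall t S, F t S -> measurable S.
Hypothesis monoF : forall s t, s <= t -> F s `<=` F t.
Local Notation time := (time T).
Local Notation Om := (X * time)%type.
Local Notation adapted_law := (@adapted_law R d X T F rho).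
Local Notation FtauX := (@FtauX R d X T).
Local Notation FX := (@FX R d X T F).
Local Notation marginal := (@marginal R d X T rho).
Implicit Type P : PM Om R.

(** It suffices to treat $\{\tau\wedge t>r\}$: empty for $r\ge t$, otherwise the complement of
    $\{\tau\le r\}$ with $r<t$, to which the definition of an adapted law applies; for $r<0$ the
    latter event is empty. *)
Lemma orth_FtauX P t : adapted_law P -> t < T%:num -> 0 <= t ->
  forall A, FtauX t A -> orth_event rho (law P) (F t) A.
Proof.
move=> [mP aP] tT t0 _ [U mU <-] h bh h0; rewrite setTI.
have hE : Ex rho h = 0.
  have := h0 _ (sigma_algebraT (sF t)).
  by rewrite [X in Ex rho X](_ : _ = h)//; apply: funext => x; rewrite indicT mul1r.
have bh' : bmeas (fun w : Om => h w.1) by apply: bmeas_comp => //; exact: measurable_fst.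
have hE' : Ex (law P) (fun w => h w.1) = 0 by rewrite (Ex_marginal mP bh).
apply: (@orth_dynkin _ _ X time R (law P) (fun w => Order.min (tauX w) t)) => //.
  by apply: measurable_minr; [exact: tauX_measurable|exact: measurable_cst].
move=> r; case: (leP t r) => tr.
  rewrite [X in Ex _ X](_ : _ = fun=> 0) ?Ex_cst//; apply: funext => w.
  rewrite indicE memNset ?mul0r//= lt_min => /andP[_].
  by rewrite ltNge tr.
rewrite [X in Ex _ X](_ : _ = fun w => h w.1 - \1_(tau_le r) w * h w.1); last first.
  apply: funext => w; rewrite !indicE.
  case: (leP (tauX w) r) => wr.
    rewrite memNset ?mem_set ?mul0r ?mul1r ?subrr//=.
    by rewrite lt_min => /andP[]; rewrite ltNge wr.
  rewrite mem_set ?memNset ?mul0r ?mul1r ?subr0//= ?lt_min ?wr//.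
  by rewrite /tau_le /= leNgt wr.
have btau : bmeas (\1_(@tau_le R d X T r) : Om -> R) by apply: bmeas_indic; exact: tau_le_measurable.
rewrite ExB//; last exact: bmeasM.
rewrite hE' sub0r; apply/eqP; rewrite oppr_eq0; apply/eqP.
case: (leP 0 r) => r0.
  exact: (adapted_orth mP (@mF t) (sF t) (@tau_le_measurable R d X T r) (aP _ _ r0 tr tT) bh h0).
rewrite [X in Ex _ X](_ : _ = fun=> 0) ?Ex_cst//; apply: funext => w.
rewrite indicE memNset ?mul0r//= /tau_le /= => wr.
by have /andP[] := val_time01 w.2; rewrite leNgt (le_lt_trans wr r0).
Qed.

Lemma adapted_FtauX P t : adapted_law P -> t < T%:num -> 0 <= t ->
  forall A, FtauX t A -> adapted_event rho (law P) (F t) A.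
Proof.
move=> aP tT t0 A FA; apply: (orth_adapted aP.1 (@mF t) (sF t) (FtauX_measurable FA)).
exact: orth_FtauX FA.
Qed.

(** The densities of [A] at times $s_n$ decreasing to t are versions of one function. Their upper
    limit is still a version, and it is measurable for F_r for every $r>t$, hence for F_(t+). *)
Lemma adapted_fplus P t : adapted_law P -> t < T%:num -> 0 <= t ->
  forall A, fplus FtauX t A -> adapted_event rho (law P) (fplus F t) A.
Proof.
move=> aP tT t0 A FA.
(* The denominator n+2 keeps $s_0$ strictly below T. *)
pose s n := t + (T%:num - t) / n.+2%:R.
have Tt : 0 < T%:num - t by rewrite subr_gt0.
have ts n : t < s n by rewrite /s ltrDl divr_gt0.
have sT n : s n < T%:num.
  by rewrite /s -ltrBrDl ltr_pdivrMr// ltr_pMr// ltr1n.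
have s0 n : 0 <= s n by apply: le_trans t0 (ltW (ts n)).
have FAs n : FtauX (s n) A by apply: FA.
have mA := FtauX_measurable (FAs 0%N).
have ad n := adapted_FtauX aP (sT n) (s0 n) (FAs n).
pose g n := sval (cid (ad n)).
have gP n : [/\ Gmeas (F (s n)) (g n), forall x, 0 <= g n x <= 1 &
      forall S, measurable S ->
        Ex (law P) (fun w => \1_A w * \1_S w.1) = Ex rho (fun x => \1_S x * g n x)].
  by rewrite /g; case: cid.
have g01 n x : 0 <= g n x <= 1 by case: (gP n).
have mg n : measurable_fun setT (g n) by apply: (@Gmeas_meas _ _ _ (F (s n))) => //; [exact: mF|case: (gP n)].
have bg n : bmeas (g n) by exact: bmeas01.
exists (lim_tail_sup g); split.
- move=> U mU r tr.
  have [N hN] : exists N, forall n, (N <= n)%N -> s n <= r.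
    exists (Num.trunc ((T%:num - t) / (r - t))) => n Nn.
    rewrite /s -lerBrDl ler_pdivrMr// mulrC -ler_pdivrMr ?subr_gt0//.
    apply: ltW; apply: lt_le_trans (truncnS_gt _) _; rewrite ler_nat.
    by apply: leq_trans (_ : n.+1 <= _)%N.
  apply: (@Gmeas_lim_tail_sup _ _ _ g g01 (F r) N) => // n Nn.
  by apply: GmeasS (monoF (hN n Nn)) _; case: (gP n).
- exact: lim_tail_sup01.
- move=> S mS; have bS := @bmeas_indic _ _ R _ mS.
  rewrite (Ex_lim_tail_sup g01 mg bS (bg 0%N)); first by case: (gP 0%N) => _ _; apply.
  move=> n h bh; rewrite -(density_Ex aP.1 mA (bg n) bh); last by case: (gP n).
  by rewrite -(density_Ex aP.1 mA (bg 0%N) bh)//; case: (gP 0%N).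
Qed.

(** The first projection is onto, so a set is determined by its preimage: the bases obtained at
    different times coincide. *)
Lemma fplus_FX t : fplus FX t = preimage_set_system setT (fst : Om -> X) (fplus F t).
Proof.
apply/seteqP; split => [A FA|_ [S FS <-] s ts]; last by exists S => //; exact: FS.
have [S _ SA] : FX (t + 1) A by apply: FA; rewrite ltrDl.
exists S => // s ts; have [S' FS' S'A] := FA s ts.
suff -> : S = S' by [].
move: SA; rewrite -S'A !setTI => e; apply/seteqP; split => x Sx.
  have : ((fst : Om -> X) @^-1` S) (x, time0 T) by [].
  by rewrite e.
have : ((fst : Om -> X) @^-1` S') (x, time0 T) by [].
by rewrite -e.
Qed.

Lemma RrelXE : @RrelX R d X T F rho = [set P | adapted_law P].
Proof.
apply/seteqP; split => P [mP cP]; split => //.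
- move=> s t s0 st tT; have t0 := le_trans s0 (ltW st).
  have tt : 0 <= t < T%:num by rewrite t0 tT.
  have [+ _] := cond_indep_law mP (sF t) (@mF t) (@FtauX_measurable R d X T t).
  move/(_ (cP t tt)); apply; exact: FtauX_tau_le.
- move=> t /andP[t0 tT].
  have [_] := cond_indep_law mP (sF t) (@mF t) (@FtauX_measurable R d X T t).
  by apply => A FA; exact: adapted_FtauX FA.
Qed.

Lemma RplusXE : @RplusX R d X T F rho = [set P | adapted_law P].
Proof.
apply/seteqP; split => P [mP cP]; split => //.
- move=> s t s0 st tT; have sT := lt_trans st tT.
  have ss : 0 <= s < T%:num by rewrite s0 sT.
  have mG S : fplus F s S -> measurable S.
    by move=> /(_ _ st); exact: mF.
  have mH A : fplus FtauX s A -> measurable A.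
    by move=> /(_ _ st); exact: FtauX_measurable.
  have [+ _] := cond_indep_law mP (fplus_sigma s sF) mG mH.
  rewrite -fplus_FX => /(_ (cP s ss)) h.
  apply: (@adapted_eventS _ _ _ _ _ _ _ (fplus F s)); first by move=> A; apply.
  by apply: h => r sr; exact: FtauX_tau_le.
- move=> t /andP[t0 tT].
  have mG S : fplus F t S -> measurable S by move=> /(_ _ tT); exact: mF.
  have mH A : fplus FtauX t A -> measurable A by move=> /(_ _ tT); exact: FtauX_measurable.
  rewrite fplus_FX.
  have [_] := cond_indep_law mP (fplus_sigma t sF) mG mH.
  by apply => A FA; exact: adapted_fplus FA.
Qed.

Lemma convex_adapted : convexX [set P | adapted_law P].
Proof.
move=> P Q M l [mP aP] [mQ aQ] /andP[l0 l1] ME.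
have l1' : 0 <= 1 - l by rewrite subr_ge0.
have mM : marginal M.
  move=> A mA; rewrite ME; last exact: measurableX.
  rewrite mP// mQ// -ge0_muleDl ?lee_fin//.
  by rewrite -EFinD addrC subrK mul1e.
split => // s t s0 st tT.
have [g [Gg g01 gE]] := aP s t s0 st tT.
have [h [Gh h01 hE]] := aQ s t s0 st tT.
have bg : bmeas g by apply: bmeas01 => //; apply: Gmeas_meas Gg; exact: mF.
have bh : bmeas h by apply: bmeas01 => //; apply: Gmeas_meas Gh; exact: mF.
exists (fun x => l * g x + (1 - l) * h x); split.
- by apply: GmeasD => //; apply: GmeasM => //; exact: Gmeas_cst.
- move=> x; have /andP[a b] := g01 x; have /andP[a' b'] := h01 x.
  by rewrite addr_ge0 ?mulr_ge0//=; nra.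
- move=> S mS; have bS := @bmeas_indic _ _ R _ mS.
  have mC : measurable (@tau_le R d X T s `&` (fst : Om -> X) @^-1` S).
    apply: measurableI; first exact: tau_le_measurable.
    by rewrite -[X in measurable X]setTI; exact: measurable_fst.
  have E (Q' : PM Om R) : Ex (law Q') (fun w => \1_(tau_le s) w * \1_S w.1) =
      fine (law Q' (@tau_le R d X T s `&` (fst : Om -> X) @^-1` S)).
    by rewrite -Ex_indic//; congr Ex; apply: funext => w; rewrite indicI.
  rewrite [RHS](_ : _ = l * Ex rho (fun x => \1_S x * g x) + (1 - l) * Ex rho (fun x => \1_S x * h x)).
    rewrite -gE// -hE// !E ME// fineD ?fineM//;
      by rewrite ?fin_numM// fin_num_measure.
  rewrite -!ExZ -?ExD; try exact: bmeasM; try by apply: bmeasZ; exact: bmeasM.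
  by congr Ex; apply: funext => x; ring.
Qed.
End relaxed_sets_characterization.

(** * Closedness *)

Lemma eq_probability_BC {R : realType} {d} {X : topMeasType d} (P Q : probability X R) :
  cozero_base R X -> (forall f : BC X R, Ex P (sval f) = Ex Q (sval f)) ->
  forall A, measurable A -> P A = Q A.
Proof.
move=> gX PQ A mA.
have sub := measurable_cozeros gX.
have mG := @sigma_algebra_measurable _ X.
have mc : measurable = <<s @cozeros R _ X measurable >>.
  by apply/seteqP; split => //; exact: (@cozeros_sub R _ X measurable mG).
apply: (@measure_unique _ R X (@cozeros R _ X measurable) (fun=> setT) mc) => //.
- exact: cozerosI.
- move=> _; exists (fun=> 1); split; [exact: continuous_cstr|exact: Gmeas_cst|].
  by apply/seteqP; split => x //= _; rewrite ltr01.
- by rewrite bigcup_const//; exists 0%N.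
- move=> S cS; have [f cf fS] := cozeros_limit mG cS.
  have mS : measurable S by rewrite mc; exact: sub_sigma_algebra.
  have f01 n x : 0 <= f n x <= 1 by case: (cf n).
  have cfb n : continuous (f n) /\ exists M : R, forall x, `|f n x| <= M.
    by split; [case: (cf n)|exists 1 => x; have /andP[? ?] := f01 n x; rewrite ger0_norm].
  have lim (P' : probability X R) : Ex P' (f n) @[n --> \oo] --> Ex P' (\1_S).
    apply: (@Ex_cvg _ _ _ P' _ _ 1) => //.
    + by move=> n; apply: continuous_meas => //; case: (cf n).
    + by move=> n x; have /andP[? ?] := f01 n x; rewrite ger0_norm.
  have e : (fun n => Ex P (f n)) = (fun n => Ex Q (f n)).
    by apply: funext => n; exact: (PQ (exist _ (f n) (cfb n))).
  have := lim P; rewrite e => /(cvg_unique (@Rhausdorff R))/(_ (lim Q)).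
  by rewrite !Ex_indic// => h; have := congr1 EFin h; rewrite !fineP.
- by move=> n; rewrite -ge0_fin_numE// fin_num_measure.
Qed.

Section L1_density.
Context {R : realType} {d} {X : topMeasType d} (rho : probability X R).
Hypothesis gX : cozero_base R X.

Lemma L1_approx (h : X -> R) (e : R) : bmeas h -> 0 < e ->
  exists2 phi : X -> R, continuous phi /\ (exists M : R, forall x, `|phi x| <= M) &
    Ex rho (fun x => `|phi x - h x|) < e.
Proof.
move=> bh e0; have [mh [M hM]] := bh.
have M0 : 0 <= M by exact: le_trans (hM point).
pose N := M + 1; have N0 : 0 < N by rewrite /N; lra.
have N20 : 0 < 2 * N by rewrite mulr_gt0.
pose p x := (h x + N) / (2 * N).
have p01 x : 0 <= p x <= 1.
  have := hM x; rewrite ler_norml => /andP[? ?].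
  by rewrite /p divr_ge0 ?ler_pdivrMr//= /N; lra.
have mp : measurable_fun setT p by apply: measurable_funM => //; exact: measurable_funD.
have Gp : Gmeas measurable p by move=> U mU; rewrite -[X in measurable X]setTI; exact: mp.
have e20 : 0 < e / (2 * N) by rewrite divr_gt0.
have [q [cq Gq q01] qp] := capprox_fun rho (@sigma_algebra_measurable _ X) (fun S mS => mS)
  (measurable_cozeros gX) Gp p01 e20.
have bq : bmeas q by apply: bmeas01 => //; apply: Gmeas_meas Gq.
have bp : bmeas p by exact: bmeas01.
exists (fun x => 2 * N * q x - N).
  split.
    apply: continuousBr; last exact: continuous_cstr.
    by apply: continuousMr => //; exact: continuous_cstr.
  exists N => x; have /andP[q0 q1] := q01 x; rewrite ler_norml; apply/andP; split.
    by rewrite lerBrDl subrr mulr_ge0// ltW.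
  by have := ler_piMr (ltW N20) q1; lra.
rewrite [X in Ex rho X](_ : _ = fun x => 2 * N * `|q x - p x|).
  rewrite ExZ; last by apply: bmeas_norm; exact: bmeasB.
  by rewrite mulrC -ltr_pdivlMr.
apply: funext => x; rewrite -[in RHS](ger0_norm (ltW N20)) -normrM; congr `|_|.
by rewrite /p; field; rewrite gt_eqF.
Qed.
End L1_density.

Section closedness.
Context {R : realType} {d} {X : topMeasType d} (T : {posnum R}).
Variables (F : R -> set (set X)) (rho : probability X R).
Hypothesis gX : cozero_base R X.
Hypothesis sF : forall t, sigma_algebra setT (F t).
Hypothesis mF : forall t S, F t S -> measurable S.
Local Notation time := (time T).
Local Notation Om := (X * time)%type.
Local Notation adapted_law := (@adapted_law R d X T F rho).
Local Notation FtauX := (@FtauX R d X T).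
Local Notation marginal := (@marginal R d X T rho).

Lemma Om_cozero_base : cozero_base R Om.
Proof. exact: (cozero_base_prod gX (time_cozero_base T)). Qed.

Lemma closure_BC (S : set (PM Om R)) P (f : BC Om R) (e : R) : closure S P -> 0 < e ->
  exists2 Q, S Q & `|Ex (law P) (sval f) - Ex (law Q) (sval f)| < e.
Proof.
move=> cP e0; have /cvgrPdist_lt/(_ _ e0) nU := @PM_cont R _ Om f P.
by have [Q [SQ UQ]] := cP _ nU; exists Q.
Qed.

Lemma fstBC (phi : X -> R) : continuous phi /\ (exists M : R, forall x, `|phi x| <= M) ->
  continuous (fun w : Om => phi w.1) /\ (exists M : R, forall w : Om, `|phi w.1| <= M).
Proof.
move=> [cp [M pM]]; split; last by exists M => w; exact: pM.
apply: (@continuous_compT Om X R fst phi) => //.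
exact: (@fst_tm_continuous _ _ X time).
Qed.

Lemma closure_marginal (S : set (PM Om R)) P : S `<=` marginal -> closure S P -> marginal P.
Proof.
move=> SM cP A mA.
have [Q [QE QEx]] := push_ex (law P) (@measurable_fst _ _ X time).
have -> : law P (A `*` setT) = Q A.
  by rewrite QE//; congr (law P _); apply/seteqP; split => w /=; [case|].
apply: (eq_probability_BC gX) => // f.
rewrite QEx; last exact: BC_bmeas.
apply/eqP; rewrite -subr_eq0 -normr_le0; apply/ler_addgt0Pr => e e0; rewrite add0r.
have [Q' SQ] := closure_BC (exist _ _ (fstBC (svalP f))) cP e0.
rewrite /= (Ex_marginal (SM _ SQ)); last exact: BC_bmeas.
exact: ltW.
Qed.

(** Equal to 1 up to s, to 0 from $s+1/n$ on and linear between: a continuous function above the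
    indicator of $\{r\le s\}$ that converges to it. *)
Definition cutoff (s : R) (n : nat) (r : R) : R :=
  Num.max 0 (Num.min 1 (1 - n%:R * (r - s))).

Lemma cutoff01 s n r : 0 <= cutoff s n r <= 1.
Proof. by rewrite /cutoff le_max lexx /= ge_max ler01 ge_min lexx. Qed.

Lemma cutoff_continuous s n : continuous (cutoff s n).
Proof.
apply: continuous_maxr; first exact: continuous_cstr.
apply: continuous_minr; first exact: continuous_cstr.
apply: continuousBr; first exact: continuous_cstr.
apply: continuousMr; first exact: continuous_cstr.
apply: continuousBr; last exact: continuous_cstr.
by move=> x; exact: cvg_id.
Qed.

(** When $s+1/n\le t$ the cutoff vanishes beyond t, so at tau it depends only on $\tau\wedge t$ and
    inherits the orthogonality of $\mathcal F^\tau_t$. *)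
Lemma cutoff_min s n t r : (0 < n)%N -> s + n%:R^-1 <= t ->
  cutoff s n r = cutoff s n (Num.min r t).
Proof.
move=> n0 st; case: (leP r t) => // tr.
have n0' : 0 < n%:R :> R by rewrite ltr0n.
have z u : t <= u -> cutoff s n u = 0.
  move=> tu; apply/max_idPl; rewrite ge_min; apply/orP; right.
  rewrite subr_le0 mulrC -ler_pdivrMr// div1r lerBrDl.
  exact: le_trans tu.
by rewrite !z// ltW.
Qed.

(** For large n the equation $E[\mathrm{cutoff}(\tau)\,h]=0$ holds under every law of [S]. It passes
    to the limit law because replacing [h] by a continuous function costs the same error in
    $L^1(\rho)$ under both laws, the marginal being fixed; then n tends to infinity. *)
Lemma closure_adapted (S : set (PM Om R)) : S `<=` [set P | adapted_law P] ->
  closure S `<=` [set P | adapted_law P].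
Proof.
move=> SA P cP; have mP : marginal P by apply: closure_marginal cP => Q /SA[].
split => // s t s0 st tT.
apply: (orth_adapted mP (@mF t) (sF t) (@tau_le_measurable R d X T s)) => h bh h0.
have t0 := le_trans s0 (ltW st).
have [mh [M hM]] := bh.
have M0 : 0 <= M by exact: le_trans (hM point).
have mtau := @tauX_measurable R d X T.
have bh' : bmeas (fun w : Om => h w.1) by apply: bmeas_comp => //; exact: measurable_fst.
have bg n : bmeas (fun w : Om => cutoff s n (tauX w)).
  apply: bmeas01 => [|w]; last exact: cutoff01.
  by apply: measurableT_comp => //; exact: (continuous_measurable_fun (@cutoff_continuous s n)).
have key n : (0 < n)%N -> s + n%:R^-1 <= t -> Ex (law P) (fun w => cutoff s n (tauX w) * h w.1) = 0.
  move=> n0 sn; apply/eqP; rewrite -normr_le0; apply/ler_addgt0Pr => e e0; rewrite add0r.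
  have e30 : 0 < e / 3 by rewrite divr_gt0.
  have [phi phiBC phih] := L1_approx rho gX bh e30.
  have bphi : bmeas phi by case: phiBC => cphi [N pN]; split; [exact: continuous_meas|exists N].
  have bphi' : bmeas (fun w : Om => phi w.1) by apply: bmeas_comp => //; exact: measurable_fst.
  have fBC : continuous (fun w : Om => cutoff s n (tauX w) * phi w.1) /\
      exists N : R, forall w : Om, `|cutoff s n (tauX w) * phi w.1| <= N.
    split.
      apply: (@continuousMr R Om); last by case: (fstBC phiBC).
      apply: (@continuous_compT Om time R snd (fun u => cutoff s n (val u))).
        exact: (@snd_tm_continuous _ _ X time).
      apply: (@continuous_compT time R R (fun u => val u)); first exact: val_time_continuous.
      exact: cutoff_continuous.
    case: phiBC => _ [N pN]; exists N => w; rewrite normrM; have /andP[c0 c1] := cutoff01 s n (tauX w).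
    by rewrite (ger0_norm c0); apply: le_trans (pN w.1); rewrite ler_piMl.
  have [Q SQ PQ] := closure_BC (exist _ _ fBC) cP e30.
  have [mQ aQ] := SA _ SQ.
  have dist (P' : PM Om R) : marginal P' ->
      `|Ex (law P') (fun w => cutoff s n (tauX w) * phi w.1) -
        Ex (law P') (fun w => cutoff s n (tauX w) * h w.1)| < e / 3.
    move=> mP'; rewrite -ExB; [|exact: bmeasM..].
    apply: le_lt_trans (Ex_norm _ _) _; first by apply: bmeasB; exact: bmeasM.
    apply: le_lt_trans phih; rewrite -(Ex_marginal mP'); last by apply: bmeas_norm; exact: bmeasB.
    apply: Ex_le.
    - by apply: bmeas_norm; apply: bmeasB; exact: bmeasM.
    - by apply: bmeas_norm; exact: bmeasB.
    - move=> w; rewrite -mulrBr normrM; have /andP[c0 c1] := cutoff01 s n (tauX w).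
      by rewrite (ger0_norm c0) ler_piMl.
  have Q0 : Ex (law Q) (fun w => cutoff s n (tauX w) * h w.1) = 0.
    apply: (@Ex_ortho _ _ _ (law Q) (FtauX t)) => //.
    - exact: FtauX_measurable.
    - by move=> A FA; exact: (orth_FtauX sF mF (SA _ SQ) tT t0 FA bh h0).
    - move=> r; exists (cutoff s n @^-1` `[r, +oo[%classic).
        rewrite -[X in measurable X]setTI.
        by apply: (continuous_measurable_fun (@cutoff_continuous s n)) => //; exact: measurable_itv.
      by apply/seteqP; split => w /=; rewrite in_itv /= andbT -(cutoff_min (tauX w) n0 sn) //; case.
  have := dist P mP; have := dist Q mQ; rewrite Q0 subr0; move: PQ => /=.
  rewrite !ltr_norml ler_norml => /andP[? ?] /andP[? ?] /andP[? ?]; apply/andP; split; lra.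
have c : Ex (law P) (fun w => cutoff s n (tauX w) * h w.1) @[n --> \oo] -->
    Ex (law P) (fun w => \1_(tau_le s) w * h w.1).
  apply: (@Ex_cvg _ _ _ (law P) _ _ M).
  - by move=> n; apply: bmeas_meas; exact: bmeasM.
  - move=> n w; rewrite normrM; have /andP[c0 c1] := cutoff01 s n (tauX w).
    by rewrite (ger0_norm c0); apply: le_trans (hM w.1); rewrite ler_piMl.
  - move=> w; apply: cvgM; last exact: cvg_cst.
    apply/cvgrPdist_lt => e e0; case: (leP (tauX w) s) => ws.
      exists 0%N => // n _; rewrite indicE mem_set// /cutoff (min_idPl _).
        by rewrite (max_idPr ler01) subrr normr0.
      by rewrite lerBrDr gerDl mulr_ge0_le0// subr_le0.
    exists (Num.trunc (tauX w - s)^-1).+1 => // n /= nx.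
    rewrite indicE memNset; last by rewrite /tau_le /= leNgt ws.
    rewrite /cutoff (max_idPl _) ?subrr ?normr0// ge_min subr_le0; apply/orP; right.
    rewrite -ler_pdivrMr ?subr_gt0// div1r; apply: ltW; apply: lt_le_trans (truncnS_gt _) _.
    by rewrite ler_nat.
apply/eqP; rewrite -normr_le0; apply/ler_addgt0Pr => e e0; rewrite add0r.
move/cvgrPdist_lt : c => /(_ _ e0) [N _ HN].
(* Large enough both for the convergence in [c] and for $1/n\le t-s$, which [key] demands. *)
pose n := (N + (Num.trunc (t - s)^-1).+1)%N.
have := HN n (leq_addr _ _); rewrite /= key ?subr0; first exact: ltW.
  by rewrite /n addnS.
rewrite -lerBrDl -[leRHS]invrK lef_pV2 ?posrE ?invr_gt0 ?subr_gt0 ?ltr0n//; last by rewrite /n addnS.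
apply: ltW; apply: lt_le_trans (truncnS_gt _) _; rewrite ler_nat; exact: leq_addl.
Qed.
End closedness.

(** * Interpolation on a time grid *)

Section time_grid.
Context {R : realType} (T : {posnum R}).
Local Notation time := (time T).
Variable n : nat.
Hypothesis n0 : (0 < n)%N.
Definition mesh : R := T%:num / n%:R.
Local Notation h := mesh.
Definition grid (i : nat) : time := clamp_time T (i%:R * h).

Lemma mesh_gt0 : 0 < h. Proof. by rewrite divr_gt0// ltr0n. Qed.

Lemma mesh_n : n%:R * h = T%:num.
Proof. by rewrite /mesh mulrC divfK// gt_eqF// ltr0n. Qed.

Lemma val_grid i : (i <= n)%N -> val (grid i) = i%:R * h.
Proof.
move=> i_n; apply: val_clamp_id; rewrite mulr_ge0 ?(ltW mesh_gt0)//=.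
by rewrite -mesh_n ler_wpM2r ?(ltW mesh_gt0)// ler_nat.
Qed.

Definition interp (g : time -> R) (c : nat -> R) : R :=
  g (grid 0) + \sum_(0 <= i < n) (g (grid i.+1) - g (grid i)) * c i.

(** The staircase has sum $k+\theta$ and interpolates to $(1-\theta)g(t_k)+\theta g(t_{k+1})$. Both
    nodes are within one mesh of the time $r=h(k+\theta)$, which is within two meshes of [s]: one
    error [e] for each passage. *)
Lemma interp_close (g : time -> R) (c : nat -> R) (s : time) (e : R) :
  (forall i, 0 <= c i <= 1) -> (forall i, c i < 1 -> c i.+1 = 0) ->
  (forall s t : time, `|val s - val t| < 2 * h -> `|g s - g t| <= e) ->
  `|val s - h * \sum_(0 <= i < n) c i| < 2 * h ->
  `|g s - interp g c| <= 2 * e.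
Proof.
move=> c01 cd gosc sc.
have h0 := mesh_gt0.
(* Invariant of the induction: either all coefficients so far are 1, or the break has occurred and
   the next coefficient is 0. *)
have key m : (m <= n)%N ->
  (\sum_(0 <= i < m) c i = m%:R /\
     \sum_(0 <= i < m) (g (grid i.+1) - g (grid i)) * c i = g (grid m) - g (grid 0)) \/
  (c m = 0 /\ exists k th, [/\ (k < m)%N, 0 <= th <= 1, \sum_(0 <= i < m) c i = k%:R + th &
     \sum_(0 <= i < m) (g (grid i.+1) - g (grid i)) * c i =
       g (grid k) - g (grid 0) + (g (grid k.+1) - g (grid k)) * th]).
  elim: m => [|m IH] mn; first by left; rewrite !big_geq// subrr.
  rewrite !big_nat_recr//=; case: (IH (ltnW mn)) => [[e1 e2]|[cm0 [k [th [km th01 e1 e2]]]]].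
  - rewrite e1 e2; have /andP[_] := c01 m; rewrite le_eqVlt => /predU1P[cm|cm].
      by left; rewrite cm natr1; split=> //; ring.
    right; split; first exact: cd.
    exists m, (c m); split => //.
  - right; rewrite cm0 mulr0 !addr0 e1 e2; split; first by apply: cd; rewrite cm0 ltr01.
    by exists k, th; split => //; exact: ltnW.
have [k [th [kn th01 e1 e2]]] : exists k th, [/\ (k < n)%N, 0 <= th <= 1, \sum_(0 <= i < n) c i = k%:R + th &
     \sum_(0 <= i < n) (g (grid i.+1) - g (grid i)) * c i =
       g (grid k) - g (grid 0) + (g (grid k.+1) - g (grid k)) * th].
  case: (key n (leqnn n)) => [[e1 e2]|[_ //]].
  (* The full staircase is treated as a break in the last cell with weight 1. *)
  exists n.-1, 1; rewrite prednK// e1 e2; split => //.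
  - by rewrite ler01 lexx.
  - by rewrite natr1 prednK.
  - by ring.
have /andP[th0 th1] := th01.
rewrite e1 in sc; rewrite /interp e2.
have vk := val_grid (ltnW kn); have vk1 := val_grid kn.
pose r := clamp_time T (h * (k%:R + th)).
have vr : val r = h * (k%:R + th).
  apply: val_clamp_id; apply/andP; split.
    by rewrite mulr_ge0 ?addr_ge0// ltW.
  have : k.+1%:R * h <= T%:num by rewrite -mesh_n ler_wpM2r ?(ltW h0)// ler_nat.
  by rewrite -natr1; nra.
have H1 : `|g s - g r| <= e by apply: gosc; rewrite vr.
have H2 : `|g r - g (grid k)| <= e.
  apply: gosc; rewrite vr vk ger0_norm; nra.
have H3 : `|g r - g (grid k.+1)| <= e.
  apply: gosc; rewrite vr vk1 -natr1 ler0_norm; nra.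
have -> : g s - (g (grid 0) + (g (grid k) - g (grid 0) + (g (grid k.+1) - g (grid k)) * th)) =
  (g s - g r) + ((1 - th) * (g r - g (grid k)) + th * (g r - g (grid k.+1))) by ring.
apply: le_trans (ler_normD _ _) _.
have : `|(1 - th) * (g r - g (grid k)) + th * (g r - g (grid k.+1))| <= e.
  apply: le_trans (ler_normD _ _) _; rewrite !normrM (ger0_norm th0) ger0_norm ?subr_ge0//.
  by nra.
by lra.
Qed.

(** If exactly the first k values are true, then $s\le kh$, and, when k is positive, $(k-2)h<s$. The
    spare step in the third hypothesis is what admits indicators delayed by one step. *)
Lemma bool_pattern (b : nat -> bool) (s : time) :
  (forall i, b i.+1 -> b i) ->
  (forall i, (i < n)%N -> ~~ b i -> val s <= i%:R * h) ->
  (forall i, (i < n)%N -> b i -> i%:R * h - h < val s) ->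
  `|val s - h * \sum_(0 <= i < n) (b i)%:R| < 2 * h.
Proof.
move=> bd bF bT; have h0 := mesh_gt0.
have key m : (m <= n)%N ->
  (\sum_(0 <= i < m) (b i)%:R = m%:R :> R /\ (forall i, (i < m)%N -> b i)) \/
  (b m = false /\ exists k, [/\ (k < m)%N, \sum_(0 <= i < m) (b i)%:R = k%:R :> R,
     ~~ b k & forall i, (i < k)%N -> b i]).
  elim: m => [|m IH] mn; first by left; rewrite big_geq.
  rewrite big_nat_recr//=; case: (IH (ltnW mn)) => [[e1 e2]|[bm [k [km e1 bk ek]]]].
    rewrite e1; case bm : (b m).
      left; rewrite natr1; split => // i; rewrite ltnS leq_eqVlt => /predU1P[->//|]; exact: e2.
    right; split; first by apply/negbTE/negP => /bd; rewrite bm.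
    by exists m; rewrite addr0 bm.
  right; split; first by apply/negbTE/negP => /bd; rewrite bm.
  by exists k; rewrite bm addr0; split => //; exact: ltnW.
have /andP[s0 sT] := val_time01 s.
have fin k : (k <= n)%N -> val s <= k%:R * h -> (forall i, (i < k)%N -> b i) ->
    `|val s - h * k%:R| < 2 * h.
  move=> kn sk bk; rewrite mulrC distrC ger0_norm ?subr_ge0//.
  case: k kn sk bk => [|k] kn sk bk; first by rewrite mul0r; lra.
  by have := bT k kn (bk k (ltnSn k)); rewrite -natr1; lra.
case: (key n (leqnn n)) => [[-> e2]|[_ [k [kn -> bk ek]]]].
  by apply: fin => //; rewrite mesh_n.
by apply: fin => //; [exact: ltnW|exact: bF].
Qed.

End time_grid.

Lemma bigcapT_measurable_rat {d} {Y : measurableType d} (A : rat -> set Y) :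
  (forall q, measurable (A q)) -> measurable (\bigcap_q A q).
Proof.
move=> mA; rewrite -[X in measurable X]setCK setC_bigcap; apply: measurableC.
by apply: bigcupT_measurable_rat => q; exact: measurableC.
Qed.

Lemma dist_lt4 {R : realDomainType} (u v w z a b c : R) :
  `|w - u| < a -> `|z - v| < b -> `|w - z| <= c -> `|u - v| < a + c + b.
Proof.
rewrite distrC => h1 h2 h3; apply: le_lt_trans (ler_distD w u v) _.
rewrite -addrA ltrD//; apply: le_lt_trans (ler_distD z w v) _.
by rewrite ler_ltD.
Qed.

(** * Oscillation in time at the scale of the grid *)

Section oscillation.
Context {R : realType} {d} {X : topMeasType d} (T : {posnum R}).
Local Notation time := (time T).
Local Notation Om := (X * time)%type.
Hypothesis gX : cozero_base R X.
Variable f : X -> time -> R.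
Hypothesis fc : forall x, continuous (f x).
Hypothesis fm : forall t, measurable_fun setT (fun x => f x t).

Definition osc_set (dl e : R) : set X :=
  [set x | forall s t : time, `|val s - val t| < dl -> `|f x s - f x t| <= e].

Lemma rat_time (x : X) (s : time) (eta : R) : 0 < eta ->
  exists q : rat, `|ratr q - val s| < eta /\ `|f x (clamp_time T (ratr q)) - f x s| < eta.
Proof.
move=> eta0; pose g r := f x (clamp_time T r).
have cg : continuous g.
  by apply: (@continuous_compT R time R) => //; exact: clamp_time_continuous.
have /cvgrPdist_lt/(_ _ eta0) [e /= e0 eg] := cg (val s).
have m0 : 0 < Num.min e eta by rewrite lt_min e0 eta0.
have [q] := rat_in_itvoo (ltr_pwDr m0 (lexx (val s))); rewrite in_itv /= => /andP[q1 q2].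
have sq : `|ratr q - val s| < Num.min e eta by rewrite ger0_norm ?subr_ge0 ?ltW// ltrBlDl.
exists q; split; first by apply: lt_le_trans sq _; rewrite ge_min lexx orbT.
have e1 : `|g (val s) - g (ratr q)| < eta.
  by apply: eg => /=; rewrite distrC; apply: lt_le_trans sq _; rewrite ge_min lexx.
by move: e1; rewrite /g clamp_timeK distrC.
Qed.

Lemma clamp_time_dist (r r' : R) :
  `|val (clamp_time T r) - val (clamp_time T r')| <= `|r - r'|.
Proof.
rewrite !val_clamp_time; have T0 : 0 < T%:num by [].
move: (T%:num) T0 => Tn T0.
wlog rr : r r' / r' <= r.
  move=> H; case: (leP r' r) => [|/ltW]; first exact: H.
  by rewrite distrC (distrC r); exact: H.
have k (y : R) : Num.min (Num.max y 0) Tn = if y <= 0 then 0 else if y <= Tn then y else Tn.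
  case: (leP y 0) => a; first by rewrite (min_idPl (ltW T0)).
  by case: (leP y Tn) => b //; apply/min_idPl.
rewrite [leRHS]ger0_norm ?subr_ge0// ger0_norm !k ?subr_ge0;
  case: (leP r 0) => a; case: (leP r' 0) => b; case: (leP r Tn) => c; case: (leP r' Tn) => e; lra.
Qed.

(** By continuity, pairs of rational times suffice. Clamping them into the interval does not
    increase distances, and rationals close enough to s and t still differ by less than [dl]. *)
Lemma osc_set_measurable dl e : measurable (osc_set dl e).
Proof.
pose V (q q' : rat) : set X :=
  if `|ratr q - ratr q'| < dl
  then [set x | `|f x (clamp_time T (ratr q)) - f x (clamp_time T (ratr q'))| <= e] else setT.
have -> : osc_set dl e = \bigcap_q \bigcap_q' V q q'.
  apply/seteqP; split => x Ex.
    move=> q _ q' _; rewrite /V; case: ifPn => // qq; apply: Ex.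
    exact: le_lt_trans (clamp_time_dist _ _) qq.
  move=> s t st; apply/ler_addgt0Pr => a a0.
  have a30 : 0 < a / 2 by rewrite divr_gt0.
  have d0 : 0 < (dl - `|val s - val t|) / 2 by rewrite divr_gt0// subr_gt0.
  have m0 : 0 < Num.min (a / 2) ((dl - `|val s - val t|) / 2) by rewrite lt_min a30.
  have [q [q1 q2]] := rat_time x s m0; have [q' [q'1 q'2]] := rat_time x t m0.
  move: q1 q2 q'1 q'2; rewrite !lt_min => /andP[_ q1] /andP[q2 _] /andP[_ q'1] /andP[q'2 _].
  have := Ex q I q' I; rewrite /V ifT => [h|].
    by have := ltW (dist_lt4 q2 q'2 h); rewrite addrAC -splitr addrC.
  rewrite distrC in q1; rewrite distrC in q'1.
  have := dist_lt4 q1 q'1 (lexx _); rewrite addrAC -splitr; lra.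
apply: bigcapT_measurable_rat => q; apply: bigcapT_measurable_rat => q'.
rewrite /V; case: ifPn => // _.
rewrite (_ : [set x | _] = setT `&` (fun x => `|f x (clamp_time T (ratr q)) - f x (clamp_time T (ratr q'))|) @^-1` `]-oo, e]%classic).
  apply: measurableT_comp => //.
  exact: measurable_funB.
by apply/seteqP; split => x /=; rewrite in_itv //= => -[].
Qed.

Lemma mesh_small (r : R) : 0 < r -> exists N, forall n, (N <= n)%N -> 2 * mesh T n.+1 < r.
Proof.
move=> r0; exists (Num.trunc (2 * T%:num / r)) => n Nn.
rewrite /mesh mulrA ltr_pdivrMr ?ltr0n// (mulrC r) -ltr_pdivrMr//.
by apply: lt_le_trans (truncnS_gt _) _; rewrite ler_nat.
Qed.

(** No modulus of continuity need be common to all x; but each time slice is uniformly continuous,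
    so the exceptional sets vanish pointwise and, by dominated convergence, in measure. *)
Lemma osc_set_cvg (rho : probability X R) (e a : R) : 0 < e -> 0 < a ->
  exists N, forall n, (N <= n)%N -> Ex rho (\1_(~` osc_set (2 * mesh T n.+1) e)) < a.
Proof.
move=> e0 a0.
have mE n : measurable (~` osc_set (2 * mesh T n.+1) e) by apply: measurableC; exact: osc_set_measurable.
have c : Ex rho (\1_(~` osc_set (2 * mesh T n.+1) e)) @[n --> \oo] --> Ex rho (fun=> 0).
  apply: (@Ex_cvg _ _ _ rho _ _ 1).
  - by move=> n; exact: measurable_indic.
  - by move=> n x; rewrite indicE; case: (_ \in _); rewrite ?normr1 ?normr0.
  - move=> x; apply/cvgrPdist_lt => b b0.
    have [dl dl0 xdl] := time_unif_continuous (@fc x) e0.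
    have [N HN] := mesh_small dl0.
    exists N => // n /= nN; rewrite indicE memNset ?subrr ?normr0//=.
    by apply; move=> s t st; apply: ltW; apply: xdl; apply: lt_trans st (HN n nN).
move/cvgrPdist_lt : c => /(_ _ a0) [N _ HN]; exists N => n /HN /=.
by rewrite Ex_cst sub0r normrN ger0_norm//; apply: Ex_ge0 => x; rewrite indicE.
Qed.
End oscillation.

Section interpolation.
Context {R : realType} {d} {X : topMeasType d} (T : {posnum R}).
Local Notation time := (time T).
Local Notation Om := (X * time)%type.
Hypothesis gX : cozero_base R X.
Variables (rho : probability X R) (f : BC Om R).

Lemma BC_time_continuous x : continuous (fun t => sval f (x, t)).
Proof.
apply: (@continuous_compT time Om R (fun t => (x, t)) (sval f)).
  by move=> t; apply: (@cvg_pair time X time (nbhs t) (nbhs x) (nbhs t) _ _ _ (fun=> x) id); [exact: cvg_cst|exact: cvg_id].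
by case: (svalP f).
Qed.

Lemma BC_slice_bmeas t : bmeas (fun x => sval f (x, t)).
Proof.
have [mf [M fM]] := BC_bmeas f (Om_cozero_base T gX).
split; last by exists M => x; exact: fM.
apply: (@measurableT_comp _ _ _ X Om R (sval f) setT (fun x => (x, t))) => //.
Qed.

(* The staircase [c] is 1, ..., 1, th, 0, ..., 0, so the sum telescopes to a value of [f (xi, .)]
   interpolated near [s]. *)
Definition interp_bound (n : nat) (e : R) := forall d' (W : measurableType d')
    (P : probability W R) (xi : W -> X) (s : W -> time) (c : nat -> W -> R),
  measurable_fun setT xi -> (forall h, bmeas h -> Ex P (fun w => h (xi w)) = Ex rho h) ->
  measurable_fun setT s -> (forall i, measurable_fun setT (c i)) ->
  (forall i w, 0 <= c i w <= 1) -> (forall i w, c i w < 1 -> c i.+1 w = 0) ->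
  (forall w, `|val (s w) - mesh T n * \sum_(0 <= i < n) c i w| < 2 * mesh T n) ->
  `|Ex P (fun w => sval f (xi w, s w)) -
    (Ex rho (fun x => sval f (x, grid T n 0)) +
     \sum_(0 <= i < n) Ex P (fun w => (sval f (xi w, grid T n i.+1) - sval f (xi w, grid T n i)) * c i w))| <= e.

(** The threshold depends only on [f], [rho] and [e], so one grid serves at once for a given law,
    its randomized limit and its approximations by stopping times. Off the exceptional set the error
    is twice $e/4$; on it the crude oscillation bound $2M$ is used. *)
Lemma interp_Ex (e : R) : 0 < e -> exists N, forall n, (N < n)%N -> interp_bound n e.
Proof.
move=> e0; have [cf [M fM]] := svalP f.
have M0 : 0 <= M by exact: le_trans (fM point).
have e40 : 0 < e / 4 by rewrite divr_gt0.
(* The exceptional set contributes at most $4M\cdot e/(8(M+1))\le e/2$. *)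
have a0 : 0 < e / (8 * (M + 1)) by rewrite divr_gt0// mulr_gt0//; lra.
have [N hN] := @osc_set_cvg R d X T (fun x t => sval f (x, t)) BC_time_continuous (fun t => bmeas_meas (BC_slice_bmeas t)) rho _ _ e40 a0.
exists N => -[//|n] /hN; set E := osc_set _ _ _ => hn.
have mE : measurable E.
  apply: osc_set_measurable; first exact: BC_time_continuous.
  by move=> t; exact: bmeas_meas (BC_slice_bmeas t).
move=> d' W P xi s c mxi xirho ms mc c01 cd sc.
have bE : bmeas (\1_(~` E) : X -> R) by apply: bmeas_indic; exact: measurableC.
have bc i : bmeas (c i) by exact: bmeas01.
have bslice t : bmeas (fun w => sval f (xi w, t)).
  exact: (bmeas_comp mxi (BC_slice_bmeas t)).
have bfs : bmeas (fun w => sval f (xi w, s w)).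
  apply: (@bmeas_comp _ W R _ Om (fun w => (xi w, s w)) (sval f)).
    exact: measurable_fun_pair.
  exact: (BC_bmeas f (Om_cozero_base T gX)).
have bterm i : bmeas (fun w => (sval f (xi w, grid T n.+1 i.+1) - sval f (xi w, grid T n.+1 i)) * c i w).
  by apply: bmeasM => //; exact: bmeasB.
have binterp : bmeas (fun w => interp n.+1 (fun t => sval f (xi w, t)) (c ^~ w)).
  by apply: bmeasD => //; exact: bmeas_sum.
rewrite -(xirho _ (BC_slice_bmeas (grid T n.+1 0))) -Ex_sum// -ExD//; last exact: bmeas_sum.
rewrite -ExB//; apply: le_trans (Ex_norm _ _) _; first exact: bmeasB.
have bE' : bmeas (fun w => \1_(~` E) (xi w) : R) by exact: (bmeas_comp mxi bE).
apply: (@le_trans _ _ (Ex P (fun w => e / 2 + 4 * M * \1_(~` E) (xi w)))).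
  apply: Ex_le.
  - by apply: bmeas_norm; exact: bmeasB.
  - by apply: bmeasD; [exact: bmeas_cst|exact: bmeasZ].
  move=> w; rewrite indicE in_setC.
  have n0 : (0 < n.+1)%N by [].
  case: (boolP (xi w \in E)) => xE /=.
    have := @interp_close R T n.+1 n0 (fun t => sval f (xi w, t)) (c ^~ w) (s w) (e / 4)
      (c01^~ w) (cd^~ w) (set_mem xE) (sc w).
    rewrite /interp mulr0 addr0 => /le_trans; apply; lra.
  have osc (t t' : time) : `|val t - val t'| < 2 * mesh T n.+1 -> `|sval f (xi w, t) - sval f (xi w, t')| <= 2 * M.
    move=> _; apply: le_trans (ler_normB _ _) _.
    by have := fM (xi w, t); have := fM (xi w, t'); lra.
  have := @interp_close R T n.+1 n0 (fun t => sval f (xi w, t)) (c ^~ w) (s w) (2 * M)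
      (c01^~ w) (cd^~ w) osc (sc w).
  rewrite /interp mulr1 => /le_trans; apply; lra.
rewrite ExD ?Ex_cst ?ExZ//; [|exact: bmeas_cst|exact: bmeasZ].
rewrite xirho//.
have h1 : 4 * M * Ex rho \1_(~` E) <= 4 * M * (e / (8 * (M + 1))).
  by rewrite ler_wpM2l ?mulr_ge0//; exact: ltW.
have h2 : 4 * M * (e / (8 * (M + 1))) <= e / 2.
  have -> : e / 2 = 4 * (M + 1) * (e / (8 * (M + 1))) by field; lra.
  by rewrite ler_wpM2r ?(ltW a0)//; lra.
lra.
Qed.
End interpolation.

(** * Compactness *)

Section product_probability.
Context {d1 d2} {X : measurableType d1} {Y : measurableType d2} {R : realType}.
Variables (P : probability X R) (Q : probability Y R).

Definition product_probability : set (X * Y) -> \bar R := (P \x Q)%E.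
HB.instance Definition _ := Measure.on product_probability.

Lemma product_probabilityX (A : set X) (B : set Y) : measurable A -> measurable B ->
  product_probability (A `*` B) = (P A * Q B)%E.
Proof. by move=> mA mB; rewrite /product_probability product_measure1E. Qed.

Lemma product_probability_setT : product_probability setT = 1%E.
Proof.
rewrite -setXTT product_probabilityX//.
by rewrite (@probability_setT _ _ _ P) (@probability_setT _ _ _ Q) mule1.
Qed.

HB.instance Definition _ :=
  @Measure_isProbability.Build _ _ R product_probability product_probability_setT.
End product_probability.

Section randomization.
Context {d} {X : measurableType d} {R : realType} (rho : probability X R).
Local Notation unif := (uniform_prob (@ltr01 R)).

Lemma uniform_gt (p : R) : 0 <= p <= 1 -> unif `]p, +oo[%classic = (1 - p)%:E.
Proof.
move=> /andP[p0 p1]; rewrite /uniform_prob integral_uniform_pdf.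
rewrite (_ : _ `&` _ = `]p, 1]%classic); last first.
  apply/seteqP; split => x /=; rewrite !in_itv /= ?andbT.
    by move=> [-> /andP[_ ->]].
  by move=> /andP[px ->]; rewrite px (le_trans p0 (ltW px)).
rewrite (eq_integral (fun=> 1%:E)); last first.
  move=> x; rewrite inE /= in_itv /= /uniform_pdf => /andP[px ->].
  by rewrite (le_trans p0 (ltW px)) subr0 invr1.
rewrite integral_cst//= lebesgue_measure_itv/= lte_fin mul1e.
by case: (ltP p 1) => // p1'; rewrite (@le_anti _ _ p 1) ?p1 ?p1'// subrr.
Qed.

Lemma below_measurable (p : X -> R) : measurable_fun setT p ->
  measurable [set w : X * measurableTypeR R | p w.1 < w.2].
Proof.
move=> mp; have : measurable_fun setT (fun w : X * measurableTypeR R => (w.2 : R) - p w.1).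
  apply: measurable_funB; first exact: measurable_snd.
  by apply: measurableT_comp => //; exact: measurable_fst.
move=> /(_ measurableT _ (measurable_itv `]0, +oo[)); congr measurable.
by apply/seteqP; split => w /=; rewrite in_itv /= andbT subr_gt0 //; case.
Qed.

Lemma randomization_marginal S : measurable S -> product_probability rho unif (S `*` setT) = rho S.
Proof. by move=> mS; rewrite /= product_probabilityX// (@probability_setT _ _ _ unif) mule1. Qed.

(** The section of $\{p(x)<u\}$ at x has uniform measure $1-p(x)$, so $1-p$ is the density of this
    event over [rho]. *)
Lemma randomization_Ex (p psi : X -> R) : measurable_fun setT p -> (forall x, 0 <= p x <= 1) ->
  bmeas psi ->
  Ex (product_probability rho unif) (fun w => psi w.1 * \1_[set w : X * measurableTypeR R | p w.1 < w.2] w) =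
  Ex rho (fun x => psi x * (1 - p x)).
Proof.
move=> mp p01 bpsi; have bp : bmeas p by exact: bmeas01.
set E := [set w : X * measurableTypeR R | _].
have mE : measurable E by exact: below_measurable.
have bq : bmeas (fun x => 1 - p x) by apply: bmeasB => //; exact: bmeas_cst.
rewrite -(@density_Ex _ _ _ _ R rho (product_probability rho unif) _ E (fun x => 1 - p x)) //.
- by congr Ex; apply: funext => w; rewrite mulrC.
- exact: randomization_marginal.
- move=> S mS; have mSE : measurable (E `&` (S `*` setT)) by apply: measurableI => //; exact: measurableX.
  rewrite [X in Ex _ X](_ : _ = \1_(E `&` (S `*` setT))); last first.
    apply: funext => w; rewrite indicI; congr (_ * _); rewrite !indicE.
    by congr (_ %:R); congr nat_of_bool; apply/idP/idP; rewrite !inE /=; [|case].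
  rewrite Ex_indic//; apply: EFin_inj; rewrite fineP// Ex_EFin; last first.
    by apply: bmeasM => //; exact: bmeas_indic.
  rewrite /= /product_probability /product_measure1; apply: eq_integral => x _ /=.
  rewrite indicE; case: (boolP (x \in S)) => xS; rewrite ?mul1r ?mul0r.
    rewrite -(uniform_gt (p01 x)); congr (unif _); apply/seteqP; split => u.
      by rewrite /xsection /= inE /= in_itv /= andbT => -[].
    by rewrite /xsection /= inE /= in_itv /= andbT; split => //; split => //; exact: set_mem.
  rewrite (_ : xsection _ _ = set0) ?measure0//; apply/seteqP; split => u //.
  by rewrite /xsection /= inE /= => -[_ [/mem_set]]; rewrite (negbTE xS).
Qed.
End randomization.

Lemma clamp_time_measurable {R : realType} (T : {posnum R}) :
  measurable_fun setT (clamp_time T : R -> time T).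
Proof.
apply: (@measurability _ _ _ _ _ _ open) => //.
move=> _ [U oU <-]; rewrite setTI; apply: open_measurable.
by move/continuousP : (@clamp_time_continuous R T); exact.
Qed.

(* For a nondecreasing family [p q] of functions with values in [0,1], the random time
   [sup {q T | p q x < u}] has conditional distribution function [p] given [x] when [u] is uniform. *)
Section quantile_time.
Context {R : realType} {d} {X : measurableType d} (T : {posnum R}) (p : rat -> X -> R).
Hypothesis mp : forall q, measurable_fun setT (p q).
Hypothesis p_nd : forall q q' x, q <= q' -> p q x <= p q' x.
Local Notation W := (X * measurableTypeR R)%type.

(** The candidates of the supremum, enumerated by codes. Inadmissible codes contribute 0, which
    leaves a supremum of nonnegative numbers unchanged and gives the value 0 when no rational
    qualifies. *)
Let g (n : nat) (w : W) : R :=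
  if unpickle n is Some q then
    if [&& (0 <= q :> rat), q <= 1 & p q w.1 < w.2] then ratr q * T%:num else 0
  else 0.

Definition quantile_time (w : W) : time T := clamp_time T (sups (g ^~ w) 0).

Let g_ub w : has_ubound (range (g ^~ w)).
Proof.
exists T%:num => _ [n _ <-]; rewrite /g; case: unpickle => [q|]//.
by case: ifPn => // /and3P[q0 q1 _]; rewrite ler_piMl// -(rmorph1 (@ratr R)) ler_rat.
Qed.

Let g_measurable n : measurable_fun setT (g n).
Proof.
rewrite /g; case: unpickle => [q|]; last exact: measurable_cst.
apply: measurable_fun_if => //.
apply: measurable_and; first exact: measurable_cst.
apply: measurable_and; first exact: measurable_cst.
apply: measurable_fun_ltr; last exact: measurable_snd.
by apply: measurableT_comp => //; exact: measurable_fst.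
Qed.

Lemma quantile_time_measurable : measurable_fun setT quantile_time.
Proof.
apply: (@measurableT_comp _ _ _ _ _ _ (clamp_time T)); first exact: clamp_time_measurable.
by apply: measurable_fun_sups => // t _; exact: g_ub.
Qed.

Lemma quantile_time_ge (q : rat) w : 0 <= q -> q <= 1 -> p q w.1 < w.2 ->
  ratr q * T%:num <= val (quantile_time w).
Proof.
move=> q0 q1 pw; rewrite val_clamp_time le_min le_max.
apply/andP; split; last by rewrite ler_piMl// -(rmorph1 (@ratr R)) ler_rat.
apply/orP; left; apply: ub_le_sup.
  by have [M hM] := g_ub w; exists M => _ [n _ <-]; apply: hM; exists n.
by exists (pickle q) => //; rewrite /g pickleK q0 q1 pw.
Qed.

Lemma quantile_time_le (q : rat) w : 0 <= q -> ~~ (p q w.1 < w.2) ->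
  val (quantile_time w) <= ratr q * T%:num.
Proof.
move=> q0 pw; rewrite val_clamp_time ge_min ge_max; apply/orP; left.
have qT : 0 <= ratr q * T%:num :> R by rewrite mulr_ge0 ?ler0q.
rewrite qT andbT; apply: ge_sup; first by exists (g 0%N w), 0%N.
move=> _ [n _ <-]; rewrite /g; case: unpickle => [q'|]//.
case: ifPn => // /and3P[q'0 q'1 pw']; rewrite ler_wpM2r// ler_rat leNgt.
apply: contra pw => qq'; apply: le_lt_trans pw'; apply: p_nd; exact: ltW.
Qed.
End quantile_time.

Lemma ultra_bounded_cvg {R : realType} (S : Type) (F : set_system S) (phi : S -> R) (M : R) :
  UltraFilter F -> (forall s, `|phi s| <= M) -> cvg (phi s @[s --> F]).
Proof.
move=> UF pM; have := @segment_compact R (- M) M.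
move=> /(_ (phi s @[s --> F]) _) [].
  change (F (phi @^-1` `[- M, M]%classic)).
  suff -> : phi @^-1` `[- M, M]%classic = setT by exact: filterT.
  by apply/seteqP; split => s //= _; rewrite in_itv /= -ler_norml.
move=> l [_ cl]; apply/cvg_ex; exists l => V nV.
have [//|FnV] := in_ultra_setVsetC (phi @^-1` V) UF.
by have [r [nr Vr]] := cl (~` V) V FnV nV.
Qed.

(** * Limits of expectations along an ultrafilter *)

Section ultralimit.
Context {R : realType} {d} {X : topMeasType d} (T : {posnum R}) (rho : probability X R).
Local Notation Om := (X * time T)%type.
Variable U : set_system (PM Om R).
Hypothesis UU : UltraFilter U.
Hypothesis Um : U (marginal rho).

(** On bounded measurable functions this limit exists and is a positive normalized linear
    functional, a priori without countable additivity. *)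
Definition ulim (g : Om -> R) : R := lim ((fun P => Ex (law P) g) @ U).

Lemma ulim_cvg g : bmeas g -> (fun P => Ex (law P) g) @ U --> ulim g.
Proof.
move=> bg; have [_ [M gM]] := bg.
apply: (@ultra_bounded_cvg _ _ _ _ M) => P.
apply: le_trans (Ex_norm _ bg) _; apply: Ex_bound gM; exact: bmeas_norm.
Qed.

Lemma ulim_eq g l : (fun P => Ex (law P) g) @ U --> l -> ulim g = l.
Proof. by move=> h; exact: cvg_lim. Qed.

Lemma ulimD f g : bmeas f -> bmeas g -> ulim (fun w => f w + g w) = ulim f + ulim g.
Proof.
move=> bf bg; apply: ulim_eq.
rewrite (_ : (fun P => _) = fun P => Ex (law P) f + Ex (law P) g); last by apply: funext => P; rewrite ExD.
by apply: cvgD; exact: ulim_cvg.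
Qed.

Lemma ulimZ c g : bmeas g -> ulim (fun w => c * g w) = c * ulim g.
Proof.
move=> bg; apply: ulim_eq.
rewrite (_ : (fun P => _) = fun P => c * Ex (law P) g); last by apply: funext => P; rewrite ExZ.
by apply: cvgMr; exact: ulim_cvg.
Qed.

Lemma ulim_le f g : bmeas f -> bmeas g -> (forall w, f w <= g w) -> ulim f <= ulim g.
Proof.
move=> bf bg fg; apply: (ler_cvg_to (ulim_cvg bf) (ulim_cvg bg)).
have : U setT by exact: filterT.
by apply: filterS => P _; exact: Ex_le.
Qed.

Lemma ulim_cst c : ulim (fun=> c) = c.
Proof.
apply: ulim_eq; rewrite (_ : (fun P => _) = fun=> c); first exact: cvg_cst.
by apply: funext => P; rewrite Ex_cst.
Qed.

Lemma ulim_sum (I : Type) (s : seq I) (f : I -> Om -> R) : (forall i, bmeas (f i)) ->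
  ulim (fun w => \sum_(i <- s) f i w) = \sum_(i <- s) ulim (f i).
Proof.
move=> bf; elim: s => [|i s IH].
  by under [X in ulim X]funext do rewrite big_nil; rewrite big_nil ulim_cst.
under [X in ulim X]funext do rewrite big_cons.
by rewrite big_cons ulimD ?IH//; exact: bmeas_sum.
Qed.

Lemma ulim_norm g M : bmeas g -> (forall w, `|g w| <= M) -> `|ulim g| <= M.
Proof.
move=> bg gM; have bM c : bmeas (fun _ : Om => c) by exact: bmeas_cst.
rewrite ler_norml -[X in _ <= _ <= X]ulim_cst -[X in X <= _]ulim_cst !ulim_le// => w;
  by have := gM w; rewrite ler_norml => /andP[].
Qed.

Lemma ulim_fst psi : bmeas psi -> ulim (fun w => psi w.1) = Ex rho psi.
Proof.
move=> bpsi; apply: ulim_eq => V nV.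
change (U ((fun P => Ex (law P) (fun w : Om => psi w.1)) @^-1` V)).
apply: filterS Um => P mP /=; rewrite (_ : Ex _ _ = Ex rho psi); last exact: (Ex_marginal mP).
exact: nbhs_singleton.
Qed.

Let bfst (psi : X -> R) : bmeas psi -> bmeas (fun w : Om => psi w.1).
Proof. exact: (bmeas_comp measurable_fst). Qed.

(** On functions of x alone the limit functional is integration under [rho], so the set function
    $S\mapsto\mathrm{ulim}(1_S1_A)$ is dominated by [rho] and has a density despite being only
    finitely additive. Both sides are then norm-bounded linear functionals agreeing on
    indicators. *)
Lemma ulim_density (A : set Om) : measurable A -> exists p : X -> R,
  [/\ measurable_fun setT p, forall x, 0 <= p x <= 1 &
      forall psi, bmeas psi -> ulim (fun w => psi w.1 * \1_A w) = Ex rho (fun x => psi x * p x)].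
Proof.
move=> mA; have bA := @bmeas_indic _ _ R _ mA.
have A01 w : 0 <= (\1_A w : R) <= 1 by rewrite indicE; case: (_ \in _); rewrite ?lexx ?ler01.
have bSA S : measurable S -> bmeas (fun w => \1_S w.1 * \1_A w : R).
  by move=> mS; apply: bmeasM => //; apply: bfst; exact: bmeas_indic.
have SA0 S w : 0 <= \1_S w.1 * \1_A w :> R by rewrite mulr_ge0// indicE.
have ulim_ge0 f : bmeas f -> (forall w, 0 <= f w) -> 0 <= ulim f.
  by move=> bf f0; rewrite -[leLHS]ulim_cst; apply: ulim_le => //; exact: bmeas_cst.
(* The value 0 off the measurable sets secures nonnegativity on every set, as [radon_nikodym_sub]
   asks. *)
pose n S := if `[< measurable S >] then ulim (fun w => \1_S w.1 * \1_A w) else 0.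
have [] := @radon_nikodym_sub _ X R rho measurable n (sigma_algebra_measurable _) (fun _ => id).
- by move=> S; rewrite /n; case: asboolP => // mS; apply: ulim_ge0 => //; exact: bSA.
- move=> S mS; rewrite /n asboolT// -Ex_indic// -ulim_fst; last exact: bmeas_indic.
  apply: ulim_le; [exact: bSA|by apply: bfst; exact: bmeas_indic|].
  by move=> w; have /andP[a0 a1] := A01 w; rewrite ler_piMr// indicE.
- move=> S S' mS mS' SS'; rewrite /n !asboolT//; last exact: measurableU.
  rewrite -ulimD; [|exact: bSA..]; congr ulim; apply: funext => w.
  rewrite -mulrDl; congr (_ * _); rewrite !indicE in_setU.
  case: (boolP (w.1 \in S)) => wS; case: (boolP (w.1 \in S')) => wS'; rewrite /= ?addr0 ?add0r//.
  move: SS'; rewrite disj_set2E => /eqP/seteqP[/(_ w.1) []]; split; exact: set_mem.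
move=> p [mp p01 pE]; exists p.
have mp' : measurable_fun setT p by move=> _ V mV; rewrite setTI; exact: mp.
have bp : bmeas p by exact: bmeas01.
split => // psi bpsi; apply/eqP; rewrite -subr_eq0; apply/eqP.
have bA' (psi' : X -> R) : bmeas psi' -> bmeas (fun w : Om => psi' w.1 * \1_A w).
  by move=> b; apply: bmeasM => //; exact: bfst.
(* The constant 2 is 1 for the limit functional plus 1 for the integral. *)
apply: (@functional_eq0 _ X R measurable
  (fun psi => ulim (fun w => psi w.1 * \1_A w) - Ex rho (fun x => psi x * p x)) 2) => //.
- move=> f g bf bg; rewrite [X in ulim X](_ : _ = fun w => f w.1 * \1_A w + g w.1 * \1_A w); last first.
    by apply: funext => w; rewrite mulrDl.
  rewrite ulimD; [|exact: bA'..].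
  rewrite [X in Ex rho X](_ : _ = fun x => f x * p x + g x * p x); last first.
    by apply: funext => w; rewrite mulrDl.
  by rewrite ExD; [ring|exact: bmeasM..].
- move=> c f bf; rewrite [X in ulim X](_ : _ = fun w => c * (f w.1 * \1_A w)); last first.
    by apply: funext => w; rewrite mulrA.
  rewrite ulimZ; last exact: bA'.
  rewrite [X in Ex rho X](_ : _ = fun x => c * (f x * p x)); last first.
    by apply: funext => w; rewrite mulrA.
  by rewrite ExZ; [ring|exact: bmeasM].
- move=> f M bf fM; have M0 : 0 <= M by exact: le_trans (fM point).
  apply: le_trans (ler_normB _ _) _; rewrite mulr_natl mulr2n lerD//.
    apply: ulim_norm; first exact: bA'.
    by move=> w; rewrite normrM -[leRHS]mulr1 ler_pM//; have /andP[a0 a1] := A01 w; rewrite ger0_norm.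
  apply: le_trans (Ex_norm _ _) _; first exact: bmeasM.
  apply: Ex_bound; first by apply: bmeas_norm; exact: bmeasM.
  by move=> x; rewrite normrM -[leRHS]mulr1 ler_pM//; have /andP[a0 a1] := p01 x; rewrite ger0_norm.
- by move=> S mS; rewrite -pE// /n asboolT// subrr.
by move=> r; rewrite (_ : [set x | _] = setT `&` psi @^-1` `[r, +oo[%classic);
  [case: bpsi => mpsi _; apply: mpsi|apply/seteqP; split => x /=; rewrite in_itv /= andbT //; case].
Qed.
End ultralimit.

Lemma bigcup_unpickle {Y : Type} {C : countType} (A : option C -> set Y) c :
  A (Some c) `<=` \bigcup_n A (unpickle n).
Proof. by move=> y Ay; exists (pickle c); rewrite // pickleK. Qed.

Section ultralimit_cdf.
Context {R : realType} {d} {X : topMeasType d} (T : {posnum R}) (rho : probability X R).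
Local Notation Om := (X * time T)%type.
Variable U : set_system (PM Om R).
Hypothesis UU : UltraFilter U.
Hypothesis Um : U (marginal rho).

(** For each pair of rationals the densities are ordered only almost surely. Countably many pairs
    leave one null set [B], on which all densities are replaced by 0, so that order holds
    everywhere. *)
Lemma ulim_cdf : exists p : rat -> X -> R,
  [/\ forall q, measurable_fun setT (p q), forall q x, 0 <= p q x <= 1,
      forall q q' x, q <= q' -> p q x <= p q' x &
      forall q psi, bmeas psi ->
        ulim U (fun w => psi w.1 * \1_(tau_le (ratr q * T%:num)) w) = Ex rho (fun x => psi x * p q x)].
Proof.
have tm q : measurable (@tau_le R d X T (ratr q * T%:num)) by exact: tau_le_measurable.
have [p0 p0P] := choice (fun q : rat => ulim_density UU Um (tm q)).
have mp0 q : measurable_fun setT (p0 q) by case: (p0P q).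
have p001 q x : 0 <= p0 q x <= 1 by case: (p0P q).
have p0E q psi : bmeas psi ->
  ulim U (fun w => psi w.1 * \1_(tau_le (ratr q * T%:num)) w) = Ex rho (fun x => psi x * p0 q x).
  by case: (p0P q) => _ _; exact.
have bp0 q : bmeas (p0 q) by exact: bmeas01.
pose N (q q' : rat) := [set x | p0 q' x < p0 q x].
have mN q q' : measurable (N q q').
  have := measurable_funB (mp0 q) (mp0 q').
  move=> /(_ measurableT _ (measurable_itv `]0, +oo[)); congr measurable.
  by apply/seteqP; split => w /=; rewrite in_itv /= andbT subr_gt0 //; case.
have N0 q q' : q <= q' -> rho.-negligible (N q q').
  move=> qq'; pose f x := \1_(N q q') x * (p0 q x - p0 q' x).
  have bN := @bmeas_indic _ _ R _ (mN q q').
  have bf : bmeas f by apply: bmeasM => //; exact: bmeasB.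
  have f0 x : 0 <= f x.
    rewrite /f indicE; case: (boolP (_ \in _)); rewrite ?mul0r// inE mul1r /N /= subr_ge0.
    exact: ltW.
  have : Ex rho f <= 0.
    rewrite (_ : f = fun x => \1_(N q q') x * p0 q x - \1_(N q q') x * p0 q' x); last first.
      by apply: funext => x; rewrite /f mulrBr.
    rewrite ExB; [|exact: bmeasM..]; rewrite -!p0E// subr_le0.
    have bt s : bmeas (fun w : Om => \1_(N q q') w.1 * \1_(@tau_le R d X T s) w : R).
      apply: bmeasM; first exact: (bmeas_comp measurable_fst bN).
      by apply: bmeas_indic; exact: tau_le_measurable.
    apply: ulim_le => // w; rewrite ler_wpM2l ?indicE//.
    case: (boolP (w \in tau_le _)) => // wq; rewrite mem_set//=.
    move: wq; rewrite inE /tau_le /= => /le_trans; apply; rewrite ler_wpM2r// ler_rat//.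
  move=> Ef; have Ef0 : (\int[rho]_x `|(f x)%:E|)%E = 0%E.
    under eq_integral do rewrite gee0_abs ?lee_fin//.
    by rewrite -Ex_EFin//; congr EFin; apply: le_anti; rewrite Ef Ex_ge0.
  have [mf _] := bf; have mf' : measurable_fun setT (EFin \o f) by exact/measurable_EFinP.
  have /(ae_eq_integral_abs rho measurableT mf') := Ef0.
  apply: negligibleS => x Nx /= /(_ I) /eqP; rewrite /f /= indicE mem_set// mul1r eqe subr_eq0.
  by move=> /eqP E; move: Nx; rewrite /N /= E ltxx.
pose N' (z : option (rat * rat)) :=
  if z is Some z then if z.1 <= z.2 then N z.1 z.2 else set0 else set0.
pose B := \bigcup_n N' (unpickle n).
have N'P z : measurable (N' z) /\ rho.-negligible (N' z).
  case: z => [z|]; last by split; [exact: measurable0|exact: negligible_set0].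
  by rewrite /N'; case: ifP => [/N0|_]; split => //; exact: negligible_set0.
have mB : measurable B by apply: bigcupT_measurable => n; case: (N'P (unpickle n)).
have B0 : rho.-negligible B by apply: negligible_bigcup => n; case: (N'P (unpickle n)).
have BP q q' x : q <= q' -> ~ B x -> p0 q x <= p0 q' x.
  move=> qq' Bx; rewrite leNgt; apply/negP => pp; apply: Bx.
  by apply: (@bigcup_unpickle _ (rat * rat)%type N' (q, q')); rewrite /N' /= qq'.
have bB := @bmeas_indic _ _ R _ mB.
exists (fun q x => (1 - \1_B x) * p0 q x); split.
- by move=> q; apply: bmeas_meas; apply: bmeasM => //; apply: bmeasB => //; exact: bmeas_cst.
- move=> q x; rewrite indicE; case: (_ \in _); first by rewrite subrr mul0r lexx ler01.
  by rewrite subr0 mul1r.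
- move=> q q' x qq'; rewrite indicE; case: (boolP (_ \in _)); first by rewrite subrr !mul0r.
  by rewrite notin_setE subr0 !mul1r; exact: BP.
move=> q psi bpsi; rewrite p0E//.
have /= := @Ex_null _ _ _ rho \1_B (fun x => psi x * p0 q x) bB (bmeasM bpsi (bp0 q)).
rewrite Ex_indic// => E; rewrite -[LHS]subr0 -{1}E.
- rewrite -ExB; [|exact: bmeasM|by apply: bmeasM => //; exact: bmeasM].
  by congr Ex; apply: funext => x; ring.
- by move=> x; rewrite indicE.
- by move/(negligibleP rho mB) : B0 => ->.
Qed.
End ultralimit_cdf.

Section compactness.
Context {R : realType} {d} {X : topMeasType d} (T : {posnum R}).
Variables (F : R -> set (set X)) (rho : probability X R).
Hypothesis gX : cozero_base R X.
Hypothesis sF : forall t, sigma_algebra setT (F t).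
Hypothesis mF : forall t S, F t S -> measurable S.
Local Notation Om := (X * time T)%type.
Local Notation unif := (uniform_prob (@ltr01 R)).

Lemma grid_rat n i : (0 < n)%N -> ratr (i%:R / n%:R : rat) * T%:num = i%:R * mesh T n :> R.
Proof. by move=> n0; rewrite rmorphM fmorphV !rmorph_nat /mesh mulrAC mulrA. Qed.

(** On a fine grid the expectation of a test function is nearly a finite sum linear in the events
    $\{\tau>t_i\}$. Their densities converge along [U] to $1-p$, and these are exactly the densities
    of the corresponding events $\{p<u\}$ for the randomized time, so the two sums agree in the
    limit. *)
Lemma ultra_marginal_cvg (U : set_system (PM Om R)) : UltraFilter U -> U (marginal rho) ->
  exists Q : PM Om R, U --> Q.
Proof.
move=> UU Um; have [p [mp p01 p_nd pE]] := ulim_cdf UU Um.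
pose s := quantile_time T p.
have ms : measurable_fun setT s by exact: quantile_time_measurable.
pose P' := product_probability rho unif.
pose W := (X * measurableTypeR R)%type.
have mxs : measurable_fun setT (fun w : W => (w.1, s w) : Om).
  by apply: measurable_fun_pair => //; exact: measurable_fst.
have [Q [_ QE]] := push_ex P' mxs.
exists (Q : PM Om R); apply: (PM_cvgP (P := (Q : PM Om R))) => f.
have bf := BC_bmeas f (Om_cozero_base T gX).
apply/cvgrPdist_lt => e e0; have e40 : 0 < e / 4 by rewrite divr_gt0.
have [N /(_ N.+1 (ltnSn N))] := interp_Ex gX rho f e40.
set n := N.+1 => hn; have n0 : (0 < n)%N by [].
pose qn (i : nat) : rat := i%:R / n%:R.
have qn_le i : qn i <= qn i.+1 by rewrite ler_wpM2r ?invr_ge0// ler_nat.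
pose D i (x : X) := sval f (x, grid T n i.+1) - sval f (x, grid T n i).
have bD i : bmeas (D i) by apply: bmeasB; exact: (BC_slice_bmeas gX f).
pose cst0 := Ex rho (fun x => sval f (x, grid T n 0)).
have HQ : `|Ex Q (sval f) - (cst0 + \sum_(0 <= i < n) Ex rho (fun x => D i x * (1 - p (qn i) x)))| <= e / 4.
  rewrite QE//.
  pose c (i : nat) (w : W) : R := \1_[set w : W | p (qn i) w.1 < w.2] w.
  have cE i w : c i w = (p (qn i) w.1 < w.2)%R%:R by rewrite /c indicE mem_setE.
  have mE i : measurable [set w : W | p (qn i) w.1 < w.2] by exact: below_measurable.
  under eq_bigr do rewrite -randomization_Ex//.
  apply: (hn _ W P' fst s c) => //.
  - by move=> h bh; apply: Ex_marginal bh; exact: randomization_marginal.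
  - by move=> i; exact: measurable_indic.
  - by move=> i w; rewrite cE; case: (_ < _); rewrite ?lexx ?ler01.
  - move=> i w; rewrite !cE; case: (ltP (p (qn i) w.1) w.2) => [_|h _]; first by rewrite ltxx.
    by rewrite ltNge (le_trans h)// p_nd.
  - move=> w; under eq_bigr do rewrite cE.
    apply: bool_pattern => // i.
    + by apply: le_lt_trans; exact: p_nd.
    + by move=> ni h; rewrite -(grid_rat i n0); apply: quantile_time_le => //; rewrite divr_ge0.
    + move=> ni h; have := @quantile_time_ge _ _ _ T p (qn i) w.
      rewrite divr_ge0// ler_pdivrMr ?ltr0n// mul1r ler_nat (ltnW ni) h grid_rat// => /(_ isT isT isT).
      by apply: lt_le_trans; rewrite ltrBlDr ltrDl mesh_gt0.
pose c (i : nat) (w : Om) : R := 1 - \1_(tau_le (ratr (qn i) * T%:num)) w.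
have cE i w : c i w = (~~ (tauX w <= ratr (qn i) * T%:num))%:R.
  rewrite /c indicE; have -> : (w \in tau_le (ratr (qn i) * T%:num)) = (tauX w <= ratr (qn i) * T%:num).
    by apply/idP/idP; rewrite inE.
  by case: (_ <= _); rewrite /= ?subrr ?subr0.
have bc i : bmeas (c i).
  by apply: bmeasB; [exact: bmeas_cst|apply: bmeas_indic; exact: tau_le_measurable].
have HP P : marginal rho P -> `|Ex (law P) (sval f) - (cst0 + \sum_(0 <= i < n) Ex (law P) (fun w => D i w.1 * c i w))| <= e / 4.
  move=> mP.
  rewrite (_ : Ex (law P) (sval f) = Ex (law P) (fun w => sval f (w.1, w.2))); last first.
    by congr Ex; apply: funext => -[].
  apply: (hn _ _ (law P) fst snd c) => //.
  - by move=> h bh; apply: Ex_marginal bh; exact: mP.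
  - by move=> i; exact: bmeas_meas.
  - by move=> i w; rewrite cE; case: (~~ _); rewrite ?lexx ?ler01.
  - move=> i w; rewrite !cE; case: (boolP (tauX w <= ratr (qn i) * T%:num)) => [h _|_]; last by rewrite ltxx.
    by rewrite (le_trans h)// ler_wpM2r// ler_rat.
  - move=> w; under eq_bigr do rewrite cE.
    apply: bool_pattern => // i.
    + by apply: contra => h; rewrite (le_trans h)// ler_wpM2r// ler_rat.
    + by move=> ni; rewrite negbK grid_rat.
    + move=> ni; rewrite -ltNge grid_rat//; apply: lt_trans; rewrite ltrBlDr ltrDl mesh_gt0//.
pose g (w : Om) := \sum_(0 <= i < n) D i w.1 * c i w.
have bDf i : bmeas (fun w : Om => D i w.1) by exact: (bmeas_comp measurable_fst).
have bDc i : bmeas (fun w : Om => D i w.1 * c i w) by exact: bmeasM.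
have bg : bmeas g by exact: bmeas_sum.
have ug : ulim U g = \sum_(0 <= i < n) Ex rho (fun x => D i x * (1 - p (qn i) x)).
  rewrite ulim_sum//; apply: eq_bigr => i _.
  have bA : bmeas (fun w : Om => D i w.1 * \1_(tau_le (ratr (qn i) * T%:num)) w).
    by apply: bmeasM => //; apply: bmeas_indic; exact: tau_le_measurable.
  have bp : bmeas (p (qn i)) by exact: bmeas01.
  transitivity (ulim U (fun w => D i w.1 + -1 * (D i w.1 * \1_(tau_le (ratr (qn i) * T%:num)) w))).
    by congr ulim; apply: funext => w; rewrite /c; ring.
  rewrite ulimD//; last exact: bmeasZ.
  rewrite ulimZ// pE// (ulim_fst UU Um (bD i)) mulN1r -ExB//; last exact: bmeasM.
  by congr Ex; apply: funext => x; ring.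
have /cvgrPdist_lt/(_ _ e40) := ulim_cvg UU bg.
apply: filterS2 Um => P mP; rewrite ug => hP.
have {}HP := HP P mP; rewrite -Ex_sum// in HP.
apply: le_lt_trans (ler_distD (cst0 + ulim U g) _ _) _; rewrite {1}ug.
apply: le_lt_trans (lerD HQ (ler_distD (cst0 + Ex (law P) g) _ _)) _.
have E a b : cst0 + a - (cst0 + b) = a - b by ring.
rewrite (distrC _ (Ex (PMof P) _)) E ug.
have e2 : e / 4 + (e / 4 + e / 4) < e by lra.
by apply: lt_trans e2; rewrite ltrD2l ltr_leD.
Qed.

Lemma compact_adapted : compact [set P | @adapted_law R d X T F rho P].
Proof.
rewrite compact_ultra => U UU UA.
have Um : U (marginal rho) by apply: filterS UA => P [].
have [Q UQ] := ultra_marginal_cvg UU Um; exists Q; split => //.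
apply: (closure_adapted gX sF mF (S := [set P | @adapted_law R d X T F rho P])) => // V nV.
exact: (@filter_ex _ U _ _ (@filterI _ U _ _ _ UA (UQ V nV))).
Qed.
End compactness.

(** * Density of the continuous stopping times *)

Section bessel.
Context {d} {X : measurableType d} {R : realType} (rho : probability X R).

(** The functions are orthogonal with norms at most 1. Subtracting $a_K e_K$ from the remainder
    changes its square norm by $-2a_K^2+a_K^2E e_K^2\le-a_K^2$. *)
Lemma bessel (K : nat) (e : nat -> X -> R) (psi : X -> R) :
  (forall k, bmeas (e k)) -> bmeas psi ->
  (forall k k', k != k' -> Ex rho (fun x => e k x * e k' x) = 0) ->
  (forall k, Ex rho (fun x => e k x ^+ 2) <= 1) ->
  \sum_(0 <= k < K) Ex rho (fun x => psi x * e k x) ^+ 2 <= Ex rho (fun x => psi x ^+ 2).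
Proof.
move=> be bpsi ortho e1; pose a k := Ex rho (fun x => psi x * e k x).
have b2 (f : X -> R) : bmeas f -> bmeas (fun x => f x ^+ 2) by move=> bf; exact: bmeasM.
pose r K' x := psi x - \sum_(0 <= k < K') a k * e k x.
have br K' : bmeas (r K').
  by apply: bmeasB => //; apply: bmeas_sum => k; exact: bmeasZ.
have re K' k : (K' <= k)%N -> Ex rho (fun x => r K' x * e k x) = a k.
  elim: K' => [|K' IH] Kk.
    by congr Ex; apply: funext => x; rewrite /r big_geq// subr0.
  rewrite [X in Ex _ X](_ : _ = fun x => r K' x * e k x - a K' * (e K' x * e k x)); last first.
    by apply: funext => x; rewrite /r big_nat_recr//=; ring.
  rewrite ExB; [|exact: bmeasM|by apply: bmeasZ; exact: bmeasM].
  rewrite ExZ; last exact: bmeasM.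
  by rewrite ortho ?mulr0 ?subr0 ?IH ?(ltnW Kk)// neq_ltn Kk.
suff H : \sum_(0 <= k < K) a k ^+ 2 <= Ex rho (fun x => psi x ^+ 2) - Ex rho (fun x => r K x ^+ 2).
  by apply: le_trans H _; rewrite gerBl; apply: Ex_ge0 => x; exact: sqr_ge0.
elim: K => [|K IH].
  rewrite big_geq// subr_ge0 le_eqVlt; apply/orP; left; apply/eqP.
  by congr Ex; apply: funext => x; rewrite /r big_geq// subr0.
rewrite big_nat_recr//=.
have -> : Ex rho (fun x => r K.+1 x ^+ 2) =
    Ex rho (fun x => r K x ^+ 2) - 2 * a K * Ex rho (fun x => r K x * e K x) + a K ^+ 2 * Ex rho (fun x => e K x ^+ 2).
  rewrite -(ExZ rho (2 * a K) (bmeasM (br K) (be K))) -(ExZ rho (a K ^+ 2) (b2 _ (be K))) -ExB; [|exact: b2|by apply: bmeasZ; exact: bmeasM].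
  rewrite -ExD; [|by apply: bmeasB; [exact: b2|by apply: bmeasZ; exact: bmeasM]|by apply: bmeasZ; exact: b2].
  by congr Ex; apply: funext => x; rewrite /r big_nat_recr//=; ring.
rewrite re//; have := ler_wpM2l (sqr_ge0 (a K)) (e1 K).
by move: (a K) IH => aK; rewrite mulr1 => IH H; rewrite -mulrA -expr2; lra.
Qed.

(** Bessel bounds the sum over k and i of the squared correlations by $|I|C^2$. If every k had a bad
    index, the sum would be at least $K\,dl^2$. *)
Lemma bessel_pigeonhole (I : finType) (K : nat) (e : nat -> I -> X -> R) (psi : I -> X -> R) (C dl : R) :
  (forall k i, bmeas (e k i)) -> (forall i, bmeas (psi i)) -> (forall i x, `|psi i x| <= C) ->
  (forall k k' i, k != k' -> Ex rho (fun x => e k i x * e k' i x) = 0) ->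
  (forall k i, Ex rho (fun x => e k i x ^+ 2) <= 1) ->
  0 < dl -> #|I|%:R * C ^+ 2 < K%:R * dl ^+ 2 ->
  exists2 k, (k < K)%N & forall i, `|Ex rho (fun x => psi i x * e k i x)| <= dl.
Proof.
move=> be bpsi psiC ortho e1 dl0 KC.
apply: contrapT => H.
have {}H k : (k < K)%N -> dl ^+ 2 <= \sum_i Ex rho (fun x => psi i x * e k i x) ^+ 2.
  move=> kK; apply: contrapT => /negP; rewrite -ltNge => h; apply: H; exists k => // i.
  rewrite -(@ler_pXn2r _ 2)// ?nnegrE ?normr_ge0 ?(ltW dl0)// real_normK ?num_real//.
  apply: le_trans (ltW h); rewrite (bigD1 i)//= lerDl; apply: sumr_ge0 => i' _; exact: sqr_ge0.
have := KC; apply/negP; rewrite -leNgt.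
have -> : K%:R * dl ^+ 2 = \sum_(0 <= k < K) dl ^+ 2 by rewrite sumr_const_nat subn0 mulr_natl.
apply: (@le_trans _ _ (\sum_(0 <= k < K) \sum_i Ex rho (fun x => psi i x * e k i x) ^+ 2)).
  by apply: ler_sum_nat => k /andP[_ kK]; exact: H.
rewrite exchange_big /= mulr_natl -sumr_const; apply: ler_sum => i _.
apply: le_trans (@bessel K (e ^~ i) (psi i) _ _ _ _) _ => //.
  by move=> k k'; exact: ortho.
apply: Ex_bound; first exact: bmeasM.
by move=> x; rewrite -[leLHS]real_normK ?num_real// ler_pXn2r// ?nnegrE// (le_trans (normr_ge0 (psi i x))).
Qed.
End bessel.

(** A Riemann sum for the integral of a ramp over $[0,1]$. The ramp lies between the indicators of
    $u\ge y+(j+1)eps$ and $u\ge y$; this gives the first error term, and the discretization gives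
    $1/m$. *)
Lemma riemann_clamp {R : realType} (y eps : R) (j m : nat) : 0 <= y <= 1 -> 0 < eps -> (0 < m)%N ->
  `|m%:R^-1 * \sum_(0 <= l < m) Num.min 1 (Num.max 0 ((l%:R / m%:R - y) / eps - j%:R)) - (1 - y)|
    <= j.+1%:R * eps + m%:R^-1.
Proof.
move=> /andP[y0 y1] e0 m0; have m0' : 0 < m%:R :> R by rewrite ltr0n.
(* [N z m] counts the grid indices $l<m$ with $z\le l$, so for $z\ge0$ it lies between $m-z-1$ and
   $\max(0,m-z)$. *)
pose N (z : R) m := \sum_(0 <= l < m) ((z <= l%:R)%R%:R : R).
have Nge (z : R) k : 0 <= z -> k%:R - z - 1 <= N z k.
  move=> z0; elim: k => [|k IH]; first by rewrite /N big_geq//; lra.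
  rewrite /N big_nat_recr//= -/(N z k) -natr1.
  have N0 : 0 <= N z k by apply: sumr_ge0.
  by case: (leP z k%:R) => zk /=; lra.
have Nle (z : R) k : 0 <= z -> N z k <= Num.max 0 (k%:R - z).
  move=> z0; elim: k => [|k IH]; first by rewrite /N big_geq// le_max lexx.
  rewrite /N big_nat_recr//= -/(N z k) -natr1.
  move: IH; rewrite !le_max.
  by case: (leP z k%:R) => zk /= /orP[h|h]; apply/orP; ((left; lra) || (right; lra)).
pose G (l : nat) : R := Num.min 1 (Num.max 0 ((l%:R / m%:R - y) / eps - j%:R)).
have up : \sum_(0 <= l < m) G l <= m%:R * (1 - y).
  apply: (@le_trans _ _ (N (m%:R * y) m)).
    apply: ler_sum => l _; rewrite /G.
    case: (leP (m%:R * y) l%:R) => h /=; first by rewrite ge_min lexx.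
    rewrite (max_idPl _) ?ge_min ?lexx ?orbT// subr_le0 ler_pdivrMr//.
    apply: (@le_trans _ _ 0); last by rewrite mulr_ge0// ltW.
    by rewrite subr_le0 ler_pdivrMr// mulrC ltW.
  apply: le_trans (Nle _ _ _) _; first by rewrite mulr_ge0.
  by rewrite mulrBr mulr1 ge_max lexx subr_ge0 ler_piMr// ltW.
have y'0 : 0 <= y + j.+1%:R * eps by rewrite addr_ge0// mulr_ge0// ltW.
have lo : m%:R * (1 - (y + j.+1%:R * eps)) - 1 <= \sum_(0 <= l < m) G l.
  apply: (@le_trans _ _ (N (m%:R * (y + j.+1%:R * eps)) m)).
    by rewrite mulrBr mulr1; apply: Nge; rewrite mulr_ge0.
  apply: ler_sum => l _; rewrite /G.
  case: (leP (m%:R * (y + j.+1%:R * eps)) l%:R) => h /=; last by rewrite le_min ler01 le_max lexx.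
  rewrite le_min lexx le_max lerBrDl natr1 ler_pdivlMr//; apply/orP; right.
  by rewrite lerBrDl ler_pdivlMr// mulrC.
have -> : m%:R^-1 * \sum_(0 <= l < m) G l - (1 - y) = m%:R^-1 * (\sum_(0 <= l < m) G l - m%:R * (1 - y)).
  by rewrite mulrBr mulKf// gt_eqF.
rewrite normrM ger0_norm ?invr_ge0// ler0_norm ?subr_le0// opprB.
rewrite -(ler_pM2l m0') mulVKf ?gt_eqF// [leRHS]mulrDr mulfV ?gt_eqF//.
by move: lo; rewrite !mulrBr !mulrDr; lra.
Qed.

(** * Replacing an independent uniform variable by a function of the input *)

Section randomize.
Context {d} {X : measurableType d} {R : realType} (rho : probability X R).

(** Independence is pairwise: it makes the centred cell indicators orthogonal, as Bessel's
    inequality requires. The law is prescribed on half-open intervals, the shape of the cells. *)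
Definition iid_uniform (U : nat -> X -> R) :=
  [/\ forall k, measurable_fun setT (U k),
      forall k (a b : R), 0 <= a -> a <= b -> b <= 1 -> Ex rho (\1_(U k @^-1` `[a, b[%classic)) = b - a &
      forall k k' (A B : set R), k != k' -> measurable A -> measurable B ->
        Ex rho (fun x => \1_(U k @^-1` A) x * \1_(U k' @^-1` B) x) =
        Ex rho (\1_(U k @^-1` A)) * Ex rho (\1_(U k' @^-1` B))].

Variable U : nat -> X -> R.
Hypothesis iidU : iid_uniform U.

Let cell m (l : nat) : set R := `[l%:R / m%:R, l.+1%:R / m%:R[%classic.

Let ind (m k l : nat) (x : X) : R := \1_(U k @^-1` cell m l) x.

Let indE m k l x : ind m k l x = (l%:R / m%:R <= U k x < l.+1%:R / m%:R)%R%:R.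
Proof.
rewrite /ind indicE; congr (nat_of_bool _)%:R.
by apply/idP/idP; rewrite inE /cell /= in_itv.
Qed.

Let mcell m k l : measurable (U k @^-1` cell m l).
Proof. by rewrite -[X in measurable X]setTI; case: iidU => mU _ _; apply: mU => //; exact: measurable_itv. Qed.

Let bind m k l : bmeas (ind m k l).
Proof. by apply: bmeas_indic; exact: mcell. Qed.

Let Ex_ind m k l : (l < m)%N -> Ex rho (ind m k l) = m%:R^-1.
Proof.
move=> lm; have m0 : 0 < m%:R :> R by rewrite ltr0n (leq_trans _ lm).
case: iidU => _ uU _; rewrite uU.
- by rewrite -natr1 mulrDl mul1r addrAC subrr add0r.
- by rewrite divr_ge0.
- by rewrite ler_pM2r ?invr_gt0// ler_nat.
- by rewrite ler_pdivrMr// mul1r ler_nat.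
Qed.

(** The second alternative covers values outside $[0,1[$, which the law makes null but does not
    exclude pointwise. *)
Let cell_sum (m k : nat) x :
  (exists l, [/\ (l < m)%N, l%:R / m%:R <= U k x < l.+1%:R / m%:R &
     forall a : nat -> R, \sum_(l < m) a l * ind m k l x = a l]) \/
  (forall a : nat -> R, \sum_(l < m) a l * ind m k l x = 0).
Proof.
have [l /= ul|none] := pickP (fun l : 'I_m => l%:R / m%:R <= U k x < l.+1%:R / m%:R); last first.
  by right => b; rewrite big1// => l _; rewrite indE none mulr0.
have m0 : 0 < m%:R :> R by rewrite ltr0n (leq_trans _ (ltn_ord l)).
left; exists l; split => // b; rewrite (bigD1 l)//= indE ul mulr1 big1 ?addr0// => l' ll'.
rewrite indE; case: (boolP (_ <= _ < _)); rewrite ?mulr0// => /andP[u1 u2].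
case/andP: ul => v1 v2; exfalso; move/eqP: ll'; apply; apply: val_inj => /=.
have h1 := le_lt_trans u1 v2; have h2 := le_lt_trans v1 u2.
move: h1 h2; rewrite !ltr_pM2r ?invr_gt0// !ltr_nat !ltnS => ? ?.
by apply/eqP; rewrite eqn_leq; apply/andP.
Qed.

(** Freezing the last argument at the left end of the cell of $U_k$ costs $L/m$. What remains is,
    for each i and each of the m cells, the correlation of [g i] at a cell point with a centred cell
    indicator; the pigeonhole makes all of them at most $dl/m$ for one k. *)
Lemma randomize (I : finType) (g : I -> X -> R -> R) (C L dl : R) (m : nat) :
  (forall i u, bmeas (g i ^~ u)) -> (forall i V, measurable_fun setT V -> bmeas (fun x => g i x (V x))) ->
  (forall i x u, `|g i x u| <= C) ->
  (forall i x u v, `|g i x u - g i x v| <= L * `|u - v|) -> 0 <= L -> 0 < dl -> (0 < m)%N ->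
  exists k, forall i, `|Ex rho (fun x => g i x (U k x)) -
    Ex rho (fun x => m%:R^-1 * \sum_(0 <= l < m) g i x (l%:R / m%:R))| <= L / m%:R + dl.
Proof.
move=> bg bgV gC gL L0 dl0 m0; have m0' : 0 < m%:R :> R by rewrite ltr0n.
pose J := (I * 'I_m)%type.
pose psi (z : J) x := g z.1 x ((z.2 : nat)%:R / m%:R).
pose e k (z : J) x := ind m k z.2 x - m%:R^-1.
have be k z : bmeas (e k z) by apply: bmeasB => //; exact: bmeas_cst.
have bpsi z : bmeas (psi z) by exact: bg.
have dm0 : 0 < dl / m%:R by rewrite divr_gt0.
(* Enough candidates for the pigeonhole with $|J|$ functions, bound [C] and tolerance $dl/m$. *)
pose K := (Num.trunc (#|{: J}|%:R * C ^+ 2 / (dl / m%:R) ^+ 2)).+1.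
have KC : #|{: J}|%:R * C ^+ 2 < K%:R * (dl / m%:R) ^+ 2.
  by rewrite -ltr_pdivrMr ?exprn_gt0//; exact: truncnS_gt.
have [||k _ hk] := @bessel_pigeonhole _ _ R rho J K e psi C (dl / m%:R) be bpsi (fun z => gC z.1 ^~ _) _ _ dm0 KC.
- move=> k k' [i l] kk'; rewrite /e /=.
  case: iidU => mU uU iU.
  transitivity (Ex rho (fun x => ind m k l x * ind m k' l x - m%:R^-1 * ind m k l x - m%:R^-1 * ind m k' l x + m%:R^-1 ^+ 2)).
    by congr Ex; apply: funext => x; ring.
  have bb1 : bmeas (fun x => ind m k l x * ind m k' l x) by exact: bmeasM.
  have bb2 k'' : bmeas (fun x => m%:R^-1 * ind m k'' l x) by exact: bmeasZ.
  rewrite ExD; [|by do 2 apply: bmeasB => //|exact: bmeas_cst].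
  rewrite ExB//; last exact: bmeasB.
  rewrite ExB// Ex_cst !ExZ// /ind iU//; try exact: measurable_itv.
  by rewrite -!/(ind _ _ _) !Ex_ind//; ring.
- move=> k z; apply: Ex_bound; first exact: bmeasM.
  move=> x; rewrite /e indE; have /andP[y0 y1] : 0 <= (m%:R^-1 : R) <= 1.
    by rewrite invr_ge0 ltW//= invf_le1// ler1n.
  case: (_ <= _ < _) => /=; first by rewrite exprn_ile1 ?subr_ge0// gerBl.
  by rewrite sub0r sqrrN exprn_ile1.
exists k => i.
have -> : (fun x => m%:R^-1 * \sum_(0 <= l < m) g i x (l%:R / m%:R)) =
    (fun x => \sum_(l < m) g i x (l%:R / m%:R) * m%:R^-1).
  by apply: funext => x; rewrite big_mkord mulr_sumr; apply: eq_bigr => l _; rewrite mulrC.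
pose S x := \sum_(l < m) g i x (l%:R / m%:R) * ind m k l x.
have bS : bmeas S by apply: bmeas_sum => l; exact: bmeasM.
have bgU : bmeas (fun x => g i x (U k x)) by apply: bgV; case: iidU => mU _ _; exact: mU.
apply: le_trans (ler_distD (Ex rho S) _ _) _; apply: lerD; last first.
  rewrite -ExB//; last by apply: bmeas_sum => l; apply: bmeasM => //; exact: bmeas_cst.
  rewrite [X in Ex _ X](_ : _ = fun x => \sum_(l < m) psi (i, l) x * e k (i, l) x); last first.
    by apply: funext => x; rewrite /S -sumrB; apply: eq_bigr => l _; rewrite -mulrBr.
  rewrite Ex_sum; last by move=> l; exact: bmeasM.
  apply: le_trans (ler_norm_sum _ _ _) _.
  have -> : dl = \sum_(l < m) dl / m%:R.
    by rewrite sumr_const card_ord -mulrnAr -mulr_natr mulVf ?mulr1// gt_eqF.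
  by apply: ler_sum => l _; exact: hk.
rewrite -ExB//; apply: le_trans (Ex_norm _ _) _; first exact: bmeasB.
have bi : bmeas (fun x => \sum_(l < m) ind m k l x) by apply: bmeas_sum.
have b1i : bmeas (fun x => 1 - \sum_(l < m) ind m k l x) by apply: bmeasB => //; exact: bmeas_cst.
(* Where no cell contains $U_k$, the bound [C] is charged to one minus the sum of the cell
   indicators, which has mean 0. *)
apply: (@le_trans _ _ (Ex rho (fun x => L / m%:R + C * (1 - \sum_(l < m) ind m k l x)))).
  apply: Ex_le; [by apply: bmeas_norm; exact: bmeasB|by apply: bmeasD; [exact: bmeas_cst|exact: bmeasZ]|].
  move=> x; have [[l [lm /andP[u1 u2] sE]]|sE] := cell_sum m k x.
    have -> : \sum_(l < m) ind m k l x = 1.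
      by rewrite -[RHS](sE (fun=> 1)); apply: eq_bigr => l' _; rewrite mul1r.
    rewrite subrr mulr0 addr0 /S (sE (fun l => g i x (l%:R / m%:R))).
    apply: le_trans (gL _ _ _ _) _; rewrite ler_wpM2l// ger0_norm ?subr_ge0//.
    by move: (ltW u2); rewrite -natr1 mulrDl mul1r lerBlDl.
  have -> : \sum_(l < m) ind m k l x = 0.
    by rewrite -[RHS](sE (fun=> 1)); apply: eq_bigr => l' _; rewrite mul1r.
  rewrite /S (sE (fun l => g i x (l%:R / m%:R))) !subr0 mulr1.
  by apply: le_trans (gC i x _) _; rewrite lerDr divr_ge0.
rewrite ExD; [|exact: bmeas_cst|exact: bmeasZ].
rewrite Ex_cst ExZ// ExB//; last exact: bmeas_cst.
rewrite Ex_cst Ex_sum//.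
have -> : \sum_(l < m) Ex rho (ind m k l) = 1.
  transitivity (\sum_(l < m) (m%:R^-1 : R)); first by apply: eq_bigr => l _; exact: Ex_ind.
  by rewrite sumr_const card_ord -[LHS]mulr_natr mulVf// gt_eqF.
by rewrite subrr mulr0 addr0.
Qed.
End randomize.

Section ramp.
Context {R : realType}.

(** A continuous substitute for the indicator of $y<u$: as u varies it rises from 0 to 1 over
    $[y+j\,eps,\,y+(j+1)eps]$. The rises for successive j adjoin, so for nondecreasing y the next
    ramp vanishes until the present one is complete, which gives the staircase of the
    interpolation. *)
Definition ramp (eps : R) (j : nat) (u y : R) : R := Num.min 1 (Num.max 0 ((u - y) / eps - j%:R)).

Lemma ramp01 eps j u y : 0 <= ramp eps j u y <= 1.
Proof. by rewrite /ramp le_min ler01 le_max lexx ge_min lexx. Qed.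

Lemma ramp_lipschitz eps j u v y : 0 < eps -> `|ramp eps j u y - ramp eps j v y| <= eps^-1 * `|u - v|.
Proof.
move=> e0; have clamp (a b : R) : `|Num.min 1 (Num.max 0 a) - Num.min 1 (Num.max 0 b)| <= `|a - b|.
  wlog ab : a b / a <= b.
    by move=> H; case: (leP a b) => [/H//|/ltW /H]; rewrite distrC (distrC b).
  rewrite [leRHS]ler0_norm ?subr_le0// opprB.
  have k (z : R) : Num.min 1 (Num.max 0 z) = if z <= 0 then 0 else if z <= 1 then z else 1.
    case: (leP z 0) => z0; first by rewrite (min_idPr ler01).
    by case: (leP z 1).
  rewrite !k ler_norml; case: (leP a 0) => a0; case: (leP b 0) => b0; case: (leP a 1) => a1; case: (leP b 1) => b1; apply/andP; split; lra.
apply: le_trans (clamp _ _) _.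
rewrite [X in `|X|](_ : _ = eps^-1 * (u - v)); last by field; rewrite gt_eqF.
by rewrite normrM ger0_norm// invr_ge0 ltW.
Qed.

Lemma ramp_lt1 eps j u y y' : 0 < eps -> y <= y' -> ramp eps j u y < 1 -> ramp eps j.+1 u y' = 0.
Proof.
move=> e0 yy'; rewrite /ramp gt_min ltxx /= gt_max ltr01 /= => h.
have : (u - y') / eps <= (u - y) / eps by rewrite ler_pM2r ?invr_gt0// lerD2l lerN2.
by move=> h'; rewrite (max_idPl _) ?(min_idPr ler01)// -natr1; lra.
Qed.

Lemma ramp_measurable {d} {X : measurableType d} eps j (V q : X -> R) :
  measurable_fun setT V -> measurable_fun setT q -> measurable_fun setT (fun x => ramp eps j (V x) (q x)).
Proof.
move=> mV mq; apply: measurable_minr; first exact: measurable_cst.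
apply: measurable_maxr; first exact: measurable_cst.
apply: measurable_funB; last exact: measurable_cst.
by apply: measurable_funM; [exact: measurable_funB|exact: measurable_cst].
Qed.
End ramp.

Section randomize_ramp.
Context {d} {X : measurableType d} {R : realType} (rho : probability X R).
Variable U : nat -> X -> R.
Hypothesis iidU : iid_uniform rho U.

Lemma randomize_ramp (I : finType) (D q : I -> X -> R) (j : I -> nat) (C eps eta : R) :
  (forall i, bmeas (D i)) -> (forall i x, `|D i x| <= C) -> 0 < C ->
  (forall i, measurable_fun setT (q i)) -> (forall i x, 0 <= q i x <= 1) -> 0 < eps -> 0 < eta ->
  exists k, forall i, `|Ex rho (fun x => D i x * ramp eps (j i) (U k x) (q i x)) -
    Ex rho (fun x => D i x * (1 - q i x))| <= C * ((j i).+1%:R * eps) + eta.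
Proof.
move=> bD DC C0 mq q01 e0 eta0; have eta20 : 0 < eta / 2 by rewrite divr_gt0.
have Ce0 : 0 < C / eps by rewrite divr_gt0.
(* The Lipschitz error $C/(eps\,m)$ and the Riemann error $C/m$ together use half of [eta]. *)
pose m := (Num.trunc ((C / eps + C) / (eta / 2))).+1.
have m0 : (0 < m)%N by []. have m0' : 0 < m%:R :> R by rewrite ltr0n.
have Cm : C / eps / m%:R + C / m%:R <= eta / 2.
  by rewrite -mulrDl ler_pdivrMr// (mulrC (eta / 2)) -ler_pdivrMr//; apply: ltW; exact: truncnS_gt.
pose g i x u := D i x * ramp eps (j i) u (q i x).
have bgV i (V : X -> R) : measurable_fun setT V -> bmeas (fun x => g i x (V x)).
  move=> mV; apply: bmeasM => //; apply: bmeas01; last by move=> x; exact: ramp01.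
  exact: ramp_measurable.
have rn eps' j' u y : `|ramp eps' j' u y| <= 1 :> R.
  by have /andP[r0 r1] := ramp01 eps' j' u y; rewrite ger0_norm.
have [|||k hk] := randomize iidU (g := g) (C := C) (L := C / eps) _ bgV _ _ (ltW Ce0) eta20 m0.
- by move=> i u; apply: bgV; exact: measurable_cst.
- by move=> i x u; rewrite normrM -[leRHS]mulr1 ler_pM.
- move=> i x u v; rewrite -mulrBr normrM -mulrA ler_pM//; exact: ramp_lipschitz.
exists k => i; apply: le_trans (ler_distD (Ex rho (fun x => m%:R^-1 * \sum_(0 <= l < m) g i x (l%:R / m%:R))) _ _) _.
have H : `|Ex rho (fun x => m%:R^-1 * \sum_(0 <= l < m) g i x (l%:R / m%:R)) - Ex rho (fun x => D i x * (1 - q i x))|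
    <= C * ((j i).+1%:R * eps + m%:R^-1).
  apply: Ex_close.
  - apply: bmeasZ; apply: bmeas_sum => l; apply: bgV; exact: measurable_cst.
  - by apply: bmeasM => //; apply: bmeasB; [exact: bmeas_cst|exact: bmeas01].
  move=> x; rewrite /g -mulr_sumr mulrCA -mulrBr normrM ler_pM//.
  exact: riemann_clamp.
have := hk i; rewrite mulrDr in H; lra.
Qed.
End randomize_ramp.

(** Controls the error of a running maximum: [a] and [e] approximate [b] and [c], and the middle
    term will have mean 0 because the exact densities increase almost surely. *)
Lemma max_dist {R : realDomainType} (a b c e : R) :
  `|Num.max a e - c| <= `|a - b| + Num.max 0 (b - c) + `|e - c|.
Proof.
have h1 := ler_norm (a - b); have h2 : b - c <= Num.max 0 (b - c) by rewrite le_max lexx orbT.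
have h3 : 0 <= Num.max 0 (b - c) by rewrite le_max lexx.
have h4 := normr_ge0 (a - b); have h5 := normr_ge0 (e - c).
have h6 : c - e <= `|e - c| by rewrite distrC ler_norm.
move: h1 h2 h3 h4 h5 h6; move: (Num.max 0 _) `|a - b| => u v h1 h2 h3 h4.
case: (leP a e) => [_ _ _|ae]; first by rewrite lerDr addr_ge0.
by move: `|e - c| => z h5 h6; rewrite ler_norml; apply/andP; split; lra.
Qed.

(** * Continuous densities and stopping times on the grid *)

Section grid_densities.
Context {R : realType} {d} {X : topMeasType d} (T : {posnum R}).
Variables (F : R -> set (set X)) (rho : probability X R).
Hypothesis sF : forall t, sigma_algebra setT (F t).
Hypothesis mF : forall t S, F t S -> measurable S.
Hypothesis monoF : forall s t, s <= t -> F s `<=` F t.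
Hypothesis cozF : forall t, F t `<=` <<s @cozeros R d X (F t) >>.
Local Notation Om := (X * time T)%type.
Local Notation tau_le := (@tau_le R d X T).

(** The density of $\{\tau\le ih\}$ is measurable at time $(i+1)h$, which must be below T, hence the
    guard on i. Running maxima of continuous approximations make the family monotone everywhere, as
    the ramps require, and preserve continuity and measurability. *)
Lemma grid_densities (P : PM Om R) (n : nat) (dl : R) : adapted_law F rho P -> (0 < n)%N -> 0 < dl ->
  exists p q : nat -> X -> R,
  [/\ forall i, bmeas (p i),
      forall i, (i.+1 < n)%N -> forall psi, bmeas psi ->
        Ex (law P) (fun w => psi w.1 * \1_(tau_le (i%:R * mesh T n)) w) = Ex rho (fun x => psi x * p i x),
      forall i, (i.+1 < n)%N -> Ex rho (fun x => `|q i x - p i x|) <= dl,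
      forall i x, q i x <= q i.+1 x &
      forall i, continuous (q i) /\ (forall x, 0 <= q i x <= 1) /\ ((i.+1 < n)%N -> Gmeas (F (i.+1%:R * mesh T n)) (q i))].
Proof.
move=> [mP aP] n0 dl0; have h0 := @mesh_gt0 R T n n0.
(* Each step of the running maximum adds one error, at most n in all. *)
have dln0 : 0 < dl / n%:R by rewrite divr_gt0 ?ltr0n.
have /choice [p0 p0P] (i : nat) : exists z : (X -> R) * (X -> R),
  [/\ bmeas z.1,
      (i.+1 < n)%N -> forall psi, bmeas psi ->
        Ex (law P) (fun w => psi w.1 * \1_(tau_le (i%:R * mesh T n)) w) = Ex rho (fun x => psi x * z.1 x),
      (i.+1 < n)%N -> Ex rho (fun x => `|z.2 x - z.1 x|) <= dl / n%:R &
      continuous z.2 /\ (forall x, 0 <= z.2 x <= 1) /\ ((i.+1 < n)%N -> Gmeas (F (i.+1%:R * mesh T n)) z.2)].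
  case: (ltnP i.+1 n) => iin; last first.
    exists (fun=> 0, fun=> 0); split => //; first exact: bmeas_cst.
    split; first exact: cst_continuous.
    by split => // x; rewrite lexx ler01.
  have [p [Gp p01 pE]] : adapted_event rho (law P) (F (i.+1%:R * mesh T n)) (tau_le (i%:R * mesh T n)).
    apply: aP; first by rewrite mulr_ge0// ltW.
      by rewrite ltr_pM2r// ltr_nat.
    by rewrite -(mesh_n T n0) ltr_pM2r// ltr_nat.
  have bp : bmeas p by apply: bmeas01 => //; apply: Gmeas_meas Gp; exact: mF.
  have [q [cq Gq q01] qp] := capprox_fun rho (sF (i.+1%:R * mesh T n)) (@mF (i.+1%:R * mesh T n)) (@cozF _) Gp p01 dln0.
  exists (p, q); split => //= _; last exact: ltW.
  move=> psi bpsi; rewrite -(density_Ex mP (@tau_le_measurable R d X T (i%:R * mesh T n)) bp bpsi pE).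
  by congr Ex; apply: funext => w; rewrite mulrC.
pose p i := (p0 i).1; pose q0 i := (p0 i).2.
pose q := fix q i x := if i is i'.+1 then Num.max (q i' x) (q0 i x) else q0 0%N x.
have bp i : bmeas (p i) by case: (p0P i).
have cq0 i : continuous (q0 i) by case: (p0P i) => _ _ _ [].
have q001 i x : 0 <= q0 i x <= 1 by case: (p0P i) => _ _ _ [_ [h _]]; exact: h.
have Gq0 i : (i.+1 < n)%N -> Gmeas (F (i.+1%:R * mesh T n)) (q0 i).
  by case: (p0P i) => _ _ _ [_ [_]].
have cq i : continuous (q i).
  by elim: i => [|i IH] /=; [exact: cq0|exact: (continuous_maxr IH (@cq0 i.+1))].
have q01 i x : 0 <= q i x <= 1.
  elim: i => [|i /andP[h1 h2]] /=; first exact: q001.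
  by rewrite le_max h1 ge_max h2 /=; have /andP[_ ->] := q001 i.+1 x.
have Gq i : (i.+1 < n)%N -> Gmeas (F (i.+1%:R * mesh T n)) (q i).
  elim: i => [|i IH] iin /=; first exact: Gq0.
  apply: Gmeas_max => //; last exact: Gq0.
  apply: GmeasS (IH (ltnW iin)); apply: monoF.
  by rewrite ler_wpM2r ?(ltW h0)// ler_nat.
exists p, q; split => //.
- by move=> i; case: (p0P i).
- have pq0 i : (i.+1 < n)%N -> Ex rho (fun x => `|q0 i x - p i x|) <= dl / n%:R by case: (p0P i).
  have bq0 i : (i.+1 < n)%N -> bmeas (q0 i).
    by move=> iin; apply: (bmeas01 _ (q001 i)); apply: Gmeas_meas (Gq0 i iin); exact: mF.
  have bq i : (i.+1 < n)%N -> bmeas (q i).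
    by move=> iin; apply: (bmeas01 _ (q01 i)); apply: Gmeas_meas (Gq i iin); exact: mF.
  have bqp i : (i.+1 < n)%N -> bmeas (fun x => `|q0 i x - p i x|).
    by move=> iin; apply: bmeas_norm; apply: bmeasB => //; exact: bq0.
  have pos0 i : (i.+2 < n)%N -> Ex rho (fun x => Num.max 0 (p i x - p i.+1 x)) <= 0.
    move=> iin; pose S := [set x | 0 < p i x - p i.+1 x].
    have mS : measurable S.
      have [mpp _] := bmeasB (bp i) (bp i.+1).
      have := mpp measurableT _ (measurable_itv `]0, +oo[); congr measurable.
      by apply/seteqP; split => w /=; rewrite in_itv /= andbT //; case.
    have bS := @bmeas_indic _ _ R _ mS.
    rewrite [X in Ex _ X](_ : _ = fun x => \1_S x * p i x - \1_S x * p i.+1 x); last first.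
      apply: funext => x; rewrite -mulrBr indicE.
      case: (ltP 0 (p i x - p i.+1 x)) => pp; first by rewrite mem_set ?mul1r.
      by rewrite memNset ?mul0r// /S /=; apply/negP; rewrite -leNgt.
    rewrite ExB; [|exact: bmeasM..]; rewrite subr_le0.
    have H k : (k.+1 < n)%N -> Ex (law P) (fun w => \1_S w.1 * \1_(tau_le (k%:R * mesh T n)) w) = Ex rho (fun x => \1_S x * p k x).
      by move=> kn; case: (p0P k) => _ /(_ kn _ bS).
    rewrite -!H//; last exact: ltnW.
    have bt s : bmeas (fun w : Om => \1_S w.1 * \1_(tau_le s) w : R).
      apply: bmeasM; first exact: (bmeas_comp measurable_fst bS).
      by apply: bmeas_indic; exact: tau_le_measurable.
    apply: Ex_le => // w; rewrite ler_wpM2l ?indicE//.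
    case: (boolP (w \in tau_le _)) => // wq; rewrite mem_set//=.
    by move: wq; rewrite inE /Defs.preim /= => /le_trans; apply; rewrite ler_wpM2r ?(ltW h0)// ler_nat.
  have main i : (i.+1 < n)%N -> Ex rho (fun x => `|q i x - p i x|) <= i.+1%:R * (dl / n%:R).
    elim: i => [|i IH] iin /=; first by rewrite mul1r; exact: pq0.
    have bi := bqp _ iin; have iin' := ltnW iin.
    have bqpi : bmeas (fun x => `|q i x - p i x|) by apply: bmeas_norm; apply: bmeasB => //; exact: bq.
    have bm : bmeas (fun x => Num.max 0 (p i x - p i.+1 x)).
      by apply: bmeas_max; [exact: bmeas_cst|exact: bmeasB].
    apply: (@le_trans _ _ (Ex rho (fun x => `|q i x - p i x| + Num.max 0 (p i x - p i.+1 x) + `|q0 i.+1 x - p i.+1 x|))).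
      apply: Ex_le.
      - by apply: bmeas_norm; apply: bmeasB => //; exact: (bq i.+1 iin).
      - by apply: bmeasD => //; exact: bmeasD.
      by move=> x; exact: max_dist.
    rewrite ExD//; last exact: bmeasD.
    rewrite ExD// -natr1 mulrDl mul1r.
    have := IH iin'; have := pos0 i iin; have := pq0 i.+1 iin; lra.
  move=> i iin; apply: le_trans (main i iin) _.
  by rewrite mulrCA ger_pMr// ler_pdivrMr ?ltr0n// mul1r ler_nat ltnW.
- by move=> i x /=; rewrite le_max lexx.
- by move=> i; split; [exact: cq|split; [exact: q01|exact: Gq]].
Qed.

Definition grid_time (n : nat) (c : nat -> X -> R) (x : X) : time T :=
  clamp_time T (mesh T n * \sum_(0 <= i < n) c i x).

Lemma val_grid_time n c x : (0 < n)%N -> (forall i, 0 <= c i x <= 1) ->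
  val (grid_time n c x) = mesh T n * \sum_(0 <= i < n) c i x.
Proof.
move=> n0 c01; have h0 := @mesh_gt0 R T n n0; apply: val_clamp_id; apply/andP; split.
  by apply: mulr_ge0; [exact: ltW|apply: sumr_ge0 => i _; case/andP: (c01 i)].
rewrite -(mesh_n T n0) mulrC ler_pM2r//.
apply: le_trans (ler_sum _ (fun i _ => proj2 (andP (c01 i)))) _.
by rewrite sumr_const_nat subn0.
Qed.

(* On [jh <= t < (j+1)h] the event is decided by the first j+1 summands: if they sum up to
   less than j+1, one of them is smaller than 1 and all the later ones vanish. *)
Lemma grid_time_stopping (n : nat) (c : nat -> X -> R) (t : R) : (0 < n)%N ->
  (forall i x, 0 <= c i x <= 1) -> (forall i x, c i x < 1 -> c i.+1 x = 0) ->
  (forall i, (i < n)%N -> Gmeas (F (i%:R * mesh T n)) (c i)) -> 0 <= t <= T%:num ->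
  F t [set x | val (grid_time n c x) <= t].
Proof.
move=> n0 c01 cd Gc /andP[t0 tT]; have h0 := @mesh_gt0 R T n n0.
have [Tt|tT'] := leP T%:num t.
  rewrite (_ : [set x | _] = setT); first exact: sigma_algebraT.
  by apply/seteqP; split => // x _ /=; have /andP[_ h] := val_time01 (grid_time n c x); exact: le_trans Tt.
pose j := Num.trunc (t / mesh T n).
have jt : j%:R * mesh T n <= t by rewrite -ler_pdivlMr// truncn_le// divr_ge0// ltW.
have tj : t < j.+1%:R * mesh T n by rewrite -ltr_pdivrMr//; exact: truncnS_gt.
have jn : (j < n)%N.
  by rewrite -(ltr_nat R) -(ltr_pM2r h0) mesh_n//; exact: le_lt_trans jt tT'.
pose S m x := \sum_(0 <= i < m) c i x.
have S_nd m m' x : (m <= m')%N -> S m x <= S m' x.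
  move=> mm'; rewrite /S [leRHS](big_cat_nat (n := m))//= lerDl; apply: sumr_ge0 => i _.
  by case/andP: (c01 i x).
have Sj x : S j.+1 x < j.+1%:R -> S n x = S j.+1 x.
  move=> Sx; rewrite /S [LHS](big_cat_nat (n := j.+1))//= -[RHS]addr0; congr (_ + _).
  have [i ij ci] : exists2 i, (i <= j)%N & c i x < 1.
    apply: contrapT => H; move: Sx; apply/negP; rewrite -leNgt /S.
    have -> : j.+1%:R = \sum_(0 <= i < j.+1) (1 : R) by rewrite sumr_const_nat subn0.
    apply: ler_sum_nat => i /andP[_ ij]; rewrite leNgt; apply/negP => ci; apply: H.
    by exists i.
  rewrite big_nat big1// => k /andP[jk _].
  have cS m : c (i + m.+1)%N x = 0.
    by elim: m => [|m IH]; rewrite addnS cd// ?addn0// IH ltr01.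
  by rewrite -(subnKC (leq_ltn_trans ij jk)) addSnnS.
rewrite (_ : [set x | _] = [set x | mesh T n * S n x <= t]); last first.
  by apply: eq_set => x; rewrite val_grid_time.
rewrite (_ : [set x | _] = [set x | mesh T n * S j.+1 x <= t]).
  have GS : Gmeas (F (j%:R * mesh T n)) (S j.+1).
    rewrite (_ : S j.+1 = fun x => \sum_(i < j.+1) c i x); last first.
      by apply: funext => x; rewrite /S big_mkord.
    apply: Gmeas_sum => // i; have ij : (i <= j)%N by rewrite -ltnS.
    apply: GmeasS (Gc i (leq_ltn_trans ij jn)); apply: monoF.
    by rewrite ler_wpM2r ?(ltW h0)// ler_nat.
  have := GS `]-oo, t / mesh T n]%classic (measurable_itv _); move/(monoF jt); congr (F t _).
  by apply/seteqP; split => x /=; rewrite in_itv /= ler_pdivlMr// mulrC.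
apply/seteqP; split => x /=.
  by apply: le_trans; rewrite ler_pM2l//; exact: S_nd.
move=> Sx; rewrite Sj//; rewrite -(ltr_pM2l h0); apply: le_lt_trans Sx _; by rewrite mulrC.
Qed.
End grid_densities.

Lemma Ex_ae_eq {d} {Y : measurableType d} {R : realType} (P : probability Y R) (f g : Y -> R) :
  bmeas f -> bmeas g -> {ae P, forall y, f y = g y} -> Ex P f = Ex P g.
Proof.
move=> bf bg fg; apply: EFin_inj; rewrite !Ex_EFin//.
apply: ae_eq_integral => //.
- by apply/measurable_EFinP; exact: bmeas_meas.
- by apply/measurable_EFinP; exact: bmeas_meas.
- by apply: filterS fg => y /= ->.
Qed.

Section stopping_law.
Context {R : realType} {d} {X : topMeasType d} (T : {posnum R}).
Variables (F : R -> set (set X)) (rho : probability X R).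
Hypothesis gX : cozero_base R X.
Local Notation Om := (X * time T)%type.

Lemma continuous_time_measurable (sigma : X -> time T) : continuous sigma -> measurable_fun setT sigma.
Proof.
move=> cs; apply: (@measurability _ _ _ _ _ _ open) => //.
move=> _ [U oU <-]; rewrite setTI; apply: (cozero_base_open gX).
by move/continuousP : cs; exact.
Qed.

Lemma stopping_law (sigma : X -> time T) : continuous sigma ->
  (forall t, 0 <= t <= T%:num -> F t [set x | val (sigma x) <= t]) ->
  exists Q : PM Om R, R0X F rho Q /\
    forall f : Om -> R, bmeas f -> Ex (law Q) f = Ex rho (fun x => f (x, sigma x)).
Proof.
move=> cs Fs; have ms := continuous_time_measurable cs.
have mg : measurable_fun setT (fun x => (x, sigma x) : Om) by exact: measurable_fun_pair.
have [Q [QA QE]] := push_ex rho mg; exists (Q : PM Om R); split; last exact: QE.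
have Q0 A : measurable A -> (forall x, ~ A (x, sigma x)) -> Q A = 0%E.
  move=> mA nA; rewrite QA// (_ : _ @^-1` _ = set0) ?measure0//.
  by apply/seteqP; split => x //= /nA.
have mfst (S : set X) : measurable S -> measurable ((fst : Om -> X) @^-1` S).
  by move=> mS; rewrite -[X in measurable X]setTI; exact: measurable_fst.
have ms' : measurable_fun setT (fun w : Om => val (sigma w.1) : R).
  apply: (@measurableT_comp _ _ _ Om X R (fun x => val (sigma x))); last exact: measurable_fst.
  apply: (@measurableT_comp _ _ _ X (time T) R (fun u => val u)) => //.
  exact: (continuous_meas (time_cozero_base T) (@val_time_continuous R T)).
split.
  move=> A mA; rewrite /law /PMof QA; last exact: measurableX.
  by congr (rho _); apply/seteqP; split => x //= [].
split.
  move=> t tT; exists ((fst : Om -> X) @^-1` [set x | val (sigma x) <= t]); split.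
    by exists [set x | val (sigma x) <= t]; [exact: Fs|rewrite setTI].
  have mS : measurable ((fst : Om -> X) @^-1` [set x | val (sigma x) <= t]).
    have := ms' measurableT _ (measurable_itv `]-oo, t]); congr measurable.
    by apply/seteqP; split => w /=; rewrite in_itv /= //; case.
  have mt := @tau_le_measurable R d X T t.
  have mN := measurableU _ _ (measurableD mt mS) (measurableD mS mt).
  apply/(negligibleP (law _) mN); rewrite /law /PMof; apply: Q0 => //.
  by move=> x [[]|[]].
exists sigma; split => //.
pose N := [set w : Om | val w.2 - val (sigma w.1) != 0 :> R].
have mN : measurable N.
  have := measurable_funB (@tauX_measurable R d X T) ms'.
  move=> /(_ measurableT _ (measurableC (measurable_set1 0))); congr measurable.
  by apply/seteqP; split => w /=; [case=> _ /eqP|move=> /eqP; split].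
exists N; split => //.
  by rewrite /law /PMof; apply: Q0 => // x; rewrite /N /= subrr eqxx.
by move=> w /= ws; rewrite /N /= subr_eq0; apply/eqP => /val_inj.
Qed.
End stopping_law.

(** * Approximation of adapted laws by continuous stopping times *)

Section density.
Context {R : realType} {d} {X : topMeasType d} (T : {posnum R}).
Variables (F : R -> set (set X)) (rho : probability X R).
Hypothesis gX : cozero_base R X.
Hypothesis sF : forall t, sigma_algebra setT (F t).
Hypothesis mF : forall t S, F t S -> measurable S.
Hypothesis monoF : forall s t, s <= t -> F s `<=` F t.
Hypothesis cozF : forall t, F t `<=` <<s @cozeros R d X (F t) >>.
Hypothesis noiseF : forall h, 0 < h -> h <= T%:num ->
  exists U : nat -> X -> R, iid_uniform rho U /\ forall k, continuous (U k) /\ Gmeas (F h) (U k).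
Local Notation Om := (X * time T)%type.
Local Notation tau_le := (@tau_le R d X T).

Lemma Gmeas_ramp (G : set (set X)) eps j (V q : X -> R) : sigma_algebra setT G ->
  Gmeas G V -> Gmeas G q -> Gmeas G (fun x => ramp eps j (V x) (q x)).
Proof.
by move=> sG /(GmeasP sG) mV /(GmeasP sG) mq; apply/(GmeasP sG); exact: ramp_measurable.
Qed.

Lemma continuous_ramp eps j (V q : X -> R) : continuous V -> continuous q ->
  continuous (fun x => ramp eps j (V x) (q x)).
Proof.
move=> cV cq; apply: continuous_minr; first exact: continuous_cstr.
apply: continuous_maxr; first exact: continuous_cstr.
apply: continuousBr; last exact: continuous_cstr.
by apply: continuousMr; [exact: continuousBr|exact: continuous_cstr].
Qed.

(** The interpolation with coefficients delayed by one step: 1 first, then $1_{\{\tau>ih\}}$ in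
    position i+1. The spare step of [bool_pattern] absorbs the delay. *)
Lemma interp_law (P : PM Om R) (n : nat) (f : BC Om R) (e : R) : marginal rho P -> (0 < n)%N ->
  interp_bound rho f n e ->
  `|Ex (law P) (sval f) - (Ex rho (fun x => sval f (x, grid T n 0)) +
     \sum_(0 <= i < n) Ex (law P) (fun w => (sval f (w.1, grid T n i.+1) - sval f (w.1, grid T n i)) *
       (if i is i'.+1 then 1 - \1_(tau_le (i'%:R * mesh T n)) w else 1)))| <= e.
Proof.
move=> mP n0 hn; have h0 := @mesh_gt0 R T n n0.
pose c (i : nat) (w : Om) : R := if i is i'.+1 then 1 - \1_(tau_le (i'%:R * mesh T n)) w else 1.
pose b (i : nat) (w : Om) : bool := if i is i'.+1 then ~~ (tauX w <= i'%:R * mesh T n) else true.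
have cE i w : c i w = (b i w)%:R.
  case: i => [//|i]; rewrite /c /b indicE.
  have -> : (w \in tau_le (i%:R * mesh T n)) = (tauX w <= i%:R * mesh T n).
    by apply/idP/idP; rewrite inE.
  by case: (_ <= _); rewrite /= ?subrr ?subr0.
have b_nd i w : b i.+1 w -> b i w.
  case: i => [//|i] /=; apply: contra => /le_trans; apply.
  by rewrite ler_wpM2r ?(ltW h0)// ler_nat.
have bc i : bmeas (c i).
  case: i => [|i]; first exact: bmeas_cst.
  by apply: bmeasB; [exact: bmeas_cst|apply: bmeas_indic; exact: tau_le_measurable].
rewrite (_ : Ex (law P) (sval f) = Ex (law P) (fun w => sval f (w.1, w.2))); last first.
  by congr Ex; apply: funext => -[].
apply: (hn _ _ (law P) fst snd c) => //.
- by move=> h bh; apply: Ex_marginal bh; exact: mP.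
- by move=> i; exact: bmeas_meas.
- by move=> i w; rewrite cE; case: (b i w); rewrite ?lexx ?ler01.
- move=> i w; rewrite !cE; case bi : (b i w); first by rewrite ltxx.
  by case bi1 : (b i.+1 w) => //; rewrite (b_nd _ _ bi1) in bi.
- move=> w; under eq_bigr do rewrite cE.
  apply: bool_pattern => //.
  + by move=> i; exact: b_nd.
  + case=> [//|i] ni /=; rewrite negbK => /le_trans; apply.
    by rewrite ler_wpM2r ?(ltW h0)// ler_nat.
  + case=> [|i] ni /=; first by move=> _; rewrite mul0r sub0r; apply: (@lt_le_trans _ _ 0);
      [rewrite oppr_lt0|case/andP: (val_time01 w.2)].
    by rewrite -ltNge -natr1 mulrDl mul1r addrK.
Qed.

(** Both laws are interpolated on one grid, with an error of $e/8$ each. Each of the n terms then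
    differs by at most three times [eta]: the width of the ramps, the dependence of the noise, and
    the approximation of the densities. In all, $5e/8$. *)
Lemma density_finite (P : PM Om R) (N : nat) (f : nat -> BC Om R) (e : R) : adapted_law F rho P -> 0 < e ->
  exists2 Q : PM Om R, R0X F rho Q &
    forall k, (k < N)%N -> `|Ex (law Q) (sval (f k)) - Ex (law P) (sval (f k))| < e.
Proof.
move=> aP e0; have mP := aP.1; have e80 : 0 < e / 8 by rewrite divr_gt0.
have /choice [n0 hn0] (k : nat) := interp_Ex gX rho (f k) e80.
have /choice [M hM] (k : nat) : exists M : R, forall w, `|sval (f k) w| <= M by case: (svalP (f k)).
pose n := (\max_(k < N) n0 k).+1; have n_gt0 : (0 < n)%N by [].
have hn (k : nat) : (k < N)%N -> interp_bound rho (f k) n (e / 8).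
  by move=> kN; apply: hn0; rewrite ltnS; exact: (@leq_bigmax _ (fun k : 'I_N => n0 k) (Ordinal kN)).
have h0 := @mesh_gt0 R T n n_gt0.
have M0 k : 0 <= M k by exact: le_trans (hM k point).
(* One bound for all increments of all test functions; the summand 1 keeps it positive in every
   case. *)
pose C := 1 + \sum_(k < N) 2 * M k.
have C0 : 0 < C by rewrite ltr_pwDl// sumr_ge0// => k _; rewrite mulr_ge0.
pose D k i x := sval (f k) (x, grid T n i.+1) - sval (f k) (x, grid T n i).
have bD k i : bmeas (D k i) by apply: bmeasB; exact: (BC_slice_bmeas gX (f k)).
have DC k i x : (k < N)%N -> `|D k i x| <= C.
  move=> kN; apply: le_trans (ler_normB _ _) _; apply: le_trans (lerD (hM k _) (hM k _)) _.
  rewrite -mulr2n -mulr_natl /C (bigD1 (Ordinal kN))//= addrCA lerDl addr_ge0// sumr_ge0// => i' _.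
  by rewrite mulr_ge0.
have n0' : 0 < n%:R :> R by rewrite ltr0n.
(* With $eps=\eta/(C(n+1))$ the ramp error $C(i+2)eps$ stays below [eta] for $i+1<n$, and $\eta/C$
   is the tolerance for the densities; n terms of three times [eta] sum to $3e/8$. *)
pose eta := e / (8 * n%:R); have eta0 : 0 < eta by rewrite divr_gt0// mulr_gt0.
pose eps := eta / (C * n.+1%:R); have eps0 : 0 < eps by rewrite divr_gt0// mulr_gt0.
have dl0 : 0 < eta / C by rewrite divr_gt0.
have [p [q [bp pE qp q_nd qP]]] := grid_densities sF mF monoF cozF aP n_gt0 dl0.
have cq i : continuous (q i) by case: (qP i).
have q01 i x : 0 <= q i x <= 1 by case: (qP i) => _ [h _]; exact: h.
have bq i : bmeas (q i) by apply: bmeas01 => //; exact: (continuous_meas gX).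
have [|U [iidU UP]] := noiseF h0.
  by rewrite -(mesh_n T n_gt0) ler_peMl ?(ltW h0)// ler1n.
have [k0 hk0] := @randomize_ramp _ X R rho U iidU ('I_N * 'I_n)%type
  (fun z => D z.1 z.2.+1) (fun z => q z.2) (fun z => z.2.+1) C eps eta
  (fun z => bD _ _) (fun z x => DC _ _ x (ltn_ord z.1)) C0 (fun z => bmeas_meas (bq _)) (fun z => q01 _) eps0 eta0.
have [cV GV] := UP k0; set V := U k0 in hk0 cV GV.
(* The initial 1 makes the time wait for one mesh, until the noise [V] is known. *)
pose c (i : nat) (x : X) : R := if i is i'.+1 then ramp eps i (V x) (q i' x) else 1.
have c01 i x : 0 <= c i x <= 1.
  by case: i => [|i]; [rewrite ler01 lexx|exact: ramp01].
have cd i x : c i x < 1 -> c i.+1 x = 0.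
  by case: i => [|i]; [rewrite /c ltxx|apply: ramp_lt1].
have cc i : continuous (c i).
  by case: i => [|i]; [exact: cst_continuous|exact: continuous_ramp].
have bc i : bmeas (c i) by apply: bmeas01 => //; exact: (continuous_meas gX).
(* Coefficient i+1 combines [V], known at time h, with [q i], known at time $(i+1)h$. *)
have Gc i : (i < n)%N -> Gmeas (F (i%:R * mesh T n)) (c i).
  case: i => [|i] iin; first exact: Gmeas_cst.
  apply: Gmeas_ramp => //; last by case: (qP i) => _ [_]; exact.
  apply: GmeasS GV; apply: monoF; rewrite -[leLHS]mul1r ler_wpM2r ?(ltW h0)// ler1n//.
pose sigma := grid_time T n c.
have csigma : continuous sigma.
  apply: (@continuous_compT X R (time T)); last exact: clamp_time_continuous.
  apply: continuousMr; first exact: continuous_cstr.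
  by apply: continuous_sumr.
have [Q [RQ QE]] := stopping_law rho gX csigma (fun t => grid_time_stopping sF monoF n_gt0 c01 cd Gc).
exists Q => // k kN.
pose cP (i : nat) (w : Om) : R := if i is i'.+1 then 1 - \1_(tau_le (i'%:R * mesh T n)) w else 1.
have hP : `|Ex (law P) (sval (f k)) - (Ex rho (fun x => sval (f k) (x, grid T n 0)) +
     \sum_(0 <= i < n) Ex (law P) (fun w => D k i w.1 * cP i w))| <= e / 8.
  exact: (interp_law mP n_gt0 (hn k kN)).
have hQ : `|Ex (law Q) (sval (f k)) - (Ex rho (fun x => sval (f k) (x, grid T n 0)) +
     \sum_(0 <= i < n) Ex rho (fun x => D k i x * c i x))| <= e / 8.
  rewrite QE; last exact: (BC_bmeas (f k) (Om_cozero_base T gX)).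
  apply: (hn k kN _ X rho id sigma c) => //.
  - exact: (continuous_time_measurable gX).
  - by move=> i; exact: bmeas_meas.
  - by move=> x; rewrite val_grid_time// subrr normr0 mulr_gt0.
have term i : (i < n)%N -> `|Ex rho (fun x => D k i x * c i x) - Ex (law P) (fun w => D k i w.1 * cP i w)| <= 3 * eta.
  case: i => [|i] iin.
    rewrite [X in X - _](_ : _ = Ex rho (D k 0%N)); last first.
      by congr Ex; apply: funext => x; rewrite mulr1.
    have -> : Ex (law P) (fun w => D k 0%N w.1 * cP 0%N w) = Ex rho (D k 0%N).
      by rewrite -(Ex_marginal mP)//; congr Ex; apply: funext => x; rewrite mulr1.
    by rewrite subrr normr0; apply: mulr_ge0 => //; exact: ltW.
  have bA := @bmeas_indic _ _ R _ (@tau_le_measurable R d X T (i%:R * mesh T n)).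
  have bDf : bmeas (fun w : Om => D k i.+1 w.1) by exact: (bmeas_comp measurable_fst).
  have -> : Ex (law P) (fun w => D k i.+1 w.1 * cP i.+1 w) = Ex rho (fun x => D k i.+1 x * (1 - p i x)).
    transitivity (Ex (law P) (fun w => D k i.+1 w.1 - D k i.+1 w.1 * \1_(tau_le (i%:R * mesh T n)) w)).
      by congr Ex; apply: funext => w; rewrite /cP mulrBr mulr1.
    rewrite ExB//; last exact: bmeasM.
    rewrite pE// (Ex_marginal mP)// -ExB//; last exact: bmeasM.
    by congr Ex; apply: funext => x; rewrite mulrBr mulr1.
  have h1 := hk0 (Ordinal kN, Ordinal (ltnW iin)); rewrite /= in h1.
  have h2 : C * (i.+2%:R * eps) <= eta.
    rewrite (_ : _ * _ = eta * (i.+2%:R / n.+1%:R)); last by rewrite /eps; field; rewrite !gt_eqF ?ltr0n.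
    by rewrite ler_piMr ?(ltW eta0)// ler_pdivrMr ?ltr0n// mul1r ler_nat ltnW.
  have h3 : `|Ex rho (fun x => D k i.+1 x * (1 - q i x)) - Ex rho (fun x => D k i.+1 x * (1 - p i x))| <= eta.
    have b1 u : bmeas u -> bmeas (fun x => D k i.+1 x * (1 - u x)).
      by move=> bu; apply: bmeasM => //; apply: bmeasB => //; exact: bmeas_cst.
    have bqp : bmeas (fun x => `|q i x - p i x|) by apply: bmeas_norm; exact: bmeasB.
    rewrite -ExB; [|exact: b1..]; apply: le_trans (Ex_norm _ _) _.
      by apply: bmeasB; exact: b1.
    apply: (@le_trans _ _ (Ex rho (fun x => C * `|q i x - p i x|))).
      apply: Ex_le; [by apply: bmeas_norm; apply: bmeasB; exact: b1|exact: bmeasZ|].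
      move=> x; rewrite -mulrBr normrM (_ : 1 - q i x - (1 - p i x) = - (q i x - p i x)); last by ring.
      by rewrite normrN ler_wpM2r//; exact: DC.
    by rewrite ExZ// mulrC -ler_pdivlMr//; exact: qp.
  apply: le_trans (ler_distD (Ex rho (fun x => D k i.+1 x * (1 - q i x))) _ _) _.
  by apply: le_trans (lerD (le_trans h1 (lerD h2 (lexx _))) h3) _; lra.
set K0 := Ex rho _ in hP hQ; set SQ := \sum_(0 <= i < n) _ in hQ; set SP := \sum_(0 <= i < n) _ in hP.
have hS : `|SQ - SP| <= 3 * e / 8.
  rewrite /SQ /SP -sumrB; apply: le_trans (ler_norm_sum _ _ _) _.
  apply: (@le_trans _ _ (\sum_(0 <= i < n) 3 * eta)).
    by apply: ler_sum_nat => i /andP[_ iin]; exact: term.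
  rewrite sumr_const_nat subn0 -[leLHS]mulr_natr /eta le_eqVlt; apply/orP; left; apply/eqP.
  by field; rewrite gt_eqF.
apply: le_lt_trans (ler_distD (K0 + SQ) _ _) _.
apply: le_lt_trans (lerD hQ (ler_distD (K0 + SP) _ _)) _.
have E a b : K0 + a - (K0 + b) = a - b by ring.
rewrite E (distrC _ (Ex (law P) _)).
by apply: le_lt_trans (lerD (lexx _) (lerD hS hP)) _; lra.
Qed.

(** The sets that contain all laws passing finitely many tests form a filter converging to [P], so
    every neighbourhood of [P] contains such a set and [density_finite] applies. *)
Lemma adapted_closure_R0X : [set P | adapted_law F rho P] `<=` closure (@R0X R d X T F rho).
Proof.
move=> P aP V nV.
pose G : set_system (PM Om R) := fun W => exists N (f : nat -> BC Om R) (e : R), 0 < e /\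
  forall Q : PM Om R, (forall k, (k < N)%N -> `|Ex (law Q) (sval (f k)) - Ex (law P) (sval (f k))| < e) -> W Q.
have f0 : BC Om R.
  by exists (fun=> 0); split; [exact: cst_continuous|exists 0 => w; rewrite normr0].
have FG : Filter G.
  split.
  - by exists 0%N, (fun=> f0), 1.
  - move=> A B [N [f [e [e0 hA]]]] [N' [f' [e' [e'0 hB]]]].
    exists (N + N')%N, (fun k => if (k < N)%N then f k else f' (k - N)%N), (Num.min e e').
    rewrite lt_min e0 e'0; split => // Q hQ; split.
      apply: hA => k kN; have := hQ k (leq_trans kN (leq_addr _ _)).
      by rewrite kN lt_min => /andP[].
    apply: hB => k kN; have := hQ (N + k)%N; rewrite ltn_add2l kN => /(_ isT).
    by rewrite ltnNge leq_addr /= addKn lt_min => /andP[].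
  - by move=> A B AB [N [f [e [e0 hA]]]]; exists N, f, e; split => // Q /hA /AB.
have GP : G --> P.
  apply: (@PM_cvgP R _ Om G P FG) => f; apply/cvgrPdist_lt => e e0.
  exists 1%N, (fun=> f), e; split => // Q /(_ 0%N isT); rewrite distrC; exact.
have [N [f [e [e0 hV]]]] := GP V nV.
have [Q RQ Qf] := density_finite N f aP e0.
by exists Q; split => //; exact: hV.
Qed.

(** The event $\{\tau\le s\}$ agrees almost surely with an event of F_s, whose indicator is the
    required density. *)
Lemma R0X_adapted : @R0X R d X T F rho `<=` [set P | adapted_law F rho P].
Proof.
move=> P [mP [sP _]]; split => // s t s0 st tT.
have [|_ [[S FS <-] nS]] := sP s; first by rewrite s0 ltW// (lt_trans st).
rewrite setTI in nS.
have mS := mF FS; have bS := @bmeas_indic _ _ R _ mS.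
have mt := @tau_le_measurable R d X T s; have bt := @bmeas_indic _ _ R _ mt.
exists (\1_S); split.
- by apply: Gmeas_indic => //; exact: monoF (ltW st) _ FS.
- by move=> x; rewrite indicE; case: (_ \in _); rewrite ?lexx ?ler01.
move=> S' mS'; have bS' := @bmeas_indic _ _ R _ mS'.
have bfst (u : X -> R) : bmeas u -> bmeas (fun w : Om => u w.1) by exact: (bmeas_comp measurable_fst).
rewrite -(Ex_marginal mP); last exact: bmeasM.
apply: Ex_ae_eq; [by apply: bmeasM => //; exact: bfst|exact: (bfst _ (bmeasM bS' bS))|].
apply: negligibleS nS => w /= H; apply: contrapT => nw; apply: H.
have -> : \1_(tau_le s) w = \1_S w.1 :> R; last by rewrite mulrC.
have [tw|tw] := pselect (tau_le s w); have [sw|sw] := pselect (S w.1);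
  rewrite !indicE ?(mem_set tw) ?(mem_set sw) ?(memNset tw) ?(memNset sw)//.
- by case: nw; left.
- by case: nw; right.
Qed.
End density.

(** * Uniform variables from Brownian increments *)

Section integral_transform.
Context {R : realType} (N : probability (measurableTypeR R) R).

Definition cdf_of (r : R) : R := fine (N `]-oo, r]%classic).
Hypothesis cont_cdf : continuous cdf_of.

Let mray (r : R) : @measurable _ (measurableTypeR R) `]-oo, r]%classic. Proof. exact: measurable_itv. Qed.

Lemma cdf_of_nd (r r' : R) : r <= r' -> cdf_of r <= cdf_of r'.
Proof.
move=> rr; rewrite /cdf_of fine_le ?fin_num_measure//.
by rewrite le_measure ?inE//; exact: subitvPr.
Qed.

Lemma cdf_of_lt (e : R) : 0 < e -> exists r, cdf_of r < e.
Proof.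
move=> e0; have c : Ex N (\1_(`]-oo, - n%:R]%classic : set (measurableTypeR R))) @[n --> \oo] --> Ex N (fun=> 0).
  apply: (@Ex_cvg _ _ _ N _ _ 1).
  - by move=> n; apply: measurable_indic; exact: mray.
  - by move=> n x; rewrite indicE; case: (_ \in _); rewrite ?normr1 ?normr0.
  - move=> x; apply/cvgrPdist_lt => b b0; exists (Num.trunc (- x)).+1 => // n /= xn.
    rewrite indicE memNset ?subrr ?normr0//= in_itv /= => h.
    have := lt_le_trans (truncnS_gt (- x)) _; move=> /(_ n%:R); rewrite ler_nat xn => /(_ isT).
    by rewrite ltrNl ltNge h.
move/cvgrPdist_lt : c => /(_ _ e0) [n _ /(_ n (leqnn n)) /=].
rewrite Ex_cst Ex_indic// sub0r normrN => H; exists (- n%:R).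
exact: le_lt_trans (ler_norm _) H.
Qed.

Lemma cdf_of_gt (e : R) : e < 1 -> exists r, e < cdf_of r.
Proof.
move=> e1; have c : Ex N (\1_(`]-oo, n%:R]%classic : set (measurableTypeR R))) @[n --> \oo] --> Ex N (fun=> 1).
  apply: (@Ex_cvg _ _ _ N _ _ 1).
  - by move=> n; apply: measurable_indic; exact: mray.
  - by move=> n x; rewrite indicE; case: (_ \in _); rewrite ?normr1 ?normr0.
  - move=> x; apply/cvgrPdist_lt => b b0; exists (Num.trunc x).+1 => // n /= xn.
    rewrite indicE mem_set ?subrr ?normr0//= in_itv /=.
    by apply: le_trans (ltW (truncnS_gt x)) _; rewrite ler_nat.
have e10 : 0 < 1 - e by rewrite subr_gt0.
move/cvgrPdist_lt : c => /(_ _ e10) [n _ /(_ n (leqnn n)) /=].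
rewrite Ex_cst Ex_indic// => H; exists n%:R.
by have := le_lt_trans (ler_norm _) H; rewrite /cdf_of; lra.
Qed.

Lemma cdf_of_surj (b : R) : 0 < b -> b < 1 -> exists r, cdf_of r = b.
Proof.
move=> b0 b1; have [r rb] := cdf_of_lt b0; have [r' br'] := cdf_of_gt b1.
have rr' : r <= r'.
  by rewrite leNgt; apply/negP => /ltW /cdf_of_nd; rewrite leNgt (lt_trans rb br').
have [||c _ cE] := @IVT R cdf_of r r' b rr'; last by exists c.
  exact: continuous_subspaceT.
by rewrite (min_idPl _) ?(max_idPr _) ?(ltW rb) ?(ltW br') ?cdf_of_nd.
Qed.

Lemma cdf_of_measurable : measurable_fun setT (cdf_of : measurableTypeR R -> R).
Proof. exact: continuous_measurable_fun. Qed.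

(* The preimage of [0,b[ lies below any level of height [b] and contains the rays of smaller height. *)
Lemma cdf_of_uniform (a b : R) : 0 <= a -> a <= b -> b <= 1 ->
  fine (N (cdf_of @^-1` `[a, b[%classic)) = b - a.
Proof.
have mB (S : set R) : measurable S -> @measurable _ (measurableTypeR R) (cdf_of @^-1` S).
  by move=> mS; rewrite -[X in measurable X]setTI; exact: cdf_of_measurable.
have fN (S : set (measurableTypeR R)) : measurable S -> N S \is a fin_num by move=> mS; rewrite fin_num_measure.
have H (c : R) : 0 <= c -> c <= 1 -> fine (N (cdf_of @^-1` `]-oo, c[%classic)) = c.
  move=> c0 c1; apply/eqP; rewrite eq_le; apply/andP; split.
    have [->|cn0] := eqVneq c 0.
      rewrite (_ : _ @^-1` _ = set0) ?measure0//; apply/seteqP; split => x //=.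
      by rewrite in_itv /= ltNge /cdf_of fine_ge0.
    have {cn0} c_gt0 : 0 < c by rewrite lt_neqAle eq_sym cn0.
    have [->|cn1] := eqVneq c 1.
      by rewrite -[leRHS]/(fine 1%E) fine_le ?fN// ?probability_le1//; exact: mB.
    have {cn1} c_lt1 : c < 1 by rewrite lt_neqAle cn1.
    have [r rc] := cdf_of_surj c_gt0 c_lt1; rewrite -[leRHS]rc fine_le ?fN//; try exact: mB.
    rewrite le_measure ?inE//; first exact: mB.
    move=> x /=; rewrite !in_itv /= => xc; rewrite leNgt; apply/negP => /ltW /cdf_of_nd.
    by rewrite rc leNgt xc.
  rewrite leNgt; apply/negP => Hc.
  have N0 : 0 <= fine (N (cdf_of @^-1` `]-oo, c[%classic)) by rewrite fine_ge0.
  have [c' /andP[h1 h2]] : exists c', fine (N (cdf_of @^-1` `]-oo, c[%classic)) < c' < c.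
    by exists ((fine (N (cdf_of @^-1` `]-oo, c[%classic)) + c) / 2); rewrite !midf_lt.
  have [r rc] := cdf_of_surj (le_lt_trans N0 h1) (lt_le_trans h2 c1).
  move: h1; rewrite -rc ltNge => /negP; apply.
  rewrite /cdf_of fine_le ?fN//; try exact: mB.
  rewrite le_measure ?inE//; first exact: mB.
  move=> x /=; rewrite !in_itv /= => /cdf_of_nd; rewrite rc => h; exact: le_lt_trans h h2.
move=> a0 ab b1; have b0 := le_trans a0 ab; have a1 := le_trans ab b1.
rewrite -[in RHS](H a a0 a1) -[in RHS](H b b0 b1) -fineB ?fN//; try exact: mB.
congr fine; rewrite (_ : cdf_of @^-1` `[a, b[%classic = cdf_of @^-1` `]-oo, b[%classic `\` cdf_of @^-1` `]-oo, a[%classic); last first.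
  apply/seteqP; split => x /=; rewrite !in_itv /=.
    by move=> /andP[ax ->]; split => //; rewrite ltNge ax.
  by move=> [-> /negP]; rewrite -leNgt => ->.
rewrite measureD ?fN//; try exact: mB; last by rewrite ltey_eq fN//; exact: mB.
congr (_ - N _)%E; apply/seteqP; split => x /=; rewrite !in_itv /=; first by case.
by move=> xa; split => //; exact: lt_le_trans ab.
Qed.
End integral_transform.

Section normal_cdf.
Context {R : realType} (s : R).
Hypothesis s0 : s != 0.
Local Notation N := (normal_prob 0 s : probability (measurableTypeR R) R).

Lemma normal_prob_itv (x y : R) : x <= y -> (N `]x, y]%classic <= (normal_peak s * (y - x))%:E)%E.
Proof.
move=> xy; rewrite /= /normal_prob.
apply: (@le_trans _ _ (\int[lebesgue_measure]_(z in `]x, y]) (normal_peak s)%:E)%E).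
  apply: ge0_le_integral => //=.
  - by move=> z _; rewrite lee_fin normal_pdf_ge0.
  - by apply/measurable_EFinP/measurable_funTS; exact: measurable_normal_pdf.
  - by move=> z _; rewrite lee_fin normal_pdf_ub.
rewrite integral_cst//= lebesgue_measure_itv/= lte_fin.
by case: ltP => // _; rewrite mule0 lee_fin mulr_ge0 ?normal_peak_ge0// subr_ge0.
Qed.

(** The density is bounded by its peak value, so the distribution function is Lipschitz with that
    constant. *)
Lemma normal_cdf_continuous : continuous (cdf_of N).
Proof.
have lip (x y : R) : x <= y -> cdf_of N y - cdf_of N x <= normal_peak s * (y - x).
  move=> xy; have mr (r : R) : @measurable _ (measurableTypeR R) `]-oo, r]%classic by exact: measurable_itv.
  rewrite /cdf_of -fineB ?fin_num_measure//.
  rewrite -lee_fin fineK; last by rewrite fin_numB !fin_num_measure.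
  apply: le_trans (normal_prob_itv xy).
  have -> : `]x, y]%classic = `]-oo, y]%classic `\` `]-oo, x]%classic :> set R.
    apply/seteqP; split => z /=; rewrite !in_itv /=.
      by move=> /andP[xz ->]; split => //; apply/negP; rewrite -ltNge.
    by move=> [-> /negP]; rewrite -ltNge => ->.
  rewrite measureD; [|exact: mr|exact: mr|by rewrite ltey_eq fin_num_measure//; exact: mr].
  rewrite (_ : `]-oo, y]%classic `&` `]-oo, x]%classic = `]-oo, x]%classic)//.
  apply/seteqP; split => z /=; rewrite !in_itv /=; first by case.
  by move=> zx; split => //; exact: le_trans zx xy.
have K0 := normal_peak_gt0 s0.
move=> x; apply/cvgrPdist_lt => e e0; exists (e / normal_peak s); first by rewrite /= divr_gt0.
move=> y /= xy.
have H (a b : R) : a <= b -> `|a - b| < e / normal_peak s -> `|cdf_of N a - cdf_of N b| < e.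
  move=> ab; rewrite distrC ger0_norm ?subr_ge0// distrC ger0_norm ?subr_ge0 ?cdf_of_nd//.
  rewrite ltr_pdivlMr// mulrC; exact: le_lt_trans (lip _ _ ab).
case: (leP x y) => [/H|/ltW yx]; first exact.
by rewrite distrC; apply: H => //; rewrite distrC.
Qed.
End normal_cdf.

Section brownian_noise.
Context {R : realType} (T : {posnum R}) (rho : probability (Omega_in T) R).
Hypothesis W : std_wiener2 rho.
Local Notation time := (time T).
Variable h : R.
Hypothesis h0 : 0 < h.
Hypothesis hT : h <= T%:num.

(** Dyadic times decreasing to 0: the intervals between consecutive ones give infinitely many
    disjoint increments within $[0,h]$, however small h is. *)
Let s (k : nat) : time := clamp_time T (h / 2 ^+ k).

Let val_s k : val (s k) = h / 2 ^+ k.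
Proof.
apply: val_clamp_id; rewrite divr_ge0 ?(ltW h0) ?exprn_ge0//=.
apply: le_trans hT; rewrite ler_pdivrMr ?exprn_gt0// ler_peMr ?(ltW h0)//.
by rewrite exprn_ege1// ler1n.
Qed.

Let s_le k k' : (k <= k')%N -> val (s k') <= val (s k).
Proof.
move=> kk; rewrite !val_s ler_pM2l// lef_pV2 ?posrE ?exprn_gt0//.
by rewrite ler_eXn2l// ltr1n.
Qed.

Let s_lt k : val (s k.+1) < val (s k).
Proof. by rewrite !val_s ltr_pM2l// ltf_pV2 ?posrE ?exprn_gt0// ltr_eXn2l// ltr1n. Qed.

Let sd k : R := Num.sqrt (val (s k) - val (s k.+1)).
Let N k : probability (measurableTypeR R) R := normal_prob 0 (sd k).
Let dB k (x : Omega_in T) : R := Cev (Bin x) (s k) - Cev (Bin x) (s k.+1).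

(** The probability integral transform of a Brownian increment: uniform because the normal
    distribution function is continuous, and continuous in the path. *)
Definition noise (k : nat) (x : Omega_in T) : R := cdf_of (N k) (dB k x).

Let cont_cdf k : continuous (cdf_of (N k)).
Proof. by apply: normal_cdf_continuous; rewrite gt_eqF// sqrtr_gt0 subr_gt0; exact: s_lt. Qed.

Let dB_law k (A : set (Omega_in T)) (D : set R) : FBWmu_in (val (s k.+1)) A -> measurable D ->
  rho (A `&` (dB k @^-1` D)) = (rho A * N k D)%E.
Proof.
move=> FA mD; case: W => _ /(_ (s k.+1) (s k) (s_lt k) A FA D setT mD measurableT).
rewrite (_ : normal_prob _ _ setT = 1%E); last exact: (@probability_setT _ _ _ (N k)).
by rewrite mule1 => <-; congr (rho _); apply/seteqP; split => x [Ax] => [|[]].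
Qed.

Lemma noise_continuous k : continuous (noise k).
Proof.
apply: (@continuous_compT (Omega_in T) R R (dB k)); last exact: cont_cdf.
by apply: continuousBr; exact: Bin_continuous.
Qed.

Let noise_Gmeas' k t : val (s k) <= t -> Gmeas (@FBWmu_in R T t) (noise k).
Proof.
move=> kt; apply: (Gmeas_comp (FBWmu_in_sigma T t)); last exact: cdf_of_measurable.
apply: GmeasB; first exact: FBWmu_in_sigma.
  exact: Gmeas_Bin.
by apply: Gmeas_Bin; apply: le_trans kt; exact: ltW (s_lt k).
Qed.

Lemma noise_Gmeas k : Gmeas (@FBWmu_in R T h) (noise k).
Proof.
apply: noise_Gmeas'; rewrite val_s ler_pdivrMr ?exprn_gt0// ler_peMr ?(ltW h0)//.
by rewrite exprn_ege1// ler1n.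
Qed.

(** Larger indices belong to earlier intervals. For $k<k'$ the variable of index k' is known at time
    [s k.+1], where the increment of index k begins, so the independence of increments from the past
    applies. *)
Lemma noise_iid : iid_uniform rho noise.
Proof.
have mpre k (D : set R) : measurable D -> measurable (cdf_of (N k) @^-1` D : set R).
  by move=> mD; rewrite -[X in measurable X]setTI; exact: cdf_of_measurable.
have law k (D : set R) : measurable D -> rho (noise k @^-1` D) = N k (cdf_of (N k) @^-1` D).
  move=> mD; have := @dB_law k setT (cdf_of (N k) @^-1` D) _ (mpre k D mD).
  rewrite setTI probability_setT mul1e => <-//.
  exact: sigma_algebraT (FBWmu_in_sigma _ _).
have mnoise k : measurable_fun setT (noise k).
  by apply: Gmeas_meas (noise_Gmeas k); exact: FBWmu_in_measurable.
have mset k (D : set R) : measurable D -> measurable (noise k @^-1` D).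
  by move=> mD; rewrite -[X in measurable X]setTI; exact: mnoise.
split => //.
- move=> k a b a0 ab b1; rewrite Ex_indic; last by apply: mset; exact: measurable_itv.
  by rewrite law ?cdf_of_uniform//; exact: measurable_itv.
move=> k k' A B.
wlog kk : k k' A B / (k < k')%N.
  move=> H; rewrite neq_ltn => /orP[kk|kk] mA mB; first by apply: H => //; rewrite ltn_eqF.
  rewrite mulrC -(H k' k B A kk)//; last by rewrite ltn_eqF.
  by congr Ex; apply: funext => x; rewrite mulrC.
move=> _ mA mB.
rewrite (_ : (fun x => _) = \1_(noise k' @^-1` B `&` noise k @^-1` A)); last first.
  by apply: funext => x; rewrite indicI /= mulrC.
have mAk := mset k A mA; have mBk := mset k' B mB; have mI := measurableI _ _ mBk mAk.
rewrite !Ex_indic//.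
have := @dB_law k (noise k' @^-1` B) (cdf_of (N k) @^-1` A) _ (mpre k A mA).
rewrite -law// => ->; last by apply: (@noise_Gmeas' k'); [exact: s_le|].
rewrite fineM; first exact: mulrC.
  exact: (@fin_num_measure _ _ _ rho _ mBk).
exact: (@fin_num_measure _ _ _ rho _ mAk).
Qed.
End brownian_noise.

(** Collects what is used of the filtered input space. The Wiener hypothesis enters through the last
    premise: at every positive time the filtration already carries a sequence of continuous uniform
    variables. *)
Lemma relaxed_stopping_times {R : realType} {d} {X : topMeasType d} (T : {posnum R})
    (F : R -> set (set X)) (rho : probability X R) :
  cozero_base R X -> (forall t, sigma_algebra setT (F t)) ->
  (forall t S, F t S -> measurable S) -> (forall s t, s <= t -> F s `<=` F t) ->
  (forall t, F t `<=` <<s @cozeros R d X (F t) >>) ->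
  (forall h, 0 < h -> h <= T%:num ->
    exists U : nat -> X -> R, iid_uniform rho U /\ forall k, continuous (U k) /\ Gmeas (F h) (U k)) ->
  [/\ convexX (@RplusX R d X T F rho), compact (@RplusX R d X T F rho),
      @RplusX R d X T F rho = closure (@R0X R d X T F rho) &
      @RplusX R d X T F rho = @RrelX R d X T F rho].
Proof.
move=> gX sF mF monoF cozF noiseF.
rewrite (RplusXE T rho sF mF monoF) (RrelXE T rho sF mF); split => //.
- exact: (@convex_adapted R d X T F rho sF mF).
- exact: compact_adapted.
- apply/seteqP; split; first exact: adapted_closure_R0X.
  by apply: closure_adapted => //; exact: R0X_adapted.
Qed.

Theorem mainTheorem11 (R : realType) (T : {posnum R}) (rho : probability (Omega_in T) R) :
  std_wiener2 rho ->
  [/\ convex_PM (Rplus rho), compact (Rplus rho),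
      Rplus rho = closure (R0 rho) & Rplus rho = Rrel rho].
Proof.
move=> W.
have EP : Rplus rho = @RplusX R _ (Omega_in T) T (@FBWmu_in R T) rho by [].
have E0 : R0 rho = @R0X R _ (Omega_in T) T (@FBWmu_in R T) rho by [].
have Er : Rrel rho = @RrelX R _ (Omega_in T) T (@FBWmu_in R T) rho by [].
rewrite EP E0 Er.
apply: (@relaxed_stopping_times R _ (Omega_in T) T (@FBWmu_in R T) rho
  (Omega_in_cozero_base T) (FBWmu_in_sigma T) (@FBWmu_in_measurable R T)
  (@FBWmu_in_mono R T) (@FBWmu_in_cozeros R T)).
move=> h h0 hT; exists (@noise R T h); split; first exact: noise_iid.
by move=> k; split; [exact: noise_continuous|exact: noise_Gmeas].
Qed.
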